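(* Let $K$ be a field, let $n\ge 1$, let $Q$ be a quiver of type $\mathbb{A}_n$, and let $\Lambda=KQ/I$ with $I$ an admissible ideal of $KQ$. Put $$p=|\{i\mid i\text{ is a source in }Q\text{ with }2\le i\le n-1\}|,\qquad r=|\{i\mid i\text{ is a sink in }Q\text{ with }1\le i\le n\}|,$$ and, when $r\ge 2$, let $q=|\{i\mid i \text{ is a sink in } Q \text{ with } J_i\ne 0\}|$ be the number of non-zero sink ideals of $\Lambda$. Then the number of minimal right determiners of all irreducible morphisms between indecomposable modules in $\mathrm{mod}\,\Lambda$ is $$|\mathrm{Det}(\Lambda)|=\begin{cases}2n-2, & \text{if } r=1;\\ 2n-p-q-1, & \text{if } r\ge 2.\end{cases}$$
   Context: A quiver $Q$ is of type $\mathbb{A}_n$ if its underlying unoriented graph is the Dynkin diagram $1 - 2 - \cdots - n$ (vertices numbered consecutively; arrow $\alpha_i$ joins $i$ and $i+1$, with arbitrary orientation). $\mathrm{mod}\,\Lambda$ is the category of finitely generated left $\Lambda$-modules; paths are composed from right to left, so left $\Lambda$-modules are representations of $Q$ satisfying the relations in $I$. Minimal right determiner: an indecomposable projective module $P$ almost factors through $f:M\to N$ if there are morphisms $u:\mathrm{rad}\,P\to M$ and $h:P\to N$ with $h\iota=fu$, where $\iota:\mathrm{rad}\,P\to P$ is the inclusion, such that $\mathrm{Im}\,h\not\subseteq \mathrm{Im}\,f$. If $f:B\to C$ with $B=B_1\oplus B_2$, $B_1\subseteq\mathrm{Ker}\,f$ and $f|_{B_2}$ right minimal, then $\mathrm{Ker}\,f|_{B_2}$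 is the intrinsic kernel of $f$ (for an irreducible morphism it equals $\mathrm{Ker}\,f$). The minimal right determiner $C(f)$ of $f$ is the direct sum, one from each isomorphism class, of the indecomposable modules $\tau^{-1}X$ with $X$ an indecomposable direct summand of the intrinsic kernel of $f$ ($\tau$ the Auslander–Reiten translation) and of the indecomposable projective modules which almost factor through $f$. $\mathrm{Det}(\Lambda)$ is the set of (isomorphism classes of) modules $C(f)$, where $f$ runs over all irreducible morphisms between indecomposable modules in $\mathrm{mod}\,\Lambda$. Sink ideals: for $i<j$ let $\langle i,j\rangle$ be the subquiver of $Q$ between $i$ and $j$; it is linear if all its arrows point in the same direction. For a subquiver $Q'$ of $Q$ write $I|_{Q'}:=I\cap KQ'$. Assume $Q$ has at least two sinks and let $s_1<\cdots<s_p$ be the sources in $Q$ lying in $\{2,\dots,n-1\}$. For a sink $i$ of $Q$ the sink ideal $J_i$ is defined by: (1) $J_i=I|_{\langle 1,s_1\rangle}$ if $i=1$; (2) $J_i=I|_{\langle s_p,n\rangle}$ if $i=n$; (3) $J_i=I|_{\langle i,s_1\rangle}$ if $i\ne 1$ is the first sink and $\langle 1,i\rangle$ is linear; (4) $J_i=I|_{\langle s_p,i\rangle}$ if $i\neq n$ is the last sink and $\langle i,n\rangle$ is linear; (5) in all remaining cases $J_i=I|_{\langle s,s'\rangle}$, where $s<i<s'$ are the sources such that $\langle s,i\rangle$ and $\langle i,s'\rangle$ are linear; in this case (5), by convention, ''$J_i\ne 0$'' means that both $I|_{\langle s,i\rangle}$ and $I|_{\langle i,s'\rangle}$ are non-zero,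 and ''$J_i=0$'' means that at least one of $I|_{\langle s,i\rangle}$, $I|_{\langle i,s'\rangle}$ is zero. Every sink belongs to exactly one of these five cases. *)

(* Defs.v *)
From HB Require Import structures.
From mathcomp Require Import all_boot all_order all_algebra all_field.

Set Implicit Arguments.
Unset Strict Implicit.
Unset Printing Implicit Defensive.

Import GRing.Theory.
Local Open Scope ring_scope.

(* A quiver of type A_N with N = n + 1: the vertices 1, ..., N are           *)
(* represented by the ordinals 0, ..., n.  Two vertices are joined by at most *)
(* one arrow, so the arrows are given by a relation, [arrow i j] meaning      *)
(* i -> j.                                                                    *)
Structure quiverA (n : nat) := QuiverA {
  arrow :> rel 'I_n.+1;
  arrow_graph : forall i j : 'I_n.+1,
    arrow i j || arrow j i = (j == i.+1 :> nat) || (i == j.+1 :> nat);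
  arrow_simple : forall i j : 'I_n.+1, arrow i j -> ~~ arrow j i
}.

Section QuiverA.
Variables (n : nat) (Q : quiverA n).
Implicit Types i j s t : 'I_n.+1.

Definition is_source i : bool := [forall j, ~~ Q j i].
Definition is_sink i : bool := [forall j, ~~ Q i j].
Definition inner_source i : bool := is_source i && (0 < i < n)%N.

Definition num_inner_sources : nat := #|[pred i | inner_source i]|.
Definition num_sinks : nat := #|[pred i | is_sink i]|.

Definition linear_between i j : bool :=
  [forall k : 'I_n.+1, forall l : 'I_n.+1,
     [&& (i <= k)%N, l == k.+1 :> nat & (l <= j)%N] ==> Q k l]
  || [forall k : 'I_n.+1, forall l : 'I_n.+1,
     [&& (i <= k)%N, l == k.+1 :> nat & (l <= j)%N] ==> Q l k].

Definition first_inner_source s : bool :=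
  inner_source s && [forall t, inner_source t ==> (s <= t)%N].
Definition last_inner_source s : bool :=
  inner_source s && [forall t, inner_source t ==> (t <= s)%N].
Definition first_sink i : bool :=
  is_sink i && [forall t, is_sink t ==> (i <= t)%N].
Definition last_sink i : bool :=
  is_sink i && [forall t, is_sink t ==> (t <= i)%N].

(* A path is its start vertex followed by the list of the further vertices;   *)
(* bounding the length by n loses nothing, by [path_size].                    *)
Definition qpath : predArgType :=
  {p : 'I_n.+1 * n.-bseq 'I_n.+1 | path Q p.1 p.2}.

Definition psrc (p : qpath) : 'I_n.+1 := (val p).1.
Definition ptail (p : qpath) : seq 'I_n.+1 := (val p).2.
Definition ptgt (p : qpath) : 'I_n.+1 := last (psrc p) (ptail p).

Lemma step_up (x y : 'I_n.+1) : Q x y -> (y = x.+1 :> nat) \/ (x = y.+1 :> nat).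
Proof.
move=> xy; have := arrow_graph Q x y; rewrite xy /=.
by move/esym/orP=> [] /eqP; [left | right].
Qed.

Lemma path_size (x : 'I_n.+1) (s : seq 'I_n.+1) : path Q x s -> (size s <= n)%N.
Proof.
have up (y z : 'I_n.+1) (t : seq 'I_n.+1) : z = y.+1 :> nat -> path Q y (z :: t) ->
    last z t = (z + size t)%N :> nat.
  elim: t y z => [|w t IH] y z zy /=; first by rewrite addn0.
  case/and3P=> yz zw wt.
  have wz : w = z.+1 :> nat.
    case: (step_up zw) => // zw1; have yw : y = w.
      by apply/val_inj/succn_inj; rewrite /= -zw1 -zy.
    by move: zw; rewrite -yw (negPf (arrow_simple yz)).
  by rewrite (IH z w wz) /= ?zw // wz addSnnS.
have down (y z : 'I_n.+1) (t : seq 'I_n.+1) : y = z.+1 :> nat -> path Q y (z :: t) ->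
    (last z t + size t)%N = z :> nat.
  elim: t y z => [|w t IH] y z zy /=; first by rewrite addn0.
  case/and3P=> yz zw wt.
  have wz : z = w.+1 :> nat.
    case: (step_up zw) => // zw1; have yw : y = w.
      by apply: val_inj; rewrite /= zw1 zy.
    by move: zw; rewrite -yw (negPf (arrow_simple yz)).
  by rewrite addnS (IH z w wz) /= ?zw // -wz.
case: s => //= y s /andP[xy ys]; case: (step_up xy) => yx.
  have := up x y s yx; rewrite /= xy => /(_ ys) e.
  have := ltn_ord (last y s); rewrite e yx ltnS; apply: leq_trans.
  by rewrite addSn ltnS leq_addl.
have := down x y s yx; rewrite /= xy => /(_ ys) e.
have := ltn_ord x; rewrite ltnS yx; apply: leq_trans.
by rewrite ltnS -e leq_addl.
Qed.

(* p is the composite q r, where r is followed first. *)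
Definition is_comp (q r p : qpath) : bool :=
  [&& psrc p == psrc r, ptgt r == psrc q & ptail p == ptail r ++ ptail q].

Lemma qpath_inj (p q : qpath) : psrc p = psrc q -> ptail p = ptail q -> p = q.
Proof.
move=> e1 e2; apply: val_inj.
by rewrite [val p]surjective_pairing [val q]surjective_pairing;
   congr pair => //; apply: val_inj.
Qed.

Lemma qpathP (p : qpath) : path Q (psrc p) (ptail p).
Proof. exact: valP p. Qed.

Lemma qpath_ex (x : 'I_n.+1) (s : seq 'I_n.+1) : path Q x s -> {p : qpath | psrc p = x & ptail p = s}.
Proof.
move=> xs.
by exists (Sub (x, Bseq (path_size xs)) xs : qpath); rewrite /psrc /ptail SubK.
Qed.

Lemma is_comp_assoc (q1 q2 r p : qpath) :
  [exists q, is_comp q r p && is_comp q1 q2 q]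
  = [exists s, is_comp q1 s p && is_comp q2 r s].
Proof.
apply/existsP/existsP=> -[q] /andP[] /and3P[/eqP e1 /eqP e2 /eqP e3]
  /and3P[/eqP f1 /eqP f2 /eqP f3].
- have rs : path Q (psrc r) (ptail r ++ ptail q2).
    by rewrite cat_path qpathP -/(ptgt r) e2 f1 qpathP.
  have [s s1 s2] := qpath_ex rs; exists s.
  rewrite /is_comp /ptgt s1 s2 last_cat e1 -/(ptgt r) e2 f1 -/(ptgt q2) f2.
  by rewrite e3 f3 catA !eqxx.
- have rs : path Q (psrc q2) (ptail q2 ++ ptail q1).
    rewrite cat_path qpathP -/(ptgt q2).
    have -> : ptgt q2 = psrc q1; last exact: qpathP.
    by rewrite -e2 /ptgt f1 f3 last_cat -/(ptgt r) f2.
  have [s s1 s2] := qpath_ex rs; exists s.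
  rewrite /is_comp s1 s2 e1 f1 f2 e3 f3 catA !eqxx /=.
  by rewrite -e2 /ptgt f1 f3 last_cat -/(ptgt r) f2 eqxx.
Qed.

Lemma is_comp_inj (q r p p' : qpath) : is_comp q r p -> is_comp q r p' -> p = p'.
Proof.
move=> /and3P[/eqP e1 _ /eqP e3] /and3P[/eqP f1 _ /eqP f3].
by apply: qpath_inj; rewrite ?e1 ?e3.
Qed.

End QuiverA.

Definition pathalg (K : fieldType) n (Q : quiverA n) : Type :=
  {ffun qpath Q -> K^o}.

HB.instance Definition _ (K : fieldType) n (Q : quiverA n) :=
  GRing.Lmodule.on (pathalg K Q).
HB.instance Definition _ (K : fieldType) n (Q : quiverA n) :=
  Vector.on (pathalg K Q).

Section PathAlgebra.
Variables (K : fieldType) (n : nat) (Q : quiverA n).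
Local Notation KQ := (pathalg K Q).
Implicit Types (x y z : KQ) (p q r : qpath Q).

(* Products follow the right-to-left composition of paths. *)
Definition pathalg_mul x y : KQ :=
  [ffun p => \sum_q \sum_(r | is_comp q r p) x q * y r].
Definition pathalg_one : KQ := [ffun p => (ptail p == [::])%:R].
Definition pathv p : KQ := [ffun q => (q == p)%:R].

Let ind (b : bool) : K := b%:R.

Lemma pathalg_mulE x y p :
  pathalg_mul x y p = \sum_q \sum_r ind (is_comp q r p) * (x q * y r).
Proof.
rewrite ffunE; apply: eq_bigr => q _; rewrite big_mkcond; apply: eq_bigr => r _.
by rewrite /ind; case: ifP; rewrite ?mul1r ?mul0r.
Qed.

Lemma sum_ind (T : finType) (P : pred T) :
  (forall s t, P s -> P t -> s = t) ->
  \sum_s ind (P s) = ind [exists s, P s].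
Proof.
move=> Pu; case: (boolP [exists s, P s]) => [/existsP[s Ps]|/existsPn nP].
  rewrite (bigD1 s) //= Ps big1 ?addr0 // => t nts.
  by case Pt: (P t) => //; case/eqP: nts; apply: Pu.
by rewrite big1 // => s _; rewrite (negPf (nP s)).
Qed.

Lemma pathalg_mulA : associative pathalg_mul.
Proof.
move=> x y z; apply/ffunP=> p.
pose G q1 q2 r : K := x q1 * y q2 * z r.
transitivity (\sum_q1 \sum_q2 \sum_r
   ind [exists s, is_comp q1 s p && is_comp q2 r s] * G q1 q2 r).
  rewrite pathalg_mulE; apply: eq_bigr => q1 _.
  transitivity (\sum_s \sum_q2 \sum_r
     ind (is_comp q1 s p && is_comp q2 r s) * G q1 q2 r).
    apply: eq_bigr => s _; rewrite pathalg_mulE mulrA mulr_sumr.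
    apply: eq_bigr => q2 _; rewrite mulr_sumr; apply: eq_bigr => r _.
    by rewrite /ind /G -mulnb natrM mulrACA -[in RHS](mulrA (x q1)).
  rewrite exchange_big; apply: eq_bigr => q2 _.
  rewrite exchange_big; apply: eq_bigr => r _.
  rewrite -mulr_suml sum_ind // => s t /andP[_ h] /andP[_].
  exact: is_comp_inj h.
transitivity (\sum_r \sum_q1 \sum_q2
   ind [exists q, is_comp q r p && is_comp q1 q2 q] * G q1 q2 r).
  rewrite [RHS]exchange_big; apply: eq_bigr => q1 _.
  rewrite [RHS]exchange_big; apply: eq_bigr => q2 _.
  by apply: eq_bigr => r _; rewrite is_comp_assoc.
rewrite pathalg_mulE [RHS]exchange_big; apply: eq_bigr => r _.
transitivity (\sum_q \sum_q1 \sum_q2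
   ind (is_comp q r p && is_comp q1 q2 q) * G q1 q2 r).
  rewrite [RHS]exchange_big; apply: eq_bigr => q1 _.
  rewrite [RHS]exchange_big; apply: eq_bigr => q2 _.
  rewrite -mulr_suml sum_ind // => s t /andP[_ h] /andP[_].
  exact: is_comp_inj h.
apply: eq_bigr => q _; rewrite pathalg_mulE mulr_suml mulr_sumr.
apply: eq_bigr => q1 _; rewrite mulr_suml mulr_sumr; apply: eq_bigr => q2 _.
by rewrite /ind /G -mulnb natrM !mulrA.
Qed.

Lemma pathalg_mulDl : left_distributive pathalg_mul +%R.
Proof.
move=> x y z; apply/ffunP=> p; rewrite !ffunE -big_split; apply: eq_bigr => q _.
by rewrite -big_split; apply: eq_bigr => r _; rewrite !ffunE mulrDl.
Qed.

Lemma pathalg_mulDr : right_distributive pathalg_mul +%R.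
Proof.
move=> x y z; apply/ffunP=> p; rewrite !ffunE -big_split; apply: eq_bigr => q _.
by rewrite -big_split; apply: eq_bigr => r _; rewrite !ffunE mulrDr.
Qed.

Lemma trivial_path (i : 'I_n.+1) : {p : qpath Q | psrc p = i & ptail p = [::]}.
Proof. exact: qpath_ex. Qed.

Lemma pathalg_mul1x : left_id pathalg_one pathalg_mul.
Proof.
move=> x; apply/ffunP=> p; rewrite ffunE.
have [e e1 e2] := trivial_path (ptgt p).
have ep : is_comp e p p by rewrite /is_comp e1 e2 cats0 !eqxx.
rewrite (bigD1 e) //= (bigD1 p) //= ffunE e2 eqxx mul1r.
rewrite big1 ?addr0 => [|r /andP[/and3P[/eqP h1 _ /eqP h3] /eqP nrp]]; last first.
  by case: nrp; apply: qpath_inj; rewrite ?h1 // h3 e2 cats0.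
rewrite big1 ?addr0 // => q nqe; apply: big1 => r /and3P[/eqP h1 /eqP h2 /eqP h3].
rewrite ffunE; case: eqP => [q0|_]; last by rewrite mul0r.
case/eqP: nqe; apply: qpath_inj; rewrite ?e1 ?e2 //.
by rewrite -h2 /ptgt h1 h3 q0 cats0.
Qed.

Lemma pathalg_mulx1 : right_id pathalg_one pathalg_mul.
Proof.
move=> x; apply/ffunP=> p; rewrite ffunE.
have [e e1 e2] := trivial_path (psrc p).
have ep : is_comp p e p by rewrite /is_comp /ptgt e1 e2 !eqxx.
rewrite (bigD1 p) //= (bigD1 e) //= ffunE e2 eqxx mulr1.
rewrite big1 ?addr0 => [|r /andP[/and3P[/eqP h1 _ /eqP h3] /eqP nre]]; last first.
  rewrite ffunE; case: eqP => [r0|_]; last by rewrite mulr0.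
  by case: nre; apply: qpath_inj; rewrite ?e1 ?e2 ?h1.
rewrite big1 ?addr0 // => q nqp; apply: big1 => r /and3P[/eqP h1 /eqP h2 /eqP h3].
rewrite ffunE; case: eqP => [r0|_]; last by rewrite mulr0.
by case/eqP: nqp; apply: qpath_inj; rewrite ?h1 -?h2 ?h3 /ptgt ?r0.
Qed.

Lemma pathalg_1neq0 : pathalg_one != 0.
Proof.
apply/eqP=> /ffunP; have [e _ e2] := trivial_path ord0 => /(_ e).
by rewrite !ffunE e2 eqxx => /eqP; rewrite oner_eq0.
Qed.

HB.instance Definition _ := GRing.Zmodule_isNzRing.Build KQ
  pathalg_mulA pathalg_mul1x pathalg_mulx1 pathalg_mulDl pathalg_mulDr
  pathalg_1neq0.

Lemma pathalg_scaleAl (a : K) x y : a *: (x * y) = (a *: x) * y.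
Proof.
apply/ffunP=> p; rewrite !ffunE scaler_sumr; apply: eq_bigr => q _.
by rewrite scaler_sumr; apply: eq_bigr => r _; rewrite !ffunE scalerAl.
Qed.

HB.instance Definition _ := GRing.Lmodule_isLalgebra.Build K KQ pathalg_scaleAl.

Lemma pathalg_scaleAr (a : K) x y : a *: (x * y) = x * (a *: y).
Proof.
apply/ffunP=> p; rewrite !ffunE scaler_sumr; apply: eq_bigr => q _.
by rewrite scaler_sumr; apply: eq_bigr => r _; rewrite !ffunE scalerAr.
Qed.

HB.instance Definition _ := GRing.Lalgebra_isAlgebra.Build K KQ pathalg_scaleAr.
HB.instance Definition _ := Algebra_isFalgebra.Build K KQ.

Definition arrow_ideal : {vspace KQ} :=
  (fullv * <<[seq pathv p | p <- enum (qpath Q) & size (ptail p) == 1%N]>>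
   * fullv)%VS.

Definition two_sided_ideal (I : {vspace KQ}) : bool :=
  (fullv * I <= I)%VS && (I * fullv <= I)%VS.

Definition admissible (I : {vspace KQ}) : Prop :=
  two_sided_ideal I /\
  exists2 m : nat, (2 <= m)%N &
    (arrow_ideal ^+ m <= I)%VS && (I <= arrow_ideal ^+ 2)%VS.

Definition pathalg_between (i j : 'I_n.+1) : {vspace KQ} :=
  <<[seq pathv p | p <- enum (qpath Q) &
       all (fun v : 'I_n.+1 => (i <= v <= j)%N) (psrc p :: ptail p)]>>%VS.

Definition restrict_ideal (I : {vspace KQ}) (i j : 'I_n.+1) : {vspace KQ} :=
  (I :&: pathalg_between i j)%VS.

(* The condition J_i <> 0, meaningful for a sink i of a quiver with at least  *)
(* two sinks; in the last case both halves of J_i have to be non-zero.        *)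
Definition sink_ideal_neq0 (I : {vspace KQ}) (i : 'I_n.+1) : bool :=
  if i == ord0 then
    [exists s, first_inner_source Q s && (restrict_ideal I i s != 0%VS)]
  else if i == ord_max then
    [exists s, last_inner_source Q s && (restrict_ideal I s i != 0%VS)]
  else if first_sink Q i && linear_between Q ord0 i then
    [exists s, first_inner_source Q s && (restrict_ideal I i s != 0%VS)]
  else if last_sink Q i && linear_between Q i ord_max then
    [exists s, last_inner_source Q s && (restrict_ideal I s i != 0%VS)]
  else
    [exists s, exists s' : 'I_n.+1,
      [&& is_source Q s, is_source Q s', (s < i < s')%N,
          linear_between Q s i, linear_between Q i s',
          restrict_ideal I s i != 0%VS & restrict_ideal I i s' != 0%VS]].

Definition num_nonzero_sink_ideals (I : {vspace KQ}) : nat :=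
  #|[pred i | is_sink Q i && sink_ideal_neq0 I i]|.

Definition coef_path p : KQ -> K^o := fun x => x p.

Lemma coef_path_is_linear p : linear (coef_path p).
Proof. by move=> a x y; rewrite /coef_path !ffunE. Qed.

HB.instance Definition _ p := GRing.isLinear.Build K KQ K^o _ (coef_path p)
  (coef_path_is_linear p).

Lemma mul_trivial_path x y p : ptail p = [::] -> (x * y) p = x p * y p.
Proof.
move=> p0; have pp : is_comp p p p by rewrite /is_comp /ptgt p0 !eqxx.
have only q r : is_comp q r p -> q = p /\ r = p.
  case/and3P=> /eqP h1 /eqP h2 /eqP; rewrite p0.
  case r0: (ptail r) => // /= q0; move: h2; rewrite /ptgt r0 /= => h2.
  by split; apply: qpath_inj; rewrite ?p0 // h1.
rewrite ffunE (bigD1 p) //= (bigD1 p) //= big1 ?addr0 => [|r /andP[]]; last first.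
  by case/only=> _ ->; rewrite eqxx.
rewrite big1 ?addr0 // => q nqp; apply: big1 => r /only[qp].
by rewrite qp eqxx in nqp.
Qed.

Lemma arrow_ideal_trivial_path p :
  ptail p = [::] -> (arrow_ideal <= lker (linfun (coef_path p)))%VS.
Proof.
move=> p0; pose W := lker (linfun (coef_path p)).
have WE x : (x \in W) = (x p == 0) by rewrite memv_ker lfunE.
apply/prodvP=> x y xA _; rewrite -/W WE mul_trivial_path //.
suff /eqP -> : x p == 0 by rewrite mul0r.
rewrite -WE; apply: subvP x xA; apply/prodvP=> x a _ aA.
rewrite WE mul_trivial_path //.
suff /eqP -> : a p == 0 by rewrite mulr0.
rewrite -WE; apply: subvP a aA; apply/span_subvP=> _ /mapP[q + ->].
rewrite mem_filter WE ffunE => /andP[q1 _].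
by case e: (p == q) => //; move: q1; rewrite -(eqP e) p0.
Qed.

Lemma expv_trivial_path m p :
  ptail p = [::] -> (arrow_ideal ^+ m.+1 <= lker (linfun (coef_path p)))%VS.
Proof.
move=> p0; rewrite expvSl; apply/prodvP=> x y /(subvP (arrow_ideal_trivial_path p0)).
by rewrite !memv_ker !lfunE /= /coef_path mul_trivial_path // => /eqP->; rewrite mul0r.
Qed.

End PathAlgebra.

Structure admissible_ideal (K : fieldType) n (Q : quiverA n) := AdmissibleIdeal {
  ideal_vspace :> {vspace pathalg K Q};
  ideal_admissible : admissible ideal_vspace
}.

Section BoundQuiverAlgebra.
Variables (K : fieldType) (n : nat) (Q : quiverA n) (I : admissible_ideal K Q).
Local Notation KQ := (pathalg K Q).
Local Open Scope quotient_scope.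

Definition bqalg : Type := Quotient.quot (pred_of_vspace I).

HB.instance Definition _ := GRing.Zmodule.on bqalg.
HB.instance Definition _ := EqQuotient.on bqalg.

Definition bqproj (x : KQ) : bqalg := \pi_bqalg x.

Lemma bqproj_eq (x y : KQ) :
  (bqproj x = bqproj y) <-> (x - y \in (I : {vspace KQ})).
Proof.
have e := Quotient.idealrBE (pred_of_vspace I) x y.
split=> [h|h]; last by apply/eqP; move: e; rewrite h.
by apply: (etrans e); apply/eqP.
Qed.

Lemma bqproj_repr (a : bqalg) : bqproj (repr a) = a.
Proof. exact: reprK. Qed.

Lemma bqprojP (a : bqalg) : {x : KQ | a = bqproj x}.
Proof. by exists (repr a); rewrite bqproj_repr. Qed.

Lemma bqprojD (x y : KQ) : bqproj (x + y) = bqproj x + bqproj y.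
Proof. exact: (Quotient.pi_add (pred_of_vspace I) x y). Qed.

Lemma bqideal_mull (x y : KQ) : y \in (I : {vspace KQ}) -> x * y \in (I : {vspace KQ}).
Proof.
have [/andP[h _] _] := ideal_admissible I => yI.
by apply: (subvP h); apply: memv_mul; rewrite ?memvf.
Qed.

Lemma bqideal_mulr (x y : KQ) : x \in (I : {vspace KQ}) -> x * y \in (I : {vspace KQ}).
Proof.
have [/andP[_ h] _] := ideal_admissible I => xI.
by apply: (subvP h); apply: memv_mul; rewrite ?memvf.
Qed.

Lemma bqproj_reprB (x : KQ) : repr (bqproj x) - x \in (I : {vspace KQ}).
Proof. by apply/bqproj_eq; rewrite bqproj_repr. Qed.

Definition bqalg_one : bqalg := bqproj 1.
Definition bqalg_mul (a b : bqalg) : bqalg := bqproj (repr a * repr b).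
Definition bqalg_scale (c : K) (a : bqalg) : bqalg := bqproj (c *: repr a).

Lemma bqalg_mulE (x y : KQ) : bqalg_mul (bqproj x) (bqproj y) = bqproj (x * y).
Proof.
apply/bqproj_eq; set x' := repr _; set y' := repr _.
rewrite -[x' * y'](subrK (x' * y)) -addrA -mulrBr -mulrBl.
by apply: rpredD; [apply: bqideal_mull | apply: bqideal_mulr]; apply: bqproj_reprB.
Qed.

Lemma bqalg_scaleE c (x : KQ) : bqalg_scale c (bqproj x) = bqproj (c *: x).
Proof. by apply/bqproj_eq; rewrite -scalerBr rpredZ ?bqproj_reprB. Qed.

Lemma bqalg_mulA : associative bqalg_mul.
Proof.
move=> a b c; have [[[x ->] [y ->]] [z ->]] := (bqprojP a, bqprojP b, bqprojP c).
by rewrite (bqalg_mulE y z) (bqalg_mulE x y) 2!bqalg_mulE mulrA.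
Qed.

Lemma bqalg_mul1x : left_id bqalg_one bqalg_mul.
Proof. by move=> a; have [x ->] := bqprojP a; rewrite (bqalg_mulE 1 x) mul1r. Qed.

Lemma bqalg_mulx1 : right_id bqalg_one bqalg_mul.
Proof. by move=> a; have [x ->] := bqprojP a; rewrite (bqalg_mulE x 1) mulr1. Qed.

Lemma bqalg_mulDl : left_distributive bqalg_mul +%R.
Proof.
move=> a b c; have [[[x ->] [y ->]] [z ->]] := (bqprojP a, bqprojP b, bqprojP c).
by rewrite -bqprojD (bqalg_mulE x z) (bqalg_mulE y z) bqalg_mulE -bqprojD mulrDl.
Qed.

Lemma bqalg_mulDr : right_distributive bqalg_mul +%R.
Proof.
move=> a b c; have [[[x ->] [y ->]] [z ->]] := (bqprojP a, bqprojP b, bqprojP c).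
by rewrite -bqprojD (bqalg_mulE x z) (bqalg_mulE x y) bqalg_mulE -bqprojD mulrDr.
Qed.

Lemma bqalg_1neq0 : bqalg_one != 0.
Proof.
have [e _ e2] := trivial_path Q ord0.
apply/eqP=> h; have : (1 : KQ) - 0 \in (I : {vspace KQ}).
  by apply/bqproj_eq; rewrite -/bqalg_one h; apply/esym/(addrI (bqproj 0));
     rewrite -bqprojD !addr0.
have [_ [m _ /andP[_ /subvP h2]]] := ideal_admissible I.
rewrite subr0 => /h2 /(subvP (expv_trivial_path K 1 e2)).
have one_e : (1 : KQ) e = 1 by rewrite [LHS]ffunE e2.
rewrite memv_ker lfunE => /eqP e0.
by have := oner_neq0 K; rewrite -[1]one_e [X in X != _]e0 eqxx.
Qed.

HB.instance Definition _ := GRing.Zmodule_isNzRing.Build bqalg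
  bqalg_mulA bqalg_mul1x bqalg_mulx1 bqalg_mulDl bqalg_mulDr bqalg_1neq0.

Lemma bqalg_scaleA c d a : bqalg_scale c (bqalg_scale d a) = bqalg_scale (c * d) a.
Proof.
have [x ->] := bqprojP a.
by rewrite (bqalg_scaleE d x) (bqalg_scaleE c) bqalg_scaleE scalerA.
Qed.

Lemma bqalg_scale1 : left_id 1 bqalg_scale.
Proof. by move=> a; have [x ->] := bqprojP a; rewrite (bqalg_scaleE 1 x) scale1r. Qed.

Lemma bqalg_scaleDr : right_distributive bqalg_scale +%R.
Proof.
move=> c a b; have [[x ->] [y ->]] := (bqprojP a, bqprojP b).
by rewrite -bqprojD (bqalg_scaleE c x) (bqalg_scaleE c y) bqalg_scaleE -bqprojD scalerDr.
Qed.

Lemma bqalg_scaleDl a : {morph bqalg_scale^~ a : c d / c + d}.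
Proof.
move=> c d; have [x ->] := bqprojP a.
by rewrite (bqalg_scaleE c x) (bqalg_scaleE d x) (bqalg_scaleE _ x) -bqprojD scalerDl.
Qed.

HB.instance Definition _ := GRing.Zmodule_isLmodule.Build K bqalg
  bqalg_scaleA bqalg_scale1 bqalg_scaleDr bqalg_scaleDl.

Lemma bqprojM (x y : KQ) : bqproj (x * y) = bqproj x * bqproj y.
Proof. by rewrite -bqalg_mulE. Qed.

Lemma bqprojZ (c : K) (x : KQ) : bqproj (c *: x) = c *: bqproj x.
Proof. by rewrite -bqalg_scaleE. Qed.

Lemma bqalg_scaleAl (c : K) (a b : bqalg) : c *: (a * b) = (c *: a) * b.
Proof.
have [[x ->] [y ->]] := (bqprojP a, bqprojP b).
by rewrite -bqprojM -!bqprojZ -bqprojM scalerAl.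
Qed.

HB.instance Definition _ := GRing.Lmodule_isLalgebra.Build K bqalg bqalg_scaleAl.

Lemma bqalg_scaleAr (c : K) (a b : bqalg) : c *: (a * b) = a * (c *: b).
Proof.
have [[x ->] [y ->]] := (bqprojP a, bqprojP b).
by rewrite -bqprojM -!bqprojZ -bqprojM scalerAr.
Qed.

HB.instance Definition _ := GRing.Lalgebra_isAlgebra.Build K bqalg bqalg_scaleAr.

End BoundQuiverAlgebra.

Section Modules.
Variable R : nzRingType.
Implicit Types M N P X Y Z : lmodType R.

Definition finitely_generated M : Prop :=
  exists (m : nat) (g : 'I_m -> M),
    forall x, exists c : 'I_m -> R, x = \sum_i c i *: g i.

Definition zero_module M : Prop := forall x : M, x = 0.

Definition surjective_map (U V : Type) (f : U -> V) : Prop :=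
  forall y, exists x, f x = y.

Definition isomorphic M N : Prop := exists f : {linear M -> N}, bijective f.

Definition summand X M : Prop := exists Y, isomorphic M (X * Y)%type.

Definition indecomposable M : Prop :=
  ~ zero_module M /\
  forall X Y, isomorphic M (X * Y)%type -> zero_module X \/ zero_module Y.

Definition is_direct_sum (m : nat) (Y : 'I_m -> lmodType R) (C : lmodType R) : Prop :=
  exists inj : forall i, {linear Y i -> C},
    (forall x, exists y : forall i, Y i, x = \sum_i inj i (y i)) /\
    (forall y : forall i, Y i, \sum_i inj i (y i) = 0 -> forall i, y i = 0).

Definition is_kernel X M N (k : {linear X -> M}) (f : {linear M -> N}) : Prop :=
  injective k /\ forall x, f x = 0 <-> exists y, k y = x.

Definition submodule M (S : M -> Prop) : Prop :=
  S 0 /\ forall (a : R) (x y : M), S x -> S y -> S (a *: x + y).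

Definition maximal_submodule M (S : M -> Prop) : Prop :=
  [/\ submodule S, ~ (forall x, S x) &
      forall T : M -> Prop, submodule T -> (forall x, S x -> T x) ->
        (forall x, T x -> S x) \/ (forall x, T x)].

Definition radical M (x : M) : Prop :=
  forall S : M -> Prop, maximal_submodule S -> S x.

Definition projective P : Prop :=
  forall M N (g : {linear M -> N}) (h : {linear P -> N}),
    surjective_map g -> exists h' : {linear P -> M}, forall x, h x = g (h' x).

Definition superfluous_kernel M N (f : {linear M -> N}) : Prop :=
  forall S : M -> Prop, submodule S ->
    (forall x, exists s k, [/\ S s, f k = 0 & x = s + k]) -> forall x, S x.

Definition minimal_projective_presentation P1 P0 M
    (d : {linear P1 -> P0}) (e : {linear P0 -> M}) : Prop :=
  [/\ projective P1 /\ projective P0,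
      surjective_map e,
      forall x, e x = 0 <-> exists y, d y = x
    & superfluous_kernel e /\ superfluous_kernel d].

Definition split_mono M N (f : {linear M -> N}) : Prop :=
  exists g : {linear N -> M}, cancel f g.
Definition split_epi M N (f : {linear M -> N}) : Prop :=
  exists g : {linear N -> M}, cancel g f.

Definition irreducible_morphism M N (f : {linear M -> N}) : Prop :=
  [/\ ~ split_mono f, ~ split_epi f &
      forall Z (h : {linear M -> Z}) (g : {linear Z -> N}),
        finitely_generated Z -> (forall x, f x = g (h x)) ->
        split_mono h \/ split_epi g].

Definition right_minimal M N (f : {linear M -> N}) : Prop :=
  forall g : {linear M -> M}, (forall x, f (g x) = f x) -> bijective g.

(* X is isomorphic to the intrinsic kernel of f. *)
Definition intrinsic_kernel M N (f : {linear M -> N}) X : Prop :=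
  exists (B1 B2 : lmodType R) (phi : {linear (B1 * B2)%type -> M})
         (f2 : {linear B2 -> N}) (k : {linear X -> B2}),
    [/\ bijective phi,
        forall b1, f (phi (b1, 0)) = 0,
        forall b2, f2 b2 = f (phi (0, b2)),
        right_minimal f2
      & is_kernel k f2].

(* i is the inclusion of rad P in P. *)
Definition almost_factors P M N (f : {linear M -> N}) : Prop :=
  exists (radP : lmodType R) (i : {linear radP -> P})
         (u : {linear radP -> M}) (h : {linear P -> N}),
    [/\ injective i,
        forall x, radical x <-> exists y, i y = x,
        forall y, h (i y) = f (u y)
      & ~ (forall x, exists m, h x = f m)].

(* The set of isomorphism classes of modules satisfying Pm has m elements. *)
Definition num_iso_classes (Pm : lmodType R -> Prop) (m : nat) : Prop :=
  exists C : 'I_m -> lmodType R,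
    [/\ forall i, Pm (C i),
        forall i j, isomorphic (C i) (C j) -> i = j
      & forall M, Pm M -> exists i, isomorphic M (C i)].

End Modules.

(* Right A-modules are left modules over the converse algebra A^c, so that    *)
(* z a is written (a : A^c) *: z.                                             *)
Section AlgebraModules.
Variables (K : fieldType) (A : algType K).

(* Z is isomorphic to D X = Hom_K(X, K), with (z a)(x) = z(a x); ev is the  *)
(* isomorphism.  K acts on X through K -> A.                                *)
Definition is_dual (X : lmodType A) (Z : lmodType A^c) : Prop :=
  exists ev : Z -> X -> K,
    [/\ forall z (c : K) x y, ev z (c%:A *: x + y) = c * ev z x + ev z y,
        forall z z' x, ev (z + z') x = ev z x + ev z' x,
        forall (a : A) z x, ev ((a : A^c) *: z) x = ev z (a *: x),
        forall z z', (forall x, ev z x = ev z' x) -> z = z'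
      & forall phi : X -> K,
          (forall (c : K) x y, phi (c%:A *: x + y) = c * phi x + phi y) ->
          exists z, forall x, ev z x = phi x].

Definition right_linear_form (P : lmodType A^c) (phi : P -> A) : Prop :=
  (forall x y, phi (x + y) = phi x + phi y) /\
  (forall (a : A) x, phi ((a : A^c) *: x) = phi x * a).

(* ev is an isomorphism from L to Hom(P, A), with (a phi)(x) = a phi(x). *)
Definition is_hom_to_algebra (P : lmodType A^c) (L : lmodType A)
    (ev : L -> P -> A) : Prop :=
  [/\ forall l, right_linear_form (ev l),
      forall (a : A) l l' x, ev (a *: l + l') x = a * ev l x + ev l' x,
      forall l l', (forall x, ev l x = ev l' x) -> l = l'
    & forall phi, right_linear_form phi ->
        exists l, forall x, ev l x = phi x].

(* Y is isomorphic to Tr Z, the cokernel of Hom(d, A) for a minimal         *)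
(* projective presentation (d, e) of Z.                                     *)
Definition is_transpose (Z : lmodType A^c) (Y : lmodType A) : Prop :=
  exists (P1 P0 : lmodType A^c) (d : {linear P1 -> P0}) (e : {linear P0 -> Z})
         (L0 L1 : lmodType A) (ev0 : L0 -> P0 -> A) (ev1 : L1 -> P1 -> A)
         (dstar : {linear L0 -> L1}) (c : {linear L1 -> Y}),
    [/\ minimal_projective_presentation d e,
        is_hom_to_algebra ev0 /\ is_hom_to_algebra ev1,
        forall l x, ev1 (dstar l) x = ev0 l (d x),
        surjective_map c
      & forall l, c l = 0 <-> exists l0, dstar l0 = l].

(* Y is isomorphic to tau^{-1} X = Tr D X. *)
Definition is_inverse_AR_translate (X Y : lmodType A) : Prop :=
  exists Z : lmodType A^c, is_dual X Z /\ is_transpose Z Y.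

Definition determiner_summand (M N : lmodType A) (f : {linear M -> N})
    (Y : lmodType A) : Prop :=
  indecomposable Y /\
  ((exists X Ker : lmodType A,
      [/\ intrinsic_kernel f Ker, indecomposable X, summand X Ker
        & is_inverse_AR_translate X Y])
   \/ [/\ finitely_generated Y, projective Y & almost_factors Y f]).

(* C is isomorphic to C(f). *)
Definition is_minimal_right_determiner (M N : lmodType A)
    (f : {linear M -> N}) (C : lmodType A) : Prop :=
  exists (m : nat) (Y : 'I_m -> lmodType A),
    [/\ forall i, determiner_summand f (Y i),
        forall i j, isomorphic (Y i) (Y j) -> i = j,
        forall Y', determiner_summand f Y' -> exists i, isomorphic Y' (Y i)
      & is_direct_sum Y C].

Definition in_Det (C : lmodType A) : Prop :=
  exists (M N : lmodType A) (f : {linear M -> N}),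
    [/\ finitely_generated M /\ finitely_generated N,
        indecomposable M /\ indecomposable N,
        irreducible_morphism f
      & is_minimal_right_determiner f C].

End AlgebraModules.

(* Main.v *)
Require Import Defs.
From HB Require Import structures.
From mathcomp Require Import all_boot all_order all_algebra all_field.
From mathcomp Require Import boolp zify.

(* The indecomposable modules are the modules thin S of dimension one at each *)
(* vertex of an interval S: moving to the right from the leftmost vertex of   *)
(* the support of a module, the images and kernels of the arrows single out   *)
(* an interval summand.  Morphisms between such modules are multiples of the  *)
(* obvious ones, so an irreducible morphism is, up to isomorphism, the        *)
(* inclusion of thin S in thin T, with T - S = V s t, or the projection of    *)
(* thin S onto thin T, with S - T = U s t, for an arrow s -> t; here V s t is *)
(* the maximal non-zero path starting at s and leaving t aside, and U s t     *)
(* the maximal non-zero path ending at t and leaving s aside.  Conversely,    *)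
(* thin (U s t) -> thin (U s t + V s t) -> thin (V s t) are irreducible.      *)
(* In the epimorphic case the determiner is tau^-1 (thin (U s t)) =           *)
(* thin (V s t): there is one for each of the n arrows.  In the monomorphic   *)
(* case it is the projective module at the last vertex of V s t.  All         *)
(* vertices occur as last vertices, except for the inner sources and for the  *)
(* sinks that no non-zero path joins to an inner source; when there are two   *)
(* sinks or more, these are the sinks with a non-zero sink ideal.             *)

Set Implicit Arguments.
Unset Strict Implicit.
Unset Printing Implicit Defensive.

Import GRing.Theory.
Local Open Scope ring_scope.

(** * Modules *)

(** A path of $Q$ is determined by its two ends, so an admissible ideal is spanned by paths
    ([pcoef_ideal]), and the algebra is described by the relation [nz] telling which paths survive.
    Its indecomposable modules are interval modules [thin S] ([indecomposable_thin_iso]), and a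
    morphism between two of them is a multiple of the natural one ([thin_hom]). Questions about
    irreducible morphisms thus become questions about pairs of intervals.

    The natural map from [thin S] to [thin R] has image [thin (S :&: R)], so an irreducible one is
    injective or surjective. By [irreducible_pair] its cokernel, respectively its kernel, is
    [thin (Vset s t)], respectively [thin (Uset s t)], for an arrow $s\to t$. Joining the two
    intervals along the arrow gives [Nset], and the maps $U\to N\to V$ realize every arrow in both
    ways ([irreducible_Uset_Nset], [irreducible_Nset_Vset]).

    No projective almost factors through a surjection, so in that case the determiner is $\tau^{-1}$
    of the kernel [thin (Uset s t)]. The dual of this kernel is presented by the projective right
    modules at $s$ and $t$; transposing gives $P_t\to P_s$, whose cokernel is [thin (Vset s t)]
    ([inverse_AR_translate_Uset], [epi_determiner]). For an injection the kernel contributes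
    nothing, and $P_j$ almost factors exactly when $j$ lies in [Vset s t] and every arrow starting
    at $j$ leaves [Vset s t]: then a generator can be sent outside the image while the radical goes
    into it. This singles out the last vertex of [Vset s t] ([mono_determiner]).

    Hence the determiners are the modules [thin (Vset s t)], one for each arrow, and the $P_k$ with
    $k$ a last vertex; no two of them are isomorphic ([Vset_inj], [Vset_notP], [Pset_inj]). By
    [path_endP] the vertices that are not last vertices are the inner sources and the sinks to which
    no non-zero path leads from an inner source. If there is one sink, there is no inner source, and
    the sink is of the second kind. If there are at least two, the sinks of the second kind are
    those with non-zero sink ideal ([sink_ideal_reached]), because on a linear stretch the
    restricted ideal is non-zero exactly when the full path along it is zero
    ([restrict_ideal_neq0]). The vertices being $0,\dots,n$, there are $n$ arrows and $n+1$
    vertices, and the count is $n+(n+1-p-b)$ with $b$ the number of sinks of the second kind. *)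

Section ModuleIsomorphisms.
Variable R : nzRingType.
Implicit Types M N X Y : lmodType R.

Lemma linear_mapP M N (f : M -> N) :
  linear f -> exists g : {linear M -> N}, g =1 f.
Proof.
move=> lf; pose L := GRing.isLinear.Build R M N *:%R f lf.
by exists (HB.pack_for {linear M -> N} f L).
Qed.

(** Lifts, restrictions and inverses are described by relations rather than formulas. Being
    single-valued at 0 is enough, since two values at the same point differ by a value at 0. *)
Lemma rel_linear M N (r : M -> N -> Prop) :
  (forall x, exists y, r x y) ->
  (forall y, r 0 y -> y = 0) ->
  (forall a x x' y y', r x y -> r x' y' -> r (a *: x + x') (a *: y + y')) ->
  exists f : {linear M -> N}, forall x y, r x y <-> y = f x.
Proof.
move=> tot fun0 lin.
have funr x y y' : r x y -> r x y' -> y = y'.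
  move=> xy xy'; apply/eqP; rewrite -subr_eq0; apply/eqP/fun0.
  by have := lin (-1) _ _ _ _ xy' xy; rewrite !scaleN1r !addNr addrC.
pose f x := sval (cid (tot x)).
have fP x : r x (f x) by rewrite /f; case: cid.
have [|g gE] := @linear_mapP M N f.
  by move=> a x y; apply: funr (fP _) _; apply: lin.
exists g => x y; rewrite gE; split=> [xy|->] //; exact: funr xy (fP x).
Qed.

Lemma rel_isomorphic M N (r : M -> N -> Prop) :
  (forall x, exists y, r x y) -> (forall y, exists x, r x y) ->
  (forall y, r 0 y -> y = 0) -> (forall x, r x 0 -> x = 0) ->
  (forall a x x' y y', r x y -> r x' y' -> r (a *: x + x') (a *: y + y')) ->
  isomorphic M N.
Proof.
move=> totl totr fun0 inj0 lin.
have [f fP] := rel_linear totl fun0 lin.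
have [|g gP] := @rel_linear N M (fun y x => r x y) totr inj0.
  by move=> a y y' x x'; apply: lin.
exists f; exists g => x.
  by apply/esym/gP/fP.
by apply/esym/fP/gP.
Qed.

Lemma isomorphic_refl M : isomorphic M M.
Proof.
have [|f fE] := @linear_mapP M M idfun; first by [].
by exists f; exists idfun => x; rewrite fE.
Qed.

Lemma bijective_linear_inv M N (f : {linear M -> N}) : bijective f ->
  exists2 g : {linear N -> M}, cancel f g & cancel g f.
Proof.
case=> g fK gK; have [|h hE] := @linear_mapP N M g.
  by move=> a x y; rewrite -{1}(gK x) -{1}(gK y) -linearP fK.
by exists h => x; rewrite !hE.
Qed.

Lemma isomorphic_sym M N : isomorphic M N -> isomorphic N M.
Proof.
by case=> f /bijective_linear_inv[g fK gK]; exists g; exists f.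
Qed.

Lemma comp_linear M N X (g : {linear N -> X}) (f : {linear M -> N}) :
  exists h : {linear M -> X}, forall x, h x = g (f x).
Proof. by apply: linear_mapP => a x y; rewrite !linearP. Qed.

Lemma isomorphic_trans M N X :
  isomorphic M N -> isomorphic N X -> isomorphic M X.
Proof.
case=> f fb [g gb]; have [h hE] := comp_linear g f.
by exists h; apply: (eq_bij (bij_comp gb fb)) => x; rewrite hE.
Qed.

Lemma inj_surj_bijective (M N : Type) (f : M -> N) :
  injective f -> surjective_map f -> bijective f.
Proof.
move=> fi fs; pose g y := sval (cid (fs y)).
have gP y : f (g y) = y by rewrite /g; case: cid.
by exists g => // x; apply: fi.
Qed.

Lemma isomorphic_zero M N : isomorphic M N -> zero_module M -> zero_module N.
Proof.
case=> f [g fK gK] zM y; rewrite -(gK y) (zM (g y)); exact: linear0.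
Qed.

Lemma indecomposable_isomorphic M N :
  isomorphic M N -> indecomposable M -> indecomposable N.
Proof.
move=> MN [nz ind]; split=> [zN|X Y NXY].
  by apply: nz; apply: isomorphic_zero zN; apply: isomorphic_sym.
by apply: ind; apply: isomorphic_trans NXY.
Qed.

Lemma isomorphic_prod0 M N : zero_module N -> isomorphic (M * N)%type M.
Proof.
move=> zN; apply: (@rel_isomorphic _ _ (fun p x => p.1 = x)) => /=.
- by move=> p; exists p.1.
- by move=> x; exists (x, 0).
- by move=> y ->.
- by case=> x y /= ->; rewrite (zN y).
- by move=> a x x' y y' <- <-.
Qed.

Lemma summand_indecomposable M X :
  indecomposable M -> indecomposable X -> summand X M -> isomorphic X M.
Proof.
move=> [_ indM] [nzX _] [Y MXY]; case: (indM _ _ MXY) => // zY.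
apply/isomorphic_sym/(isomorphic_trans MXY).
exact: isomorphic_prod0.
Qed.

Lemma finitely_generated_isomorphic M N :
  isomorphic M N -> finitely_generated M -> finitely_generated N.
Proof.
case=> f [g _ gK] [m [e eP]]; exists m, (f \o e) => y.
have [c cE] := eP (g y); exists c; rewrite -(gK y) cE linear_sum.
by apply: eq_bigr => i _; rewrite linearZ.
Qed.

Lemma projective_isomorphic M N : isomorphic M N -> projective M -> projective N.
Proof.
case=> f /bijective_linear_inv[g _ gK] pM X Y p h ps.
have [hf hfE] := comp_linear h f.
have [k kE] := pM _ _ p hf ps.
have [kg kgE] := comp_linear k g.
by exists kg => x; rewrite kgE -kE hfE gK.
Qed.

(* Submodules given by propositions become types by deciding membership       *)
(* classically.                                                               *)
Section Submodule.
Variables (M : lmodType R) (S : M -> Prop) (subS : submodule S).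

Definition in_submodule of submodule S : {pred M} := fun x => `[< S x >].

Lemma in_submodule_closed : submod_closed (in_submodule subS).
Proof.
case: (subS) => S0 SD; split; first by apply/asboolP.
by move=> a x y /asboolP Sx /asboolP Sy; apply/asboolP/SD.
Qed.

HB.instance Definition _ :=
  GRing.isSubmodClosed.Build R M (in_submodule subS) in_submodule_closed.

Definition submod_of : Type := {x : M | in_submodule subS x}.
HB.instance Definition _ := SubChoice.on submod_of.
HB.instance Definition _ := [SubChoice_isSubLmodule of submod_of by <:].

Lemma submod_embedding : exists k : {linear (submod_of : lmodType R) -> M},
  injective k /\ forall x, S x <-> exists y, k y = x.
Proof.
have [|k kE] := @linear_mapP (submod_of : lmodType R) M (val : submod_of -> M).
  by move=> a x y; rewrite linearP.
exists k; split=> [x y|x]; first by rewrite !kE; apply: val_inj.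
split=> [/asboolP Sx|[y <-]]; first by exists (Sub x Sx); rewrite kE SubK.
by rewrite kE; apply/asboolP; apply: valP y.
Qed.

End Submodule.

Lemma submodule_exists M (S : M -> Prop) : submodule S ->
  exists (X : lmodType R) (k : {linear X -> M}),
    injective k /\ forall x, S x <-> exists y, k y = x.
Proof.
move=> subS; exists (submod_of subS : lmodType R); exact: submod_embedding.
Qed.

Lemma kernel_exists M N (f : {linear M -> N}) :
  exists (X : lmodType R) (k : {linear X -> M}), is_kernel k f.
Proof.
apply: submodule_exists; split=> [|a x y fx fy]; first exact: linear0.
by rewrite linearP fx fy scaler0 addr0.
Qed.

Lemma kernel_isomorphic M N (f : {linear M -> N}) X X' (k : {linear X -> M})
    (k' : {linear X' -> M}) : is_kernel k f -> is_kernel k' f -> isomorphic X X'.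
Proof.
move=> [ki kP] [ki' kP'].
apply: (@rel_isomorphic X X' (fun x x' => k x = k' x')).
- move=> x; have /kP'[y <-] : f (k x) = 0 by apply/kP; exists x.
  by exists y.
- move=> x; have /kP[y <-] : f (k' x) = 0 by apply/kP'; exists x.
  by exists y.
- by move=> y; rewrite linear0 => /esym e; apply: ki'; rewrite e linear0.
- by move=> y; rewrite linear0 => e; apply: ki; rewrite e linear0.
- by move=> a x x' y y'; rewrite !linearP => -> ->.
Qed.

(** The complement is the kernel of [p]. *)
Lemma retraction_isomorphic M X (i : {linear X -> M}) (p : {linear M -> X}) :
  cancel i p -> exists Y, isomorphic M (X * Y)%type.
Proof.
move=> ip; have [Y [k [ki kP]]] := kernel_exists p; exists Y.
apply: (@rel_isomorphic _ _ (fun m q => m = i q.1 + k q.2)) => /=.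
- move=> m; have /kP[y ky] : p (m - i (p m)) = 0 by rewrite linearB ip subrr.
  by exists (p m, y); rewrite /= ky addrC subrK.
- by case=> x y; exists (i x + k y).
- case=> x y /= /esym e; have pk : p (k y) = 0 by apply/kP; exists y.
  have x0 : x = 0 by have := congr1 p e; rewrite linearD ip pk addr0 linear0.
  by move: e; rewrite x0 linear0 add0r -[RHS](linear0 k) => /ki->.
- by move=> x ->; rewrite !linear0 addr0.
- move=> a x x' [y1 y2] [y1' y2'] /= -> ->.
  by rewrite !linearP scalerDr addrACA.
Qed.

Lemma retraction_indecomposable M X (i : {linear X -> M}) (p : {linear M -> X}) :
  cancel i p -> indecomposable M -> ~ zero_module X -> isomorphic M X.
Proof.
move=> ip [_ indM] nzX; have [Y MXY] := retraction_isomorphic ip.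
case: (indM _ _ MXY) => // zY; apply: isomorphic_trans MXY _.
exact: isomorphic_prod0.
Qed.

Lemma direct_sum1 (Y : 'I_1 -> lmodType R) C :
  is_direct_sum Y C <-> isomorphic C (Y ord0).
Proof.
split=> [[inj [surj free]]|CY].
  apply/isomorphic_sym; exists (inj ord0); apply: inj_surj_bijective.
    move=> x y e; apply/eqP; rewrite -subr_eq0; apply/eqP.
    (* A dependent family over ['I_1] with a prescribed value is obtained by transport along
       [ord1 i]; at [ord0] the transport is trivial by proof irrelevance. *)
    have [z zE] : exists z : forall i, Y i, z ord0 = x - y.
      by exists (fun i => match ord1 i in _ = j return (Y j -> Y i) with erefl => id end (x - y));
        rewrite (Prop_irrelevance (ord1 ord0) erefl).
    by rewrite -zE; apply: free; rewrite big_ord1 zE linearB e subrr.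
  by move=> x; have [y ->] := surj x; exists (y ord0); rewrite big_ord1.
have [f fb] := isomorphic_sym CY.
have [j jE] : exists j : forall i, {linear Y i -> C}, j ord0 = f.
  by exists (fun i => match ord1 i in _ = j return ({linear Y j -> C} -> {linear Y i -> C})
      with erefl => id end f);
    rewrite (Prop_irrelevance (ord1 ord0) erefl).
have [g fK gK] := fb.
exists j; split=> [x|y].
  have [z zE] : exists z : forall i, Y i, z ord0 = g x.
    by exists (fun i => match ord1 i in _ = j return (Y j -> Y i) with erefl => id end (g x));
      rewrite (Prop_irrelevance (ord1 ord0) erefl).
  by exists z; rewrite big_ord1 zE jE gK.
rewrite big_ord1 jE => /(congr1 g) e i; rewrite (ord1 i).
by rewrite -(fK (y ord0)) e -[in LHS](linear0 f) fK.
Qed.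

End ModuleIsomorphisms.

(** * Uniqueness of the inverse translate *)

Section ProjectiveCovers.
Variable R : nzRingType.
Implicit Types M N P : lmodType R.

Lemma image_submodule M N (f : {linear M -> N}) :
  submodule (fun y => exists x, f x = y).
Proof.
split=> [|a _ _ [x <-] [y <-]]; first by exists 0; rewrite linear0.
by exists (a *: x + y); rewrite linearP.
Qed.

Lemma projective_cover_unique (P P' M M' : lmodType R) (e : {linear P -> M})
    (e' : {linear P' -> M'}) (t : {linear M -> M'}) :
  projective P -> projective P' -> surjective_map e -> surjective_map e' ->
  superfluous_kernel e -> superfluous_kernel e' -> bijective t ->
  exists2 a : {linear P -> P'}, bijective a & forall x, e' (a x) = t (e x).
Proof.
move=> pP pP' es es' ek ek' [ti tK tiK].
have [te teE] := comp_linear t e.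
have [a aE] := pP _ _ e' te es'.
have as_ : surjective_map a.
  apply: (ek' _ (image_submodule a)) => y.
  have [x ex] := es (ti (e' y)).
  exists (a x), (y - a x); split; first by exists x.
  - by rewrite linearB -aE teE ex tiK subrr.
  - by rewrite addrC subrK.
have [idl idlE] := @linear_mapP R P' P' idfun (fun _ _ _ => erefl).
have [b bE] := pP' _ _ a idl as_.
have bs : surjective_map b.
  apply: (ek _ (image_submodule b)) => x.
  exists (b (a x)), (x - b (a x)); split; first by exists (a x).
  - apply: (can_inj tK); rewrite -teE aE linearB -bE idlE /= subrr linear0.
    by rewrite linear0.
  - by rewrite addrC subrK.
exists a; last by move=> x; rewrite -aE teE.
exists b => x; last by rewrite -bE idlE.
by have [y <-] := bs x; rewrite -bE idlE.
Qed.

Lemma lift_injective M N P (k : {linear N -> P}) (d : {linear M -> P}) :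
  injective k -> (forall x, exists y, k y = d x) ->
  exists d1 : {linear M -> N}, forall x, k (d1 x) = d x.
Proof.
move=> ki dk; have [|||f fP] := @rel_linear _ M N (fun x y => k y = d x).
- exact: dk.
- by move=> y; rewrite linear0 -[0 in X in X -> _](linear0 k) => /ki.
- by move=> a x x' y y'; rewrite !linearP => -> ->.
by exists f => x; apply/fP.
Qed.

(** Uniqueness of projective covers is used twice: for the modules themselves, and then for the
    kernels of [e] and [e'], which the first isomorphism identifies. *)
Lemma minimal_presentation_unique (P1 P0 M P1' P0' M' : lmodType R)
    (d : {linear P1 -> P0}) (e : {linear P0 -> M})
    (d' : {linear P1' -> P0'}) (e' : {linear P0' -> M'}) :
  minimal_projective_presentation d e ->
  minimal_projective_presentation d' e' -> isomorphic M M' ->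
  exists (a0 : {linear P0 -> P0'}) (a1 : {linear P1 -> P1'}),
    [/\ bijective a0, bijective a1 & forall x, a0 (d x) = d' (a1 x)].
Proof.
move=> [[pP1 pP0] es de [ek dk]] [[pP1' pP0'] es' de' [ek' dk']] [t tb].
have [a0 a0b a0E] := projective_cover_unique pP0 pP0' es es' ek ek' tb.
have ti := bij_inj tb.
have [X [k [ki kP]]] := kernel_exists e.
have [X' [k' [ki' kP']]] := kernel_exists e'.
(* The first map of a minimal presentation, corestricted to the kernel of the second, is a
   projective cover of this kernel. *)
have corestrict (Q1 Q0 W V : lmodType R) (D : {linear Q1 -> Q0}) (E : {linear Q0 -> W})
    (j : {linear V -> Q0}) : injective j -> (forall x, E x = 0 <-> exists y, j y = x) ->
    (forall x, E x = 0 <-> exists y, D y = x) -> superfluous_kernel D ->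
    exists D1 : {linear Q1 -> V},
      [/\ forall x, j (D1 x) = D x, surjective_map D1 & superfluous_kernel D1].
  move=> ji jP DE Dk.
  have [|D1 D1E] := @lift_injective _ _ _ j D ji.
    by move=> x; apply/jP/DE; exists x.
  exists D1; split=> // [y|S subS Sk].
    have /DE[x xE] : E (j y) = 0 by apply/jP; exists y.
    by exists x; apply: ji; rewrite D1E.
  apply: Dk => // x; have [s [z [Ss zk xE]]] := Sk x.
  by exists s, z; split=> //; rewrite -D1E zk linear0.
have [d1 [d1E d1s d1k]] := corestrict _ _ _ _ d e k ki kP de dk.
have [d1' [d1E' d1s' d1k']] := corestrict _ _ _ _ d' e' k' ki' kP' de' dk'.
have [a0k a0kE] := comp_linear a0 k.
have [|s sE] := @lift_injective _ _ _ k' a0k ki'.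
  move=> x; apply/kP'; rewrite a0kE a0E (_ : e (k x) = 0) ?linear0 //.
  by apply/kP; exists x.
have sb : bijective s.
  apply: inj_surj_bijective => [x y /(congr1 k')|y].
    by rewrite !sE !a0kE => /(bij_inj a0b)/ki.
  have [b bK Kb] := a0b.
  have /kP[x xE] : e (b (k' y)) = 0.
    by apply: ti; rewrite -a0E Kb linear0; apply/kP'; exists y.
  by exists x; apply: ki'; rewrite sE a0kE xE Kb.
have [a1 a1b a1E] := projective_cover_unique pP1 pP1' d1s d1s' d1k d1k' sb.
exists a0, a1; split=> // x.
by rewrite -d1E' a1E sE a0kE d1E.
Qed.

End ProjectiveCovers.

Section InverseTranslate.
Variables (K : fieldType) (A : algType K).

Lemma dual_unique (X X' : lmodType A) (Z Z' : lmodType A^c) :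
  is_dual X Z -> is_dual X' Z' -> isomorphic X X' -> isomorphic Z Z'.
Proof.
have main (Y Y' : lmodType A) (W W' : lmodType A^c) (ev : W -> Y -> K)
    (ev' : W' -> Y' -> K) (f : {linear Y' -> Y}) :
    (forall z (c : K) x y, ev z (c%:A *: x + y) = c * ev z x + ev z y) ->
    (forall phi : Y' -> K,
      (forall (c : K) x y, phi (c%:A *: x + y) = c * phi x + phi y) ->
      exists z, forall x, ev' z x = phi x) ->
    forall z, exists z', forall x, ev z (f x) = ev' z' x.
  move=> evl evs z; have [c x y|z' z'E] := evs (fun x => ev z (f x)).
    by rewrite linearP evl.
  by exists z' => x; rewrite z'E.
move=> [ev [ev1 ev2 ev3 ev4 ev5]] [ev' [ev1' ev2' ev3' ev4' ev5']] [f].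
case/bijective_linear_inv=> g fK gK.
have ev0 x : ev 0 x = 0.
  by apply: (addrI (ev 0 x)); rewrite -ev2 !addr0.
have ev0' x : ev' 0 x = 0.
  by apply: (addrI (ev' 0 x)); rewrite -ev2' !addr0.
apply: (@rel_isomorphic _ Z Z' (fun z z' => forall x, ev z x = ev' z' (f x))).
- move=> z; have [z' z'E] := main _ _ _ _ ev ev' g ev1 ev5' z.
  by exists z' => x; rewrite -z'E fK.
- move=> z; have [z' z'E] := main _ _ _ _ ev' ev f ev1' ev5 z.
  by exists z'.
- by move=> y yE; apply: ev4' => x; rewrite -(gK x) -yE ev0 ev0'.
- by move=> y yE; apply: ev4 => x; rewrite yE ev0 ev0'.
- move=> a x x' y y' xy xy' m.
  by rewrite ev2 ev2' (ev3 (a : A)) (ev3' (a : A)) xy xy' linearZ.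
Qed.

Lemma hom_to_algebra_transport (P P' : lmodType A^c) (L L' : lmodType A)
    (ev : L -> P -> A) (ev' : L' -> P' -> A) (a : {linear P' -> P}) :
  is_hom_to_algebra ev -> is_hom_to_algebra ev' ->
  forall l, exists l', forall x, ev l (a x) = ev' l' x.
Proof.
move=> [evl _ _ _] [_ _ _ evs] l; have [|l' l'E] := evs (fun x => ev l (a x)).
  by have [h1 h2] := evl l; split=> *; rewrite ?linearD ?linearZ ?h1 ?h2.
by exists l' => x; rewrite l'E.
Qed.

(** An isomorphism of minimal presentations induces an isomorphism of the maps obtained by applying
    $\mathrm{Hom}(-,A)$, and therefore of their cokernels. *)
Lemma transpose_unique (Z Z' : lmodType A^c) (Y Y' : lmodType A) :
  is_transpose Z Y -> is_transpose Z' Y' -> isomorphic Z Z' -> isomorphic Y Y'.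
Proof.
move=> [P1 [P0 [d [e [L0 [L1 [ev0 [ev1 [ds [c [pres [h0 h1] dsE cs cE]]]]]]]]]]].
move=> [P1' [P0' [d' [e' [L0' [L1' [ev0' [ev1' [ds' [c' [pres' [h0' h1'] dsE' cs' cE']]]]]]]]]]] ZZ'.
have [a0 [a1 [a0b a1b aE]]] := minimal_presentation_unique pres pres' ZZ'.
have [b0 a0K b0K] := bijective_linear_inv a0b.
have [b1 a1K b1K] := bijective_linear_inv a1b.
pose r0 l l' := forall x, ev0 l x = ev0' l' (a0 x).
pose r1 l l' := forall x, ev1 l x = ev1' l' (a1 x).
have r0l l : exists l', r0 l l'.
  have [l' l'E] := hom_to_algebra_transport b0 h0 h0' l.
  by exists l' => x; rewrite -l'E a0K.
have r0r l' : exists l, r0 l l'.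
  have [l lE] := hom_to_algebra_transport a0 h0' h0 l'.
  by exists l => x; rewrite lE.
have r1l l : exists l', r1 l l'.
  have [l' l'E] := hom_to_algebra_transport b1 h1 h1' l.
  by exists l' => x; rewrite -l'E a1K.
have r1r l' : exists l, r1 l l'.
  have [l lE] := hom_to_algebra_transport a1 h1' h1 l'.
  by exists l => x; rewrite lE.
have r1fl l l1 l' : r1 l l' -> r1 l1 l' -> l = l1.
  by case: h1 => _ _ inj _ rl rl1; apply: inj => x; rewrite rl rl1.
have r1fr l l1 l' : r1 l' l -> r1 l' l1 -> l = l1.
  by case: h1' => _ _ inj _ rl rl1; apply: inj => x; rewrite -(b1K x) -rl rl1.
have rds l l' : r0 l l' -> r1 (ds l) (ds' l').
  by move=> rl x; rewrite dsE rl aE dsE'.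
have r1D a l m l' m' : r1 l l' -> r1 m m' -> r1 (a *: l + m) (a *: l' + m').
  case: h1 => _ ev1D _ _; case: h1' => _ ev1D' _ _ rl rm x.
  by rewrite ev1D ev1D' rl rm.
apply: (@rel_isomorphic _ Y Y'
  (fun y y' => exists l l', [/\ c l = y, c' l' = y' & r1 l l'])).
- move=> y; have [l lE] := cs y; have [l' ll'] := r1l l.
  by exists (c' l'), l, l'.
- move=> y; have [l lE] := cs' y; have [l' ll'] := r1r l.
  by exists (c l'), l', l.
- move=> y [l [l' [/cE[l0 l0E] <- rl]]].
  have [l0' l00'] := r0l l0; apply/cE'; exists l0'.
  by apply: r1fr rl; rewrite -l0E; apply: rds.
- move=> y [l [l' [<- /cE'[l0' l0E] rl]]].
  have [l0 l00'] := r0r l0'; apply/cE; exists l0.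
  by apply: r1fl rl; rewrite -l0E; apply: rds.
- move=> a x x' y y' [l [l' [<- <- rl]]] [m [m' [<- <- rm]]].
  exists (a *: l + m), (a *: l' + m').
  by split; [rewrite linearP | rewrite linearP | apply: r1D].
Qed.

(** The inverse translate is a relation that involves a choice of dual and of presentation; this
    makes it a function on isomorphism classes, so that computing one instance suffices. *)
Lemma inverse_AR_translate_unique (X X' Y Y' : lmodType A) :
  is_inverse_AR_translate X Y -> is_inverse_AR_translate X' Y' ->
  isomorphic X X' -> isomorphic Y Y'.
Proof.
move=> [Z [XZ ZY]] [Z' [XZ' ZY']] XX'.
exact: transpose_unique ZY ZY' (dual_unique XZ XZ' XX').
Qed.

Lemma inverse_AR_translate_isomorphic (X Y Y' : lmodType A) :
  is_inverse_AR_translate X Y -> isomorphic Y Y' -> is_inverse_AR_translate X Y'.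
Proof.
move=> [Z [XZ ZY]] [f [g fK gK]]; exists Z; split=> //.
case: ZY => P1 [P0 [d [e [L0 [L1 [ev0 [ev1 [ds [c [pres h dsE cs cE]]]]]]]]]].
have [c' c'E] := comp_linear f c.
exists P1, P0, d, e, L0, L1, ev0, ev1, ds, c'; split=> // [y|l].
  by have [x xE] := cs (g y); exists x; rewrite c'E xE gK.
rewrite c'E -cE; split=> [|->]; last exact: linear0.
by move/(congr1 g); rewrite fK -(linear0 f) fK.
Qed.

End InverseTranslate.

(** Removing the edge between adjacent vertices [s] and [t] cuts the line in two; this is the half
    containing [s]. *)
Definition side (s t v : nat) : bool := if (s < t)%N then (v <= s)%N else (s <= v)%N.

(** * Intervals of an oriented line *)

Section Side.
Local Open Scope nat_scope.
Implicit Types s t u v w x y : nat.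

Definition adj s t := t = s.+1 \/ s = t.+1.

Lemma adjC s t : adj s t -> adj t s.
Proof. by case; [right|left]. Qed.

Lemma sideP s t v : adj s t ->
  (t = s.+1 /\ side s t v = (v <= s)) \/ (s = t.+1 /\ side s t v = (s <= v)).
Proof.
by case=> e; [left|right]; split; rewrite // /side e ?ltnS ?leqnn // ltnNge leqnSn.
Qed.

Lemma side_refl s t : side s t s.
Proof. by rewrite /side; case: ifP. Qed.

Lemma sideN s t v : adj s t -> side t s v = ~~ side s t v.
Proof.
move=> st; case: (sideP v st) => -[e ->]; case: (sideP v (adjC st)) => -[e' ->]; lia.
Qed.

Lemma side_other s t : adj s t -> side t s s = false.
Proof. by move=> st; rewrite sideN // side_refl. Qed.

Lemma side_convex s t u v w : side s t u -> side s t w -> u <= v <= w -> side s t v.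
Proof. by rewrite /side; case: ifP => _; lia. Qed.

Lemma side_cross s t u v : adj s t -> adj u v -> side s t u -> ~~ side s t v ->
  u = s /\ v = t.
Proof.
rewrite /adj => st uv; case: (sideP u st) => -[e ->]; case: (sideP v st) => -[e' ->];
  case: uv; lia.
Qed.

Lemma side_between s t v : adj s t -> ~~ side s t v -> (s <= t <= v) || (v <= t <= s).
Proof. move=> st; case: (sideP v st) => -[e ->]; lia. Qed.

Lemma side_nested s t x y z : adj s t -> adj x y -> side t s z -> side s t x ->
  side s t y -> side x y s -> side x y z.
Proof.
move=> st xy; rewrite sideN //; case: (sideP z st) => -[e ->]; case: (sideP x st) => -[e1 ->];
  case: (sideP y st) => -[e2 ->]; case: (sideP s xy) => -[e3 ->];
  case: (sideP z xy) => -[e4 ->]; lia.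
Qed.

Lemma side_order s t x y : adj s t -> adj x y -> side s t x -> side s t y ->
  ~~ ((s <= x <= y) || (y <= x <= s)) -> (s <= y <= x) || (x <= y <= s).
Proof. by rewrite /adj; lia. Qed.

Lemma side_apart s t u y : adj s t -> side t s u -> side s t y ->
  (u <= t <= y) || (y <= t <= u) /\ (t <= s <= y) || (y <= s <= t).
Proof.
move=> st; rewrite sideN //; case: (sideP u st) => -[e ->]; case: (sideP y st) => -[e1 ->]; lia.
Qed.

Lemma side_mid s t u v w : adj s t -> side t s u -> side s t w -> side s t v ->
  (u <= v <= w) || (w <= v <= u) -> (s <= v <= w) || (w <= v <= s).
Proof.
move=> st; rewrite sideN //; case: (sideP u st) => -[e ->]; case: (sideP w st) => -[e1 ->];
  case: (sideP v st) => -[e2 ->]; lia.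
Qed.

Lemma side_total s t j k : adj s t -> side s t j -> side s t k ->
  ((s <= j <= k) || (k <= j <= s)) || ((s <= k <= j) || (j <= k <= s)).
Proof.
by move=> st; case: (sideP j st) => -[e ->]; case: (sideP k st) => -[e1 ->]; lia.
Qed.

Lemma side_opposite s t t' : adj s t -> adj s t' -> t' <> t -> side s t t'.
Proof. by move=> st; case: (sideP t' st) => -[e ->]; rewrite /adj; lia. Qed.

Lemma adj_neq s t : adj s t -> s <> t.
Proof. rewrite /adj; lia. Qed.

(** For adjacent [x] and [y]: [z] lies on the half line that starts at [x] and points away from
    [y]. *)
Definition before x y z := (x < y) && (z < y) || (y < x) && (y < z).

Lemma before_opp x y z : adj x y -> z <> y -> ~~ before x y z ->
  (x <= y <= z) || (z <= y <= x).
Proof. by rewrite /adj /before; lia. Qed.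

Lemma before_between x y z w : adj x y -> before x y w -> z <> y ->
  (y <= z <= w) || (w <= z <= y) -> (x <= z <= w) || (w <= z <= x).
Proof. by rewrite /adj /before; lia. Qed.

Lemma before_adj x y z : adj x y -> before x y z -> (y <= x <= z) || (z <= x <= y).
Proof. by rewrite /adj /before; lia. Qed.

Lemma before_adj_eq x y z : adj x y -> before x y z -> adj z y -> z = x.
Proof. by rewrite /adj /before; lia. Qed.

Lemma between_eq y z : (y <= z <= y) -> z = y.
Proof. lia. Qed.

End Side.

(** * Directed paths on an oriented line *)

Section Orientation.
Local Open Scope nat_scope.
Variable f : nat -> bool.
Implicit Types u v w : nat.

(* f encodes an orientation of the line: k -> k+1 if f k, and k+1 -> k        *)
(* otherwise.                                                                 *)
Definition arr u v : bool := (v == u.+1) && f u || (u == v.+1) && ~~ f v.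

(** There is a directed path from [u] to [v]. At least one of the two lists is empty, so one formula
    covers both directions. *)
Definition conn u v : bool :=
  all f (iota u (v - u)) && all (predC f) (iota v (u - v)).

Lemma connP u v : reflect
  ((forall k, (u <= k < v)%N -> f k) /\ (forall k, (v <= k < u)%N -> ~~ f k))
  (conn u v).
Proof.
apply: (iffP andP) => -[h1 h2]; split.
- by move=> k hk; move/allP: h1; apply; rewrite mem_iota; lia.
- by move=> k hk; move/allP: h2; apply; rewrite mem_iota; lia.
- by apply/allP => k; rewrite mem_iota => hk; apply: h1; lia.
- by apply/allP => k; rewrite mem_iota => hk; apply: h2; lia.
Qed.

Lemma conn_refl u : conn u u.
Proof. by apply/connP; split=> k; lia. Qed.

(** Directed paths do not turn back: otherwise an arrow next to [v] would be followed both ways. *)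
Lemma conn_mid u v w : conn u v -> conn v w -> (u <= v <= w) || (w <= v <= u).
Proof.
move=> /connP[a1 a2] /connP[b1 b2]; apply/negPn/negP => h.
have [h1|h1] : (u < v /\ w < v)%N \/ (v < u /\ v < w)%N by lia.
  have := a1 v.-1; have := b2 v.-1; case: (f v.-1) => /=.
    by move=> /(_ ltac:(lia)).
  by move=> _ /(_ ltac:(lia)).
have := a2 v; have := b1 v; case: (f v) => /=.
  by move=> _ /(_ ltac:(lia)).
by move=> /(_ ltac:(lia)).
Qed.

Lemma conn_trans u v w : conn u v -> conn v w -> conn u w.
Proof.
move=> uv vw; have := conn_mid uv vw; move: uv vw.
move=> /connP[a1 a2] /connP[b1 b2] m; apply/connP; split=> k hk.
  by case: (ltnP k v) => kv; [apply: a1|apply: b1]; lia.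
by case: (ltnP k v) => kv; [apply: b2|apply: a2]; lia.
Qed.

Lemma conn_between u v w : (u <= v <= w) || (w <= v <= u) -> conn u w ->
  conn u v && conn v w.
Proof.
move=> m /connP[a1 a2].
by apply/andP; split; apply/connP; split=> k hk; [apply: a1|apply: a2|apply: a1|apply: a2]; lia.
Qed.

Lemma conn_anti u v : conn u v -> conn v u -> u = v.
Proof. by move=> uv vu; have := conn_mid uv vu; lia. Qed.

Lemma arr_adjacent u v : arr u v -> adj u v.
Proof. by rewrite /arr /adj; lia. Qed.

Lemma arr_conn u v : arr u v -> conn u v.
Proof.
case/orP=> /andP[/eqP e h]; apply/connP; split=> k hk; try lia.
  by have -> : k = u by lia.
by have -> : k = v by lia.
Qed.

Lemma conn_arr u v : conn u v -> adj u v -> arr u v.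
Proof.
move=> /connP[h1 h2] [e|e]; rewrite /arr.
  by rewrite h1; lia.
by rewrite (h2 v) ?andbT; lia.
Qed.

Lemma arr_total u v : adj u v -> arr u v || arr v u.
Proof. by rewrite /arr => -[->|->]; rewrite !eqxx; case: (f _); lia. Qed.

Lemma arr_asym u v : arr u v -> arr v u = false.
Proof.
move=> uv; apply/negP => vu; have := conn_anti (arr_conn uv) (arr_conn vu).
by have := arr_adjacent uv; rewrite /adj; lia.
Qed.

End Orientation.

Lemma arr_negb f u v : arr (fun k => ~~ f k) u v = arr f v u.
Proof. by rewrite /arr negbK orbC. Qed.

Lemma conn_negb f u v : conn (fun k => ~~ f k) u v = conn f v u.
Proof.
apply/connP/connP=> -[h1 h2]; split=> // k hk; last by rewrite negbK h1.
by have := h2 k hk; rewrite negbK.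
Qed.

Lemma conn_first n (f : nat -> bool) (u v : 'I_n.+1) : conn f u v -> u != v ->
  exists w : 'I_n.+1, [/\ arr f u w, conn f w v & (`|w - v| < `|u - v|)%N].
Proof.
move=> uv nuv.
have [k [lk m ak lkv]] : exists k : nat, [/\ (k < n.+1)%N,
    ((u <= k <= v) || (v <= k <= u))%N, adj u k & (`|k - v| < `|u - v|)%N].
  have nuv' : u != v :> nat by [].
  have := ltn_ord u; have := ltn_ord v; move: nuv'; rewrite /adj; move: (u : nat) (v : nat).
  move=> i j; case: (ltnP i j) => ij nij lj li; [exists i.+1|exists i.-1]; split; lia.
have /andP[uw wv] := conn_between m uv.
exists (Ordinal lk); split=> //; exact: conn_arr.
Qed.

(* nz u v means that there is a path from u to v and that it is non-zero in   *)
(* the algebra.                                                               *)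
Record qshape n := QShape {
  up : nat -> bool;
  nz : rel 'I_n.+1;
  nz_conn : forall u v, nz u v -> conn up u v;
  nz_refl : forall u, nz u u;
  nz_arr : forall u v : 'I_n.+1, arr up u v -> nz u v;
  nz_sub : forall u v w : 'I_n.+1,
    conn up u v -> conn up v w -> nz u w -> nz u v && nz v w
}.

(** * Reversal of all arrows *)

Section OppositeShape.
Local Open Scope nat_scope.
Variables (n : nat) (sh : qshape n).

Lemma op_nz_conn u v : nz sh v u -> conn (fun k => ~~ up sh k) u v.
Proof. by rewrite conn_negb; apply: nz_conn. Qed.

Lemma op_nz_arr (u v : 'I_n.+1) : arr (fun k => ~~ up sh k) u v -> nz sh v u.
Proof. by rewrite arr_negb; apply: nz_arr. Qed.

Lemma op_nz_sub (u v w : 'I_n.+1) :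
  conn (fun k => ~~ up sh k) u v -> conn (fun k => ~~ up sh k) v w ->
  nz sh w u -> nz sh v u && nz sh w v.
Proof. by rewrite !conn_negb andbC => uv vw; apply: nz_sub. Qed.

(** This duality turns statements on monomorphisms into statements on epimorphisms, and serves again
    for right modules. *)
Definition op_shape : qshape n :=
  @QShape n (fun k => ~~ up sh k) (fun u v => nz sh v u)
    op_nz_conn (nz_refl sh) op_nz_arr op_nz_sub.

End OppositeShape.

Lemma ord_neq n (u v : 'I_n) : u != v -> u <> v :> nat.
Proof. by move=> h e; case/eqP: h; apply: val_inj. Qed.

(** * Intervals supporting a module, and irreducible inclusions of intervals *)

Section Convex.
Local Open Scope nat_scope.
Variable n : nat.
Implicit Types (S T : {set 'I_n.+1}) (u v w : 'I_n.+1).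

Definition convex S : Prop :=
  forall u v w, u \in S -> w \in S -> (u <= v <= w)%N -> v \in S.

Lemma convexI S T : convex S -> convex T -> convex (S :&: T).
Proof.
by move=> cS cT u v w /setIP[uS uT] /setIP[wS wT] h; rewrite inE (cS u v w) ?(cT u v w).
Qed.

Lemma convex_between S u v w : convex S -> u \in S -> w \in S ->
  (u <= v <= w)%N || (w <= v <= u)%N -> v \in S.
Proof. by move=> cS uS wS /orP[]; apply: cS. Qed.

(** Passage from neighbours to a whole interval, by induction on the distance. *)
Lemma convex_const (X : Type) (f : 'I_n.+1 -> X) S : convex S ->
  (forall u v, u \in S -> v \in S -> v = u.+1 :> nat -> f u = f v) ->
  forall u v, u \in S -> v \in S -> f u = f v.
Proof.
move=> cS h; have main k u v : u \in S -> v \in S -> v = (u + k)%N :> nat -> f u = f v.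
  elim: k u => [|k IH] u uS vS e.
    by congr f; apply: val_inj; rewrite /= e addn0.
  have lt : (u.+1 < n.+1)%N by have := ltn_ord v; lia.
  have wS : Ordinal lt \in S by apply: (cS u _ v) => //=; lia.
  by rewrite (h u (Ordinal lt)) // (IH (Ordinal lt)) //=; lia.
move=> u v uS vS; case: (leqP u v) => uv.
  by apply: (main (v - u)%N) => //; lia.
by apply/esym/(main (u - v)%N) => //; lia.
Qed.

(** If no edge of [T] left [S], membership in [S] would be constant on the interval [T]. *)
Lemma convex_boundary S T : convex T -> S \subset T -> S != set0 -> S != T ->
  exists u v : 'I_n.+1, [/\ u \in S, v \in T, v \notin S & adj u v].
Proof.
move=> cT ST S0 nST; apply/not_existsP => h.
case/set0Pn: S0 => x xS; case/eqP: nST; apply/eqP; rewrite eqEsubset ST /=.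
apply/subsetP=> y yT; have xT := subsetP ST _ xS.
have : (x \in S) = (y \in S); last by rewrite xS.
apply: (convex_const (f := fun v => v \in S) cT) => // u v uT vT e.
case uS: (u \in S); case vS: (v \in S) => //.
  by case: (h u); exists v; rewrite uS vS; split=> //; left.
by case: (h v); exists u; rewrite uS vS; split=> //; right.
Qed.

Definition seg S u v : bool := [forall w : 'I_n.+1, (minn u v <= w <= maxn u v)%N ==> (w \in S)].

Lemma segP S u v : reflect (forall w : 'I_n.+1, (minn u v <= w <= maxn u v)%N -> w \in S) (seg S u v).
Proof. exact: (iffP 'forall_implyP). Qed.

Lemma convex_seg S u v : convex S -> seg S u v = (u \in S) && (v \in S).
Proof.
move=> cS; apply/segP/andP=> [h|[uS vS] w hw].
  by split; apply: h; lia.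
by apply: (convex_between cS uS vS); lia.
Qed.

Lemma seg_sub S T u v : S \subset T -> seg S u v -> seg T u v.
Proof. by move=> /subsetP ST /segP h; apply/segP => w hw; apply/ST/h. Qed.

Lemma seg_split S u v w : (u <= v <= w)%N || (w <= v <= u)%N ->
  seg S u w = seg S u v && seg S v w.
Proof.
move=> h; apply/segP/andP=> [a|[/segP a /segP b] x hx].
  by split; apply/segP => x hx; apply: a; lia.
case: (boolP (minn u v <= x <= maxn u v)%N) => hx'; first exact: a.
by apply: b; lia.
Qed.

Variable sh : qshape n.
Local Notation arr := (arr (up sh)).
Local Notation conn := (conn (up sh)).
Local Notation nz := (nz sh).

(** The condition for [thin S] to be a module: a path staying in [S] acts as the identity there, so
    it must not vanish in the algebra. *)
Definition ok S : Prop := forall u v, seg S u v -> conn u v -> nz u v.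

Lemma ok_set0 : ok set0.
Proof. by move=> u v /segP/(_ u); rewrite inE geq_min leq_max leqnn => /(_ isT). Qed.

Lemma ok_sub S T : S \subset T -> ok T -> ok S.
Proof. by move=> ST okT u v /(seg_sub ST); apply: okT. Qed.

Lemma ok_weak S : (forall u v, u \in S -> v \in S -> conn u v -> nz u v) -> ok S.
Proof. by move=> h u v /segP a; apply: h; apply: a; lia. Qed.

Lemma ok_convex S u v : convex S -> ok S -> u \in S -> v \in S -> conn u v -> nz u v.
Proof. by move=> cS okS uS vS; apply: okS; rewrite convex_seg // uS. Qed.

(* The condition for the projection thin S -> thin (S :&: T) followed by the  *)
(* inclusion in thin T to be a homomorphism.                                  *)
Definition comap S T : Prop :=
  forall u v, u \in S -> v \in T -> arr u v -> (v \in S) = (u \in T).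

(** The vertices of the longest non-zero path that starts at [s] and does not use the edge to [t];
    it may consist of [s] alone. *)
Definition Vset s t := [set v : 'I_n.+1 | nz s v && side s t v].

Lemma Vset_convex s t : convex (Vset s t).
Proof.
move=> u v w; rewrite !inE => /andP[nu su] /andP[nw sw] h.
have sv := side_convex su sw h.
rewrite sv andbT.
have [suv|suw] : ((s <= v <= w) || (w <= v <= s))%N \/ ((s <= v <= u) || (u <= v <= s))%N by lia.
  by have /andP[a b] := conn_between suv (nz_conn nw); have /andP[] := nz_sub a b nw.
by have /andP[a b] := conn_between suw (nz_conn nu); have /andP[] := nz_sub a b nu.
Qed.

Lemma Vset_ok s t : ok (Vset s t).
Proof.
apply: ok_weak => u v; rewrite !inE => /andP[nu _] /andP[nv _] uv.
by have /andP[] := nz_sub (nz_conn nu) uv nv.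
Qed.

Lemma Vset_start s t : s \in Vset s t.
Proof. by rewrite inE nz_refl side_refl. Qed.

(* The hypothesis on T is used for three kinds of intervals: the part of R on *)
(* the side of t, the part of R left after cutting an arrow of R - S that     *)
(* points towards s, and R extended by one vertex of Vset s t.                *)
Lemma irreducible_pair_sub S R : convex S -> convex R -> ok R ->
  S != set0 -> S \subset R -> S != R -> comap S R ->
  (forall T, convex T -> ok T -> comap S T -> comap T R -> S \subset T ->
    T = S \/ T = R) ->
  exists s t : 'I_n.+1, [/\ arr s t, t \in S, s \notin S & R :\: S = Vset s t].
Proof.
move=> cS cR okR S0 SR nSR SRc irr.
have SRs := subsetP SR.
have [t [s [tS sR snS ts_adj]]] := convex_boundary cR SR S0 nSR.
have st : arr s t.
  have/orP[ts|//] := arr_total (up sh) ts_adj.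
  by have := SRc t s tS sR ts; rewrite (negPf snS) SRs.
exists s, t; split=> //.
have st_adj := adjC ts_adj.
have sideS v : v \in S -> side t s v.
  move=> vS; apply/negPn/negP => nv; case/negP: snS.
  exact: convex_between cS tS vS (side_between ts_adj nv).
have S1 : S = [set v in R | side t s v].
  pose T := [set v in R | side t s v].
  have ST : S \subset T by apply/subsetP => v vS; rewrite inE SRs ?sideS.
  have [||||//|//|TR] := irr T.
  - move=> u v w; rewrite !inE => /andP[uR us] /andP[wR ws] h.
    by rewrite (cR u v w) //=; apply: side_convex us ws h.
  - by apply: ok_sub okR; apply/subsetP => v; rewrite inE => /andP[].
  - move=> u v uS; rewrite inE => /andP[vR _] uv.
    by rewrite (subsetP ST) // (SRc u v) // SRs.
  - move=> u v; rewrite inE => /andP[uR us] vR uv; rewrite uR inE vR /=.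
    apply/negPn/negP => nv.
    have [e1 e2] : u = t :> nat /\ v = s :> nat.
      exact: side_cross ts_adj (arr_adjacent uv) us nv.
    by move: uv; rewrite e1 e2 (arr_asym st).
  by move: sR; rewrite -TR inE side_other // andbF.
have RS v : (v \in R :\: S) = (v \in R) && side s t v.
  rewrite inE {1}S1 inE (sideN v st_adj); case: (v \in R) => //=; rewrite ?andbF ?andbT //.
  by rewrite negbK.
have Rs_conn v : v \in R -> side s t v -> conn s v.
  pose A := [set v in R | side s t v && conn s v].
  pose B := [set v in R | side s t v].
  suff AB : A = B.
    move=> vR sv; have : v \in B by rewrite inE vR sv.
    by rewrite -AB inE => /and3P[].
  apply/eqP/negPn/negP => nAB.
  have AB : A \subset B by apply/subsetP => x; rewrite !inE => /and3P[-> ->].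
  have cB : convex B.
    move=> u {}v w; rewrite !inE => /andP[uR us] /andP[wR ws] h.
    by rewrite (cR u v w) //=; apply: side_convex us ws h.
  have sA : s \in A by rewrite inE sR conn_refl side_refl.
  have A0 : A != set0 by apply/set0Pn; exists s.
  have [x [y [xA yB ynA xy]]] := convex_boundary cB AB A0 nAB.
  move: xA yB ynA; rewrite !inE => /and3P[xR sx cx] /andP[yR sy].
  rewrite yR sy /= => ncy.
  have yx : arr y x.
    have/orP[xy'|//] := arr_total (up sh) xy.
    by rewrite (conn_trans cx (arr_conn xy')) in ncy.
  have sxy : side x y s.
    apply/negPn/negP => /(side_between xy) m; case/negP: ncy.
    by have /andP[] := conn_between (etrans (orbC _ _) m) cx.
  pose T := [set v in R | side x y v].
  have ST : S \subset T.
    apply/subsetP => z zS; rewrite inE SRs //=.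
    exact: side_nested st_adj xy (sideS _ zS) sx sy sxy.
  have [||||//|TS|TR] := irr T.
  - move=> u z w; rewrite !inE => /andP[uR us] /andP[wR ws] h.
    by rewrite (cR u z w) //=; apply: side_convex us ws h.
  - by apply: ok_sub okR; apply/subsetP => z; rewrite inE => /andP[].
  - move=> u z uS; rewrite inE => /andP[vR _] uv.
    by rewrite (subsetP ST) // (SRc u z) // SRs.
  - move=> u z; rewrite inE => /andP[uR us] zR uz; rewrite uR inE zR /=.
    apply/negPn/negP => nv.
    have [e1 e2] : u = x :> nat /\ z = y :> nat.
      exact: side_cross xy (arr_adjacent uz) us nv.
    by move: uz; rewrite e1 e2 (arr_asym yx).
  - have : x \in T by rewrite inE xR side_refl.
    by rewrite TS => /sideS; rewrite (sideN x st_adj) sx.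
  - have : y \in T by rewrite TR.
    by rewrite inE yR side_other //; apply: adjC.
have sub1 : R :\: S \subset Vset s t.
  apply/subsetP => v; rewrite RS inE => /andP[vR sv]; rewrite sv andbT.
  by apply: (ok_convex cR okR) => //; apply: Rs_conn.
have RSV v : v \in Vset s t -> v \in R -> v \in R :\: S.
  by rewrite RS inE => /andP[_ ->] ->.
apply/eqP; rewrite eqEsubset sub1 /=; apply/subsetP => v vV.
apply: RSV => //; move: v vV; apply/subsetP.
pose A := Vset s t :&: R.
have AV : A \subset Vset s t by apply: subsetIl.
suff /eqP <- : A == Vset s t by apply: subsetIr.
apply/negPn/negP => nAV.
have A0 : A != set0 by apply/set0Pn; exists s; rewrite inE Vset_start sR.
have [x [y [xA yV ynA xy]]] := convex_boundary (@Vset_convex s t) AV A0 nAV.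
move: xA ynA; rewrite !inE => /andP[/andP[nx sx] xR].
have := yV; rewrite inE => /andP[ny sy]; rewrite ny sy /= => ynR.
have bxy : (s <= x <= y)%N || (y <= x <= s)%N.
  apply/negPn/negP => h; case/negP: ynR; apply: (convex_between cR sR xR).
  exact: side_order st_adj xy sx sy h.
have axy : arr x y.
  have /andP[_ h] := conn_between bxy (nz_conn ny).
  exact: conn_arr.
have xnS : x \notin S.
  by apply/negP => /sideS; rewrite (sideN x st_adj) sx.
pose T := y |: R.
have yS : y \notin S by apply/negP => /SRs; rewrite (negPf ynR).
have RT : R \subset T by apply: subsetUr.
(* The interval [R] contains [x] but not its neighbour [y], so it lies entirely on the far side of
   [x]. *)
have beyond z : z \in R -> before x y z.
  move=> zR; apply/negPn/negP => h; case/negP: (ynR).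
  have zy : z <> y :> nat by move=> e; case/negP: ynR; rewrite -(val_inj e).
  exact: convex_between cR xR zR (before_opp xy zy h).
have [|||||TS|TR] := irr T.
- move=> u z w; rewrite !inE.
  case: (eqVneq z y) => //= nzy.
  have nzy' := ord_neq nzy.
  case/predU1P=> [->|uR] /predU1P[->|wR] h.
  + by case: nzy'; apply: between_eq.
  + apply: (convex_between cR xR wR).
    by apply: before_between (xy) (beyond _ wR) nzy' _; rewrite h.
  + apply: (convex_between cR xR uR).
    by apply: before_between (xy) (beyond _ uR) nzy' _; rewrite h orbT.
  + exact: cR h.
- apply: ok_weak => u v; rewrite !inE.
  have back z : z \in R -> conn y z -> False.
    move=> zR yz; have /andP[yx _] := conn_between (before_adj xy (beyond _ zR)) yz.
    by case: (adj_neq xy); apply: conn_anti (arr_conn axy) yx.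
  case/predU1P=> [->|uR] /predU1P[->|vR].
  + by rewrite nz_refl.
  + by move=> /(back _ vR).
  (* A path to [y] from the half of [t] would run from [t] to [s], against the arrow. So [u] is on
     the half of [s], where it is reached from [s], and the path from [u] to [y] is part of the
     non-zero path from [s] to [y]. *)
  + move=> uy.
    have su : side s t u.
      apply/negPn/negP => nsu.
      rewrite -(sideN u st_adj) in nsu.
      have [m m'] := side_apart st_adj nsu sy.
      have /andP[_ ty] := conn_between m uy.
      have /andP[ts _] := conn_between m' ty.
      by case: (adj_neq st_adj); apply: conn_anti (arr_conn st) ts.
    have su' := Rs_conn _ uR su.
    by have /andP[] := nz_sub su' uy ny.
  + exact: (ok_convex cR okR).
- move=> u v uS; rewrite !inE => /predU1P[->|vR] uv.
    have e : u = x.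
      apply: val_inj.
      exact: before_adj_eq xy (beyond _ (SRs _ uS)) (arr_adjacent uv).
    by rewrite e (negPf xnS) in uS.
  by rewrite (SRs _ uS) orbT (SRc u v) // SRs.
- move=> u v; rewrite !inE => /predU1P[->|uR] vR uv; last by rewrite vR uR orbT.
  have e : v = x.
    apply: val_inj.
    exact: before_adj_eq xy (beyond _ vR) (adjC (arr_adjacent uv)).
  by rewrite e (arr_asym axy) in uv.
- exact: subset_trans SR RT.
- have : y \in T by rewrite !inE eqxx.
  by rewrite TS (negPf yS).
- have : y \in T by rewrite !inE eqxx.
  by rewrite TR (negPf ynR).
Qed.

End Convex.

Section OppositeConvex.
Local Open Scope nat_scope.
Variables (n : nat) (sh : qshape n).
Implicit Types (S T R : {set 'I_n.+1}) (s t u v : 'I_n.+1).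

Lemma segC S u v : seg S u v = seg S v u.
Proof. by rewrite /seg minnC maxnC. Qed.

Lemma op_ok S : ok (op_shape sh) S <-> ok sh S.
Proof.
split=> h u v; rewrite segC => uv c; first by apply: h => //=; rewrite conn_negb.
by apply: h => //; rewrite -conn_negb.
Qed.

Lemma op_comap S T : comap (op_shape sh) S T <-> comap sh T S.
Proof.
split=> h u v uS vT uv; apply/esym/h => //=; first by rewrite arr_negb.
by rewrite -arr_negb.
Qed.

Definition Uset s t := Vset (op_shape sh) t s.

Lemma in_Uset s t u : (u \in Uset s t) = nz sh u t && side t s u.
Proof. by rewrite inE. Qed.

Lemma Uset_convex s t : convex (Uset s t).
Proof. exact: Vset_convex. Qed.

Lemma Uset_ok s t : ok sh (Uset s t).
Proof. by apply/op_ok/Vset_ok. Qed.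

(** Testing the hypothesis on the image, [S :&: R], shows that one interval contains the other. The
    inclusion case is [irreducible_pair_sub]; the projection case is the same lemma for the reversed
    arrows. *)
Lemma irreducible_pair S R : convex S -> convex R -> ok sh S -> ok sh R ->
  S :&: R != set0 -> S != R -> comap sh S R ->
  (forall T, convex T -> ok sh T -> comap sh S T -> comap sh T R ->
    S :&: R \subset T -> T = S \/ T = R) ->
  (S \subset R /\ exists s t, [/\ arr (up sh) s t, t \in S, s \notin S
    & R :\: S = Vset sh s t]) \/
  (R \subset S /\ exists s t, [/\ arr (up sh) s t, s \in R, t \notin R
    & S :\: R = Uset s t]).
Proof.
move=> cS cR okS okR SR0 nSR SRc irr.
have S0 : S != set0 by apply: contraNneq SR0 => ->; rewrite set0I.
have R0 : R != set0 by apply: contraNneq SR0 => ->; rewrite setI0.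
have [|||||e|e] := irr (S :&: R).
- exact: convexI.
- by apply: ok_sub okS; apply: subsetIl.
- move=> u v uS /setIP[vS vR] uv; rewrite vS inE uS.
  by rewrite -(SRc u v) // vS.
- move=> u v /setIP[uS uR] vR uv; rewrite inE vR andbT uR.
  by rewrite (SRc u v).
- by [].
- have SR : S \subset R by rewrite -e subsetIr.
  left; split=> //; apply: irreducible_pair_sub => // T cT okT ST TR sub.
  by apply: irr => //; apply: subset_trans sub; apply: subsetIl.
have RS : R \subset S by rewrite -e subsetIl.
right; split=> //.
have [|||||T cT okT RT TS sub|s [t [ts tR sR SRE]]] :=
    @irreducible_pair_sub n (op_shape sh) R S cR cS.
- exact/op_ok.
- by [].
- by [].
- by rewrite eq_sym.
- exact/op_comap.
- have [||||//|->|->] := irr T; [exact: cT|exact/op_ok|exact/op_comap|exact/op_comap| |right|left] => //.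
  by apply: subset_trans sub; apply: subsetIr.
by exists t, s; rewrite /= arr_negb in ts.
Qed.

End OppositeConvex.

(** * Algebras spanned by paths *)

(* pe u v stands for the path from u to v (0 if there is none) and cf u v a   *)
(* for its coefficient in a; this one structure serves for the algebra and    *)
(* for its converse.                                                          *)
Record algsys (n : nat) (sh : qshape n) (K : fieldType) (R : nzRingType) := AlgSys {
  sc : K -> R;
  pe : 'I_n.+1 -> 'I_n.+1 -> R;
  cf : 'I_n.+1 -> 'I_n.+1 -> R -> K;
  cf_inj : forall a b, (forall u v, cf u v a = cf u v b) -> a = b;
  cf_out : forall u v a, ~~ nz sh u v -> cf u v a = 0;
  cfD : forall u v a b, cf u v (a + b) = cf u v a + cf u v b;
  cf1 : forall u v, cf u v 1 = (u == v)%:R;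
  cfM : forall u w a b, nz sh u w -> cf u w (a * b) = \sum_v cf v w a * cf u v b;
  cf_pe : forall u v u' v', cf u v (pe u' v') = [&& u == u', v == v' & nz sh u v]%:R;
  cf_sc : forall u v c, cf u v (sc c) = if u == v then c else 0
}.

Section AlgSysTheory.
Variables (n : nat) (sh : qshape n) (K : fieldType) (R : nzRingType).
Variable X : algsys sh K R.
Local Notation arr := (arr (up sh)).
Local Notation conn := (conn (up sh)).
Local Notation nz := (nz sh).
Local Notation sc := (sc X).
Local Notation E := (pe X).
Local Notation cf := (cf X).
Implicit Types (u v w : 'I_n.+1) (a b : R) (c : K).

Lemma cf0 u v : cf u v 0 = 0.
Proof. by apply: (addrI (cf u v 0)); rewrite -cfD !addr0. Qed.

Lemma cf_sum u v (I : Type) (r : seq I) (P : pred I) (F : I -> R) :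
  cf u v (\sum_(i <- r | P i) F i) = \sum_(i <- r | P i) cf u v (F i).
Proof. exact: (big_morph _ (cfD X u v) (cf0 u v)). Qed.

Lemma cf_scl u v c a : cf u v (sc c * a) = c * cf u v a.
Proof.
have [h|h] := boolP (nz u v); last by rewrite !(cf_out X) // mulr0.
rewrite (cfM X) // (bigD1 v) //= cf_sc eqxx big1 ?addr0 // => w nw.
by rewrite cf_sc (negPf nw) mul0r.
Qed.

Lemma cf_scr u v c a : cf u v (a * sc c) = c * cf u v a.
Proof.
have [h|h] := boolP (nz u v); last by rewrite !(cf_out X) // mulr0.
rewrite (cfM X) // (bigD1 u) //= cf_sc eqxx big1 ?addr0 => [|w nw]; first exact: mulrC.
by rewrite cf_sc eq_sym (negPf nw) mulr0.
Qed.

Lemma scC c a : sc c * a = a * sc c.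
Proof. by apply: (@cf_inj _ _ _ _ X) => u v; rewrite cf_scl cf_scr. Qed.

Lemma scD c d : sc (c + d) = sc c + sc d.
Proof.
by apply: (@cf_inj _ _ _ _ X) => u v; rewrite cfD !cf_sc; case: eqP; rewrite ?addr0.
Qed.

Lemma sc1 : sc 1 = 1.
Proof. by apply: (@cf_inj _ _ _ _ X) => u v; rewrite cf1 cf_sc; case: eqP. Qed.

Lemma sc0 : sc 0 = 0.
Proof. by apply: (@cf_inj _ _ _ _ X) => u v; rewrite cf0 cf_sc; case: eqP. Qed.

Lemma scM c d : sc (c * d) = sc c * sc d.
Proof.
by apply: (@cf_inj _ _ _ _ X) => u v; rewrite cf_scl !cf_sc; case: eqP; rewrite ?mulr0.
Qed.

Lemma scN c : sc (- c) = - sc c.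
Proof. by apply: (addrI (sc c)); rewrite -scD !subrr sc0. Qed.

Lemma pe_out u v : ~~ nz u v -> E u v = 0.
Proof.
move=> h; apply: (@cf_inj _ _ _ _ X) => x y; rewrite cf0 cf_pe.
by case: eqP => // ->; case: eqP => // ->; rewrite (negPf h).
Qed.

Lemma cf_peM x y u v w z :
  cf x y (E v w * E u z) = [&& x == u, y == w, z == v, nz x y, nz u v & nz v w]%:R.
Proof.
have [h|h] := boolP (nz x y); last by rewrite (cf_out X) //= !andbF.
rewrite (cfM X) // (bigD1 v) //= big1 ?addr0.
  rewrite !cf_pe eqxx -natrM mulnb; congr (nat_of_bool _)%:R.
  case: (x =P u) => [->|]; rewrite ?andbF //=; case: (y =P w) => [->|] //=.
  by rewrite [z == v]eq_sym andbC -andbA.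
by move=> t nt; rewrite !cf_pe (negPf nt) mul0r.
Qed.

Lemma peM u v w : conn u v -> conn v w -> E v w * E u v = E u w.
Proof.
move=> uv vw; apply: (@cf_inj _ _ _ _ X) => x y; rewrite cf_peM cf_pe eqxx /=.
congr (nat_of_bool _)%:R; case: eqP => //= ->; case: eqP => //= ->.
by case h: (nz u w) => //=; rewrite nz_sub.
Qed.

Lemma pe_mul0 u v v' w : v != v' -> E v' w * E u v = 0.
Proof.
move=> h; apply: (@cf_inj _ _ _ _ X) => x y.
by rewrite cf_peM (negPf h) !andbF cf0.
Qed.

Lemma pe_expand a : a = \sum_u \sum_v sc (cf u v a) * E u v.
Proof.
apply: (@cf_inj _ _ _ _ X) => x y; rewrite cf_sum.
rewrite (bigD1 x) //= [X in _ + X]big1 => [|u nu]; last first.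
  rewrite cf_sum big1 // => v _; rewrite cf_scl cf_pe eq_sym (negPf nu) mulr0 //.
rewrite addr0 cf_sum (bigD1 y) //= big1 => [|v nv]; last first.
  by rewrite cf_scl cf_pe [y == v]eq_sym (negPf nv) andbF mulr0.
rewrite addr0 cf_scl cf_pe !eqxx /=.
by have [_|h] := boolP (nz x y); rewrite ?mulr1 // (cf_out X) ?mul0r.
Qed.

Lemma sum_pe : \sum_u E u u = 1.
Proof.
apply: (@cf_inj _ _ _ _ X) => x y; rewrite cf_sum cf1 (bigD1 x) //= big1.
  rewrite cf_pe eqxx addr0 /= [y == x]eq_sym; case: eqP => //= ->.
  by rewrite nz_refl.
by move=> u nu; rewrite cf_pe eq_sym (negPf nu).
Qed.

Section Modules.
Variables M N : lmodType R.
Implicit Types (x y : M).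

Lemma peS u v w x : conn u v -> conn v w -> E v w *: (E u v *: x) = E u w *: x.
Proof. by move=> uv vw; rewrite scalerA peM. Qed.

Lemma peS0 u v v' w x : v != v' -> E v' w *: (E u v *: x) = 0.
Proof. by move=> h; rewrite scalerA pe_mul0 // scale0r. Qed.

Lemma peSl u v x : E v v *: (E u v *: x) = E u v *: x.
Proof.
have [h|h] := boolP (nz u v); last by rewrite (pe_out h) !scale0r scaler0.
by rewrite peS ?conn_refl // nz_conn.
Qed.

Lemma peSr u v x : E u v *: (E u u *: x) = E u v *: x.
Proof.
have [h|h] := boolP (nz u v); last by rewrite (pe_out h) !scale0r.
by rewrite peS ?conn_refl // nz_conn.
Qed.

Lemma sum_peS x : \sum_u E u u *: x = x.
Proof. by rewrite -scaler_suml sum_pe scale1r. Qed.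

Lemma scS c a x : sc c *: (a *: x) = a *: (sc c *: x).
Proof. by rewrite !scalerA scC. Qed.

(** Scalars, trivial paths and arrows generate the algebra: a longer path is treated by splitting
    off its first arrow. *)
Lemma linear_arr (f : M -> N) :
  (forall c x y, f (sc c *: x + y) = sc c *: f x + f y) ->
  (forall u x, f (E u u *: x) = E u u *: f x) ->
  (forall u v x, arr u v -> f (E u v *: x) = E u v *: f x) ->
  linear f.
Proof.
move=> fl fe fa.
have fD x y : f (x + y) = f x + f y.
  by have := fl 1 x y; rewrite sc1 !scale1r.
have f0 : f 0 = 0 by apply: (addrI (f 0)); rewrite -fD !addr0.
have fZ c x : f (sc c *: x) = sc c *: f x by rewrite -[_ *: x]addr0 fl f0 addr0.
have fE u v x : f (E u v *: x) = E u v *: f x.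
  have [h|h] := boolP (nz u v); last by rewrite (pe_out h) !scale0r.
  have := nz_conn h; have [k] := ubnP `|u - v|%N.
  elim: k u x {h} => // k IH u x lk uv.
  have [->|nuv] := eqVneq u v; first exact: fe.
  have [w [uw wv lw]] := conn_first uv nuv.
  rewrite -(peS (v := w)) ?(arr_conn uw) // IH ?fa //; last by lia.
  by rewrite scalerA peM // arr_conn.
move=> a x y; rewrite fD; congr (_ + _).
rewrite (pe_expand a) !scaler_suml (big_morph f fD f0); apply: eq_bigr => u _.
rewrite !scaler_suml (big_morph f fD f0); apply: eq_bigr => v _.
by rewrite -!scalerA fZ fE.
Qed.

End Modules.
End AlgSysTheory.

(** * Interval modules *)

Section ThinModules.
Variables (n : nat) (sh : qshape n) (K : fieldType) (R : nzRingType).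
Variable X : algsys sh K R.
Local Notation arr := (arr (up sh)).
Local Notation conn := (conn (up sh)).
Local Notation nz := (nz sh).
Local Notation sc := (sc X).
Local Notation E := (pe X).
Local Notation cf := (cf X).
Implicit Types (u v w : 'I_n.+1) (a b : R) (c : K).

(* One copy of K at each vertex of S; the path from u to v acts as the        *)
(* identity of K when it stays in S, and as 0 otherwise.                      *)
Definition thin (S : {set 'I_n.+1}) of ok sh S & algsys sh K R : Type :=
  {ffun {v : 'I_n.+1 | v \in S} -> K}.

HB.instance Definition _ S (okS : ok sh S) := GRing.Zmodule.on (thin okS X).

Definition klin (M : lmodType R) (l : M -> K) : Prop :=
  forall c (x y : M), l (sc c *: x + y) = c * l x + l y.

Lemma klin0 (M : lmodType R) (l : M -> K) : klin l -> l 0 = 0.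
Proof.
move=> kl; apply: (addrI (l 0)); rewrite addr0.
by have := kl 1 0 0; rewrite scaler0 addr0 mul1r.
Qed.

Lemma klinD (M : lmodType R) (l : M -> K) (x y : M) : klin l -> l (x + y) = l x + l y.
Proof. by move=> kl; have := kl 1 x y; rewrite sc1 scale1r mul1r. Qed.

Lemma klinZ (M : lmodType R) (l : M -> K) c (x : M) : klin l -> l (sc c *: x) = c * l x.
Proof. by move=> kl; have := kl c x 0; rewrite addr0 (klin0 kl) addr0. Qed.

Lemma klinB (M : lmodType R) (l : M -> K) (x y : M) : klin l -> l (x - y) = l x - l y.
Proof.
move=> kl; have := kl (-1) y x; rewrite scN sc1 scaleN1r addrC => ->.
by rewrite mulN1r addrC.
Qed.

Section Coordinates.
Variables (S : {set 'I_n.+1}) (okS : ok sh S).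
Implicit Types x y : thin okS X.

(** Coordinates are extended by 0 outside [S], so that sums and equations range over all
    vertices. *)
Definition co x v : K := if insub v is Some w then x w else 0.
Definition thin_mk (g : 'I_n.+1 -> K) : thin okS X := [ffun w => g (val w)].

Lemma co_out x v : v \notin S -> co x v = 0.
Proof. by move=> h; rewrite /co insubF //; apply: negbTE. Qed.

Lemma co_mk g v : co (thin_mk g) v = if v \in S then g v else 0.
Proof. by rewrite /co; case: insubP => [w -> <-|/negPf->] //; rewrite ffunE. Qed.

Lemma thin_ext x y : (forall v, v \in S -> co x v = co y v) -> x = y.
Proof.
by move=> h; apply/ffunP => w; have := h _ (valP w); rewrite /co valK.
Qed.

Lemma coD x y v : co (x + y) v = co x v + co y v.
Proof. by rewrite /co; case: insubP => [w _ _|_]; rewrite ?addr0 // ffunE. Qed.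

Lemma co0 v : co 0 v = 0.
Proof. by rewrite /co; case: insubP => [w _ _|_] //; rewrite ffunE. Qed.

Definition thin_scale a x : thin okS X :=
  thin_mk (fun v => \sum_u (if seg S u v then cf u v a * co x u else 0)).

Lemma seg_end u v : seg S u v -> v \in S.
Proof. by move/segP; apply; rewrite leq_max leqnn orbT andbT geq_min leqnn orbT. Qed.

Lemma seg_start u v : seg S u v -> u \in S.
Proof. by rewrite segC => /seg_end. Qed.

Lemma co_thin_scale a x v : co (thin_scale a x) v =
  \sum_u (if seg S u v then cf u v a * co x u else 0).
Proof.
rewrite co_mk; case: ifP => // vS; rewrite big1 // => u _; case: ifP => // /seg_end.
by rewrite vS.
Qed.

(** An intermediate vertex [w] that contributes lies between [u] and [v], so [seg] splits at [w].
    When the path from [u] to [v] vanishes, [ok] excludes two non-zero halves inside [S]; this is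
    the point where the module axioms depend on it. *)
Lemma thin_scaleA a b x : thin_scale a (thin_scale b x) = thin_scale (a * b) x.
Proof.
apply: thin_ext => v _; rewrite !co_thin_scale.
transitivity (\sum_w \sum_u (if seg S u w && seg S w v then
    cf w v a * cf u w b * co x u else 0)).
  apply: eq_bigr => w _; case: ifP => h.
    rewrite co_thin_scale mulr_sumr; apply: eq_bigr => u _; rewrite andbT.
    by case: ifP; rewrite ?mulr0 ?mulrA.
  by rewrite big1 // => u _; rewrite andbF.
rewrite exchange_big; apply: eq_bigr => u _.
have split w : nz u w -> nz w v -> seg S u w && seg S w v = seg S u v.
  move=> uw wv; rewrite -seg_split //.
  exact: conn_mid (nz_conn uw) (nz_conn wv).
transitivity (\sum_w (if seg S u v then cf w v a * cf u w b * co x u else 0)).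
  apply: eq_bigr => w _.
  have [uw|uw] := boolP (nz u w); last first.
    by rewrite (cf_out X b uw) mulr0 mul0r; do 2!case: ifP.
  have [wv|wv] := boolP (nz w v); last first.
    by rewrite (cf_out X a wv) mul0r mul0r; do 2!case: ifP.
  by rewrite split.
case: ifP => suv; last by rewrite big1.
have [uv|uv] := boolP (nz u v); first by rewrite (cfM X) // mulr_suml.
rewrite (cf_out X _ uv) mul0r big1 // => w _.
have [uw|uw] := boolP (nz u w); last by rewrite (cf_out X b uw) mulr0 mul0r.
have [wv|wv] := boolP (nz w v); last by rewrite (cf_out X a wv) mul0r mul0r.
case/negP: uv; apply: okS suv _.
exact: conn_trans (nz_conn uw) (nz_conn wv).
Qed.

Lemma seg_refl v : seg S v v = (v \in S).
Proof.
apply/idP/idP => [/seg_end //|vS]; apply/segP => w.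
by rewrite minnn maxnn => /between_eq/val_inj->.
Qed.

Lemma thin_scale1 : left_id 1 thin_scale.
Proof.
move=> x; apply: thin_ext => v vS; rewrite co_thin_scale (bigD1 v) //= big1.
  by rewrite seg_refl vS cf1 eqxx mul1r addr0.
by move=> u nu; rewrite cf1 (negPf nu) mul0r; case: ifP.
Qed.

Lemma thin_scaleDr : right_distributive thin_scale +%R.
Proof.
move=> a x y; apply: thin_ext => v _; rewrite coD !co_thin_scale -big_split /=.
by apply: eq_bigr => u _; rewrite coD; case: ifP; rewrite ?addr0 // mulrDr.
Qed.

Lemma thin_scaleDl x : {morph thin_scale^~ x : a b / a + b}.
Proof.
move=> a b; apply: thin_ext => v _; rewrite coD !co_thin_scale -big_split /=.
by apply: eq_bigr => u _; rewrite cfD; case: ifP; rewrite ?addr0 // mulrDl.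
Qed.

HB.instance Definition _ := GRing.Zmodule_isLmodule.Build R (thin okS X)
  thin_scaleA thin_scale1 thin_scaleDr thin_scaleDl.

Lemma co_scale a x v : co (a *: x) v =
  \sum_u (if seg S u v then cf u v a * co x u else 0).
Proof. exact: co_thin_scale. Qed.

Lemma co_sc c x v : co (sc c *: x) v = c * co x v.
Proof.
have [vS|vS] := boolP (v \in S); last by rewrite !co_out ?mulr0.
rewrite co_scale (bigD1 v) //= big1; first by rewrite seg_refl vS cf_sc eqxx addr0.
by move=> u nu; rewrite cf_sc (negPf nu) mul0r; case: ifP.
Qed.

Lemma co_lin c x y v : co (sc c *: x + y) v = c * co x v + co y v.
Proof. by rewrite coD co_sc. Qed.

Lemma co_pe u v x w :
  co (E u v *: x) w = if [&& w == v, nz u v & seg S u v] then co x u else 0.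
Proof.
rewrite co_scale (bigD1 u) //= big1 => [|z nzu].
  rewrite addr0 cf_pe eqxx /=; case: (w =P v) => [->|] //=.
    by case: (nz u v); case: ifP; rewrite ?mul1r ?mul0r.
  by rewrite mul0r; case: ifP.
by rewrite cf_pe (negPf nzu) mul0r; case: ifP.
Qed.

Lemma co_idem u x w : co (E u u *: x) w = if w == u then co x u else 0.
Proof.
rewrite co_pe nz_refl seg_refl /=; case: (w =P u) => //= _; case: ifP => // /negbT h.
by rewrite co_out.
Qed.

Lemma seg_adj u v : adj u v -> seg S u v = (u \in S) && (v \in S).
Proof.
move=> uv; apply/segP/andP => [h|[uS vS] w hw].
  by split; apply: h; rewrite geq_min leq_max leqnn ?orbT.
have [/val_inj->|/val_inj->] // : w = u :> nat \/ w = v :> nat.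
by move: uv hw; rewrite /adj; clear; lia.
Qed.

Lemma co_arr u v x w : arr u v ->
  co (E u v *: x) w = if (w == v) && (v \in S) then co x u else 0.
Proof.
move=> uv; rewrite co_pe nz_arr // seg_adj; last exact: arr_adjacent uv.
case: (w =P v) => //= _; case: (v \in S); rewrite ?andbF // andbT.
by case: ifP => // /negbT h; rewrite co_out.
Qed.

Definition bas w : thin okS X := thin_mk (fun v => (v == w)%:R).

Lemma co_bas w v : co (bas w) v = ((v == w) && (w \in S))%:R.
Proof.
by rewrite co_mk; case: (v =P w) => [->|_]; [case: ifP | rewrite if_same].
Qed.

Lemma co_sum (I : finType) (P : pred I) (F : I -> thin okS X) v :
  co (\sum_(i | P i) F i) v = \sum_(i | P i) co (F i) v.
Proof. exact: (big_morph (co^~ v) (fun x y => coD x y v) (co0 v)). Qed.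

Lemma bas_expand x : x = \sum_v sc (co x v) *: bas v.
Proof.
apply: thin_ext => v vS; rewrite co_sum (bigD1 v) //= big1 => [|u nu].
  by rewrite co_sc co_bas eqxx vS mulr1 addr0.
by rewrite co_sc co_bas eq_sym (negPf nu) mulr0.
Qed.

Lemma bas_eq0 w : w \in S -> bas w <> 0.
Proof. by move=> wS /(congr1 (co^~ w)); rewrite co_bas co0 eqxx wS => /eqP; rewrite oner_eq0. Qed.

Lemma bas_out w : w \notin S -> bas w = 0.
Proof. by move=> h; apply: thin_ext => v _; rewrite co_bas co0 (negPf h) andbF. Qed.

Lemma pe_bas u v : E u v *: bas u = if nz u v && seg S u v then bas v else 0.
Proof.
apply: thin_ext => w wS; rewrite co_pe co_bas eqxx /=.
case: (boolP (nz u v && seg S u v)) => [/andP[h1 h2]|]; rewrite ?andbF ?co0 //= andbT.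
by rewrite co_bas (seg_start h2) (seg_end h2) andbT; case: eqP.
Qed.

Lemma thin_finitely_generated : finitely_generated (thin okS X).
Proof. by exists n.+1, bas => x; exists (fun v => sc (co x v)); apply: bas_expand. Qed.

Lemma thin_zero : zero_module (thin okS X) <-> S = set0.
Proof.
split=> [z|S0 x]; last first.
  apply: thin_ext => v vS; have : v \in set0 by rewrite -S0.
  by rewrite inE.
apply/eqP; apply/set0Pn => -[w wS]; exact: bas_eq0 wS (z _).
Qed.

(** A map out of [thin S] amounts to a choice of images of the basis vectors; compatibility is only
    required along arrows. *)
Lemma hom_from (M : lmodType R) (z : 'I_n.+1 -> M) :
  (forall v, v \in S -> E v v *: z v = z v) ->
  (forall u v, arr u v -> u \in S -> E u v *: z u = if v \in S then z v else 0) ->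
  exists f : {linear thin okS X -> M},
    (forall x, f x = \sum_(v in S) sc (co x v) *: z v)
    /\ (forall v, v \in S -> f (bas v) = z v).
Proof.
move=> zi za; pose f x := \sum_(v in S) sc (co x v) *: z v.
have fb w : w \in S -> f (bas w) = z w.
  move=> wS; rewrite /f (bigD1 w) //= co_bas eqxx wS sc1 scale1r big1 ?addr0 //.
  by move=> v /andP[_ nv]; rewrite co_bas (negPf nv) sc0 scale0r.
have [|g gE] := @linear_mapP R (thin okS X) M f; last first.
  by exists g; split=> [x|v vS]; rewrite gE // fb.
apply: (@linear_arr _ _ _ _ X (thin okS X) M f).
- move=> c x y; rewrite /f scaler_sumr -big_split; apply: eq_bigr => v _.
  by rewrite co_lin scD scM scalerDl scalerA.
- move=> u x; rewrite /f scaler_sumr; apply: eq_bigr => v vS; rewrite co_idem.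
  case: (v =P u) => [<-|/eqP nvu].
    by rewrite -scS zi.
  by rewrite -(zi v vS) -scS peS0 // scaler0 sc0 scale0r.
- move=> u v x uv; rewrite /f scaler_sumr.
  have h w : w \in S -> w != u -> E u v *: (sc (co x w) *: z w) = 0.
    by move=> wS nwu; rewrite -scS -(zi w wS) peS0 ?scaler0.
  have [vS|vS] := boolP (v \in S).
    rewrite (bigD1 v) //= co_arr // eqxx vS big1 ?addr0 => [|w /andP[wS nw]]; last first.
      by rewrite co_arr // (negPf nw) sc0 scale0r.
    have [uS|uS] := boolP (u \in S).
      rewrite (bigD1 u) //= big1 => [|w /andP[wS nw]]; last exact: h.
      by rewrite -scS za // vS addr0.
    rewrite co_out // sc0 scale0r big1 // => w wS; apply: h => //.
    by apply: contraNneq uS => <-.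
  rewrite big1 => [|w wS]; last by rewrite co_arr // (negPf vS) andbF sc0 scale0r.
  rewrite big1 // => w wS; have [e|nw] := eqVneq w u; last exact: h.
  by rewrite e -scS za ?(negPf vS) ?scaler0 // -e.
Qed.

(** Dual to [hom_from]: a map into [thin S] amounts to its coordinate forms. *)
Lemma hom_to (M : lmodType R) (l : 'I_n.+1 -> M -> K) :
  (forall v, v \in S -> klin (l v)) ->
  (forall v m, v \in S -> l v (E v v *: m) = l v m) ->
  (forall u v m, arr u v -> v \in S ->
    l v (E u v *: m) = if u \in S then l u m else 0) ->
  exists f : {linear M -> thin okS X},
    forall m v, co (f m) v = if v \in S then l v m else 0.
Proof.
move=> lk li la; pose f m := thin_mk (fun v => l v m).
have [|g gE] := @linear_mapP R M (thin okS X) f; last first.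
  by exists g => m v; rewrite gE co_mk.
have h u v w m : v \in S -> w != v -> l v (E u w *: m) = 0.
  by move=> vS nw; rewrite -li // peS0 // (klin0 (lk v vS)).
apply: (@linear_arr _ _ _ _ X M (thin okS X) f) => [c x y|u x|u v x uv]; apply: thin_ext => w wS.
- by rewrite co_lin !co_mk wS lk.
- rewrite co_idem !co_mk wS; case: (w =P u) => [<-|/eqP nw]; first by rewrite wS li.
  by rewrite h // eq_sym.
- rewrite co_arr // !co_mk wS; case: (w =P v) => [e|/eqP nw] /=; last first.
    by rewrite h // eq_sym.
  by move: wS; rewrite e => vS; rewrite vS la.
Qed.

End Coordinates.

Section NaturalMaps.
Variables (S T : {set 'I_n.+1}) (okS : ok sh S) (okT : ok sh T).
Local Notation MS := (thin okS X).
Local Notation MT := (thin okT X).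

Lemma nat_map : comap sh S T -> exists f : {linear MS -> MT},
  forall x v, co (f x) v = if v \in T then co x v else 0.
Proof.
move=> ST; apply: hom_to => [v vT c x y|v m vT|u v m uv vT].
- exact: co_lin.
- by rewrite co_idem eqxx.
- rewrite co_arr // eqxx /=.
  have [uS|uS] := boolP (u \in S); first by rewrite (ST u v).
  by rewrite (co_out _ uS) !if_same.
Qed.

(** The trivial paths force [f] to be diagonal with entries [d v]. The arrows inside the interval
    [S :&: T] force these to be equal, and an arrow violating [comap] would force their common value
    to be 0. *)
Lemma thin_hom (f : {linear MS -> MT}) : convex S -> convex T ->
  exists c, (forall x v, co (f x) v = if v \in T then c * co x v else 0) /\
    (c != 0 -> comap sh S T).
Proof.
move=> cS cT.
have fi w v : w \in S -> w != v -> co (f (bas okS w)) v = 0.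
  move=> wS nw; have := linearZ_LR f (E w w) (bas okS w).
  rewrite pe_bas nz_refl seg_refl wS /= => ->.
  by rewrite co_idem eq_sym (negPf nw).
pose d v := co (f (bas okS v)) v.
have fd x v : co (f x) v = co x v * d v.
  rewrite [in LHS](bas_expand x) linear_sum co_sum (bigD1 v) //= big1 => [|w nw].
    by rewrite linearZ_LR co_sc addr0.
  have [wS|wS] := boolP (w \in S); last by rewrite (bas_out _ wS) scaler0 linear0 co0.
  by rewrite linearZ_LR co_sc fi // mulr0.
have dC u v : u \in S :&: T -> v \in S :&: T -> d u = d v.
  move: u v; apply: (convex_const (convexI cS cT)).
  have main u v : arr u v -> u \in S -> v \in S -> u \in T -> v \in T -> d u = d v.
    move=> uv uS vS uT vT; have := linearZ_LR f (E u v) (bas okS u).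
    rewrite pe_bas nz_arr // (seg_adj _ (arr_adjacent uv)) uS vS /=.
    by move/(congr1 (fun z => co z v)); rewrite co_arr // eqxx vT.
  move=> u v /setIP[uS uT] /setIP[vS vT] e.
  have /orP[uv|vu] := arr_total (up sh) (or_introl e : adj u v).
    exact: main.
  by apply/esym/main.
have [c cP] : exists c, forall v, v \in S :&: T -> d v = c.
  have [->|[w wST]] := set_0Vmem (S :&: T); first by exists 0 => v; rewrite inE.
  by exists (d w) => v vST; apply: dC.
exists c; split=> [x v|c0 u v uS vT uv].
  rewrite fd; case: ifP => vT; last by rewrite -fd co_out ?vT.
  have [vS|vS] := boolP (v \in S); last by rewrite co_out // mulr0 mul0r.
  by rewrite cP ?inE ?vS // mulrC.
have := linearZ_LR f (E u v) (bas okS u) => /(congr1 (fun z => co z v)).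
rewrite fd !co_arr // !eqxx vT /= fd co_bas eqxx uS.
have [vS|vS] := boolP (v \in S); have [uT|uT] := boolP (u \in T) => //.
- rewrite mul1r cP ?inE ?vS // /d (co_out _ uT) mulr0 => /eqP.
  by rewrite (negPf c0).
- rewrite mul0r mul1r cP ?inE ?uS // => /esym/eqP; by rewrite (negPf c0).
Qed.

End NaturalMaps.
End ThinModules.

(** * Classification of the indecomposable modules *)

Section Functionals.
Variables (n : nat) (sh : qshape n) (K : fieldType) (R : nzRingType).
Variable X : algsys sh K R.
Variable M : lmodType R.
Local Notation sc := (sc X).
Local Notation E := (pe X).
Implicit Types (x y z : M) (c : K) (W : M -> Prop).

Definition subspace W : Prop :=
  W 0 /\ forall c x y, W x -> W y -> W (sc c *: x + y).

Lemma subspaceD W x y : subspace W -> W x -> W y -> W (x + y).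
Proof. by move=> [_ WD] Wx Wy; have := WD 1 x y Wx Wy; rewrite sc1 scale1r. Qed.

Lemma subspaceZ W c x : subspace W -> W x -> W (sc c *: x).
Proof. by move=> [W0 WD] Wx; have := WD c x 0 Wx W0; rewrite addr0. Qed.

Lemma subspaceN W x : subspace W -> W x -> W (- x).
Proof.
by move=> sW Wx; have := subspaceZ (-1) sW Wx; rewrite scN sc1 scaleN1r.
Qed.

Lemma subspaceB W x y : subspace W -> W x -> W y -> W (x - y).
Proof. by move=> sW Wx Wy; apply: subspaceD => //; apply: subspaceN. Qed.

(** Membership in the sum of [W], the line of [z] and the span of [l]. *)
Fixpoint spanned W z (l : seq M) x : Prop :=
  if l is y :: l' then exists c, spanned W z l' (x - sc c *: y)
  else exists c, W (x - sc c *: z).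

Lemma spanned_subspace W z l : subspace W -> subspace (spanned W z l).
Proof.
move=> sW; elim: l => [|a l [IH0 IHD]] /=; split.
- by exists 0; rewrite sc0 scale0r subr0; case: sW.
- move=> c x y [d Wx] [e Wy]; exists (c * d + e).
  have := subspaceD sW (subspaceZ c sW Wx) Wy.
  by rewrite scD scM scalerDl scalerBr scalerA opprD addrACA.
- by exists 0; rewrite sc0 scale0r subr0.
- move=> c x y [d Wx] [e Wy]; exists (c * d + e).
  have := IHD c _ _ Wx Wy.
  by rewrite scD scM scalerDl scalerBr scalerA opprD addrACA.
Qed.

Lemma spanned_sub W W' z l x : (forall y, W y -> W' y) ->
  spanned W z l x -> spanned W' z l x.
Proof.
move=> WW'; elim: l x => [|a l IH] x /= [c h]; exists c; first exact: WW'.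
exact: IH.
Qed.

Lemma spanned_base W z l x : subspace W -> W x -> spanned W z l x.
Proof.
move=> sW; elim: l x => [|a l IH] x Wx /=; exists 0; rewrite sc0 scale0r subr0 //.
exact: IH.
Qed.

Lemma spanned_top W z l : subspace W -> spanned W z l z.
Proof.
move=> sW; elim: l => [|a l IH] /=.
  by exists 1; rewrite sc1 scale1r subrr; case: sW.
by exists 0; rewrite sc0 scale0r subr0.
Qed.

Lemma spanned_mem W z l x : subspace W -> x \in l -> spanned W z l x.
Proof.
move=> sW; elim: l => //= a l IH; rewrite inE => /predU1P[->|/IH h].
  by exists 1; rewrite sc1 scale1r subrr; apply: spanned_base => //; case: sW.
by exists 0; rewrite sc0 scale0r subr0.
Qed.

(** The vectors of [l] are absorbed one at a time. If [z] lies in [W] plus a non-zero multiple of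
    [a], then [a] already lies in the sum of [W] and the line of [z]; otherwise [a] can be added to
    [W] without reaching [z]. *)
Lemma hyperplane l W z : subspace W -> ~ W z -> (forall x, spanned W z l x) ->
  exists W', [/\ subspace W', forall x, W x -> W' x, ~ W' z &
    forall x, exists c, W' (x - sc c *: z)].
Proof.
elim: l W => [|a l IH] W sW nWz sp; first by exists W.
have [[d [W1 W2]]|h] := pselect (exists d, W (z - sc d *: a) /\ d != 0).
  apply: IH => // x; have [c h] := sp x.
  have sa : spanned W z l a.
    have ss := spanned_subspace z l sW.
    have := subspaceB ss (spanned_top z l sW) (spanned_base z l sW W1).
    rewrite opprB addrC subrK => /(subspaceZ d^-1 ss).
    by rewrite scalerA -scM mulVf // sc1 scale1r.
  have ss := spanned_subspace z l sW.
  by have := subspaceD ss h (subspaceZ c ss sa); rewrite subrK.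
pose W' x := exists c, W (x - sc c *: a).
have sW' : subspace W'.
  split=> [|c x y [d Wx] [e Wy]]; first by exists 0; rewrite sc0 scale0r subr0; case: sW.
  exists (c * d + e); have := subspaceD sW (subspaceZ c sW Wx) Wy.
  by rewrite scD scM scalerDl scalerBr scalerA opprD addrACA.
have WW' x : W x -> W' x by move=> Wx; exists 0; rewrite sc0 scale0r subr0.
have [|||V [sV W'V nVz Vz]] := IH W' => //.
- case=> d Wd; apply: h; exists d; split=> //; apply/eqP => d0; apply: nWz.
  by move: Wd; rewrite d0 sc0 scale0r subr0.
- move=> x; have [c h'] := sp x; have ss := spanned_subspace z l sW'.
  have W'a : W' a by exists 1; rewrite sc1 scale1r subrr; case: sW.
  have := subspaceD ss (spanned_sub WW' h') (subspaceZ c ss (spanned_base z l sW' W'a)).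
  by rewrite subrK.
by exists V; split=> // x /WW'/W'V.
Qed.

(** The multiples of the generators by paths span the module over the field. The form reads off the
    component along [z] modulo a hyperplane containing [W]. *)
Lemma separating_form W z : finitely_generated M -> subspace W -> ~ W z ->
  exists l : M -> K, [/\ klin X l, forall x, W x -> l x = 0 & l z = 1].
Proof.
move=> [m [g gP]] sW nWz.
pose s := [seq E p.1.1 p.1.2 *: g p.2 | p : ('I_n.+1 * 'I_n.+1) * 'I_m].
have [|W' [sW' WW' nW'z h]] := @hyperplane s W z sW nWz.
  move=> x; have ss := spanned_subspace z s sW.
  have sumS (I : finType) (F : I -> M) : (forall i, spanned W z s (F i)) ->
      spanned W z s (\sum_i F i).
    move=> hF; apply: big_ind => //; first by case: ss.
    by move=> ? ?; apply: subspaceD.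
  have [c ->] := gP x; apply: (sumS) => i; rewrite (pe_expand X (c i)) scaler_suml.
  apply: (sumS) => u; rewrite scaler_suml; apply: (sumS) => v; rewrite -scalerA.
  apply: subspaceZ => //; apply: spanned_mem => //.
  by apply/imageP; exists ((u, v), i).
pose l x := sval (cid (h x)); have lP x : W' (x - sc (l x) *: z) by rewrite /l; case: cid.
have lU x c : W' (x - sc c *: z) -> l x = c.
  move=> Wc; apply/eqP; rewrite -subr_eq0; apply/negPn/negP => d0; apply: nW'z.
  have := subspaceB sW' Wc (lP x); rewrite opprB addrC addrA subrK.
  rewrite -scalerBl -scN -scD => /(subspaceZ (l x - c)^-1 sW').
  by rewrite scalerA -scM mulVf // sc1 scale1r.
exists l; split=> [c x y|x Wx|].
- apply: lU; have := subspaceD sW' (subspaceZ c sW' (lP x)) (lP y).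
  by rewrite scD scM scalerDl scalerBr scalerA opprD addrACA.
- by apply: lU; rewrite sc0 scale0r subr0; apply: WW'.
- by apply: lU; rewrite sc1 scale1r subrr; case: sW'.
Qed.

End Functionals.

(** * Splitting off an interval module *)

Section IntervalSummand.
Variables (n : nat) (sh : qshape n) (K : fieldType) (R : nzRingType).
Variable X : algsys sh K R.
Variable M : lmodType R.
Hypothesis fgM : finitely_generated M.
Local Notation arr := (arr (up sh)).
Local Notation conn := (conn (up sh)).
Local Notation sc := (sc X).
Local Notation E := (pe X).
Local Notation klin := (klin X).
Local Notation subspace := (subspace X).
Implicit Types (u v w i j : 'I_n.+1).

(* Compatible vectors x v and linear forms l v at the vertices v between j    *)
(* and i; the boundary conditions are only imposed on the right.              *)
Record family j i (x : 'I_n.+1 -> M) (l : 'I_n.+1 -> M -> K) : Prop := Family {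
  fam_x : forall v, (j <= v <= i)%N -> E v v *: x v = x v;
  fam_xa : forall u v, arr u v -> (j <= u <= i)%N -> (j <= v)%N ->
    E u v *: x u = if (v <= i)%N then x v else 0;
  fam_lin : forall v, (j <= v <= i)%N -> klin (l v);
  fam_l : forall v m, (j <= v <= i)%N -> l v (E v v *: m) = l v m;
  fam_la : forall u v m, arr u v -> (j <= v <= i)%N -> (j <= u)%N ->
    l v (E u v *: m) = if (u <= i)%N then l u m else 0
}.

Lemma family_single j xj lj : E j j *: xj = xj -> klin lj ->
  (forall m, lj (E j j *: m) = lj m) ->
  (forall v, arr j v -> v = j.+1 :> nat -> E j v *: xj = 0) ->
  (forall v m, arr v j -> v = j.+1 :> nat -> lj (E v j *: m) = 0) ->
  family j j (fun=> xj) (fun=> lj).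
Proof.
have e v : (j <= v <= j)%N -> v = j by move/between_eq/val_inj.
move=> h1 h2 h3 h4 h5; split=> [v /e->|u v uv /e ej jv|v _|v m /e->|u v m uv /e ej ju] //.
- rewrite ej in uv *; have vj : v = j.+1 :> nat.
    by have := arr_adjacent uv; rewrite /adj; move: jv; clear; lia.
  by rewrite h4 // vj ltnn.
- rewrite ej in uv *; have uj : u = j.+1 :> nat.
    by have := arr_adjacent uv; rewrite /adj; move: ju; clear; lia.
  by rewrite h5 // uj ltnn.
Qed.

Lemma family_extend j j1 i x l xj lj : j1 = j.+1 :> nat -> (j1 <= i)%N ->
  family j1 i x l -> E j j *: xj = xj -> klin lj ->
  (forall m, lj (E j j *: m) = lj m) ->
  (arr j j1 -> E j j1 *: xj = x j1 /\ forall m, l j1 (E j j1 *: m) = lj m) ->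
  (arr j1 j -> E j1 j *: x j1 = xj /\ forall m, lj (E j1 j *: m) = l j1 m) ->
  family j i (fun v => if v == j then xj else x v)
    (fun v => if v == j then lj else l v).
Proof.
move=> j1E j1i [f1 f2 f3 f4 f5] h1 h2 h3 h4 h5.
have above v : (j <= v)%N -> v != j -> (j1 <= v)%N.
  by move=> jv nv; have : v != j :> nat by []; move: jv j1E; clear; lia.
have above2 v : (j <= v <= i)%N -> v != j -> (j1 <= v <= i)%N.
  by case/andP=> jv vi nv; rewrite above.
have next v : adj j v -> (j <= v)%N -> v = j1.
  by move=> jv lv; apply: val_inj; move: jv lv j1E; rewrite /adj /=; clear; lia.
have j1j : j1 != j by apply/eqP => e; move: j1E; rewrite e; clear; lia.
have ji : (j <= i)%N by move: j1i; rewrite j1E; apply: ltnW.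
split=> [v vS|u v uv uS jv|v vS|v m vS|u v m uv vS ju].
- by case: eqP => [->|/eqP nv] //; apply/f1/above2.
- case: (u =P j) => [e|/eqP nu].
    have e1 : v = j1 by apply: next => //; rewrite -e; apply: arr_adjacent uv.
    rewrite e e1 in uv *; rewrite (negPf j1j) j1i; exact: (h4 uv).1.
  case: (v =P j) => [e|/eqP nv]; last by apply: f2 => //; [apply: above2|apply: above].
  have e1 : u = j1.
    by apply: next; [rewrite -e; apply: adjC; apply: arr_adjacent uv|case/andP: uS].
  by rewrite e e1 in uv *; rewrite ji; exact: (h5 uv).1.
- by case: eqP => // /eqP nv; apply/f3/above2.
- by case: eqP => [->|/eqP nv] //; apply/f4/above2.
- case: (v =P j) => [e|/eqP nv].
    have e1 : u = j1 by apply: next => //; rewrite -e; apply: adjC; apply: arr_adjacent uv.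
    rewrite e e1 in uv *; rewrite (negPf j1j) j1i; exact: (h5 uv).2.
  case: (u =P j) => [e|/eqP nu]; last by apply: f5 => //; [apply: above2|apply: above].
  have e1 : v = j1.
    by apply: next; [rewrite -e; apply: arr_adjacent uv|case/andP: vS].
  by rewrite e e1 in uv *; rewrite ji; exact: (h4 uv).2.
Qed.

(* By induction from the right end: when the arrow between j and j + 1 does   *)
(* not separate B from C, these are replaced by their images, or by their     *)
(* inverse images, at the vertex j + 1.                                       *)
Lemma family_exists k j (B C : M -> Prop) : (n - j = k)%N ->
  subspace B -> subspace C -> (forall y, B y -> C y) ->
  (forall y, C y -> E j j *: y = y) -> (exists y, C y /\ ~ B y) ->
  exists i x l, [/\ (j <= i)%N, family j i x l, C (x j), l j (x j) = 1
    & forall y, B y -> l j y = 0].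
Proof.
elim: k j B C => [|k IH] j B C jk sB sC BC Ce.
  case=> y [Cy nBy].
  have [lj [kl lB ly]] := separating_form fgM sB nBy.
  have lastj v : v <> j.+1 :> nat by move: jk (ltn_ord v); clear; lia.
  exists j, (fun=> y), (fun _ m => lj (E j j *: m)); split=> // [||m Bm] //.
  - apply: family_single => [|c x z|m|v _ /lastj|v m _ /lastj] //.
    + exact: Ce.
    + by rewrite scalerDr -scS kl.
    + by rewrite peSl.
  - by rewrite Ce.
  - by rewrite Ce ?lB //; apply: BC.
move=> CB; have lt : (j.+1 < n.+1)%N by move: jk; clear; lia.
pose j1 := Ordinal lt; have j1E : j1 = j.+1 :> nat by [].
have jj1 : adj j j1 by left.
have next v : v = j.+1 :> nat -> v = j1 by move=> e; apply: val_inj.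
have k1 : (n - j1 = k)%N by move: jk; rewrite j1E; clear; lia.
have single y (W : M -> Prop) : C y -> subspace W -> (forall z, B z -> W z) -> ~ W y ->
    (forall z, W z -> E j j *: z = z) ->
    (arr j j1 -> E j j1 *: y = 0) -> (arr j1 j -> forall m, W (E j1 j *: m)) ->
    exists i x l, [/\ (j <= i)%N, family j i x l, C (x j), l j (x j) = 1
      & forall y, B y -> l j y = 0].
  move=> Cy sW BW nWy We hy hW; have [lj [kl lW ly]] := separating_form fgM sW nWy.
  exists j, (fun=> y), (fun _ m => lj (E j j *: m)); split=> // [||m Bm] //.
  - apply: family_single => [|c x z|m|v jv /next e|v m jv /next e].
    + exact: Ce.
    + by rewrite scalerDr -scS kl.
    + by rewrite peSl.
    + by rewrite e in jv *; rewrite hy.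
    + by rewrite e in jv *; rewrite peSl lW //; apply: hW.
  - by rewrite Ce.
  - by rewrite Ce ?lW //; [apply: BW | apply: BC].
have /orP[ja|ja] := arr_total (up sh) jj1.
  have nja : ~ arr j1 j by rewrite (arr_asym ja).
  (* Arrow from [j] to [j + 1]. If it kills a vector of [C] outside [B], the interval ends at [j];
     otherwise the part of its kernel in [C] lies in [B], and the images of [B] and [C] remain
     distinct. *)
  have [[y [Cy ey nBy]]|h] := pselect (exists y, [/\ C y, E j j1 *: y = 0 & ~ B y]).
    by apply: (single y B) => // z /BC/Ce.
  have inj y : C y -> E j j1 *: y = 0 -> B y.
    by move=> Cy ey; apply: contrapT => nB; apply: h; exists y.
  pose im (W : M -> Prop) z := exists2 y, W y & E j j1 *: y = z.
  have s_im W : subspace W -> subspace (im W).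
    move=> [W0 WD]; split=> [|c _ _ [x Wx <-] [y Wy <-]].
      by exists 0; rewrite ?scaler0.
    by exists (sc c *: x + y); rewrite ?scalerDr ?scS //; apply: WD.
  have [|||z [y Cy <-]||i [x [l [j1i fam [y Cy yE] lx lB]]]] := IH j1 (im B) (im C) k1.
  - exact: s_im.
  - exact: s_im.
  - by move=> _ [y By <-]; exists y => //; apply: BC.
  - by rewrite peSl.
  - case: CB => y [Cy nBy]; exists (E j j1 *: y); split; first by exists y.
    case=> b Bb eb; apply: nBy.
    have : B (y - b).
      apply: inj; last by rewrite scalerBr eb subrr.
      exact: subspaceB sC Cy (BC _ Bb).
    by move=> /(subspaceD sB Bb); rewrite addrC subrK.
  have ji : (j <= i)%N by move: j1i; rewrite j1E; apply: ltnW.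
  exists i, (fun v => if v == j then y else x v),
    (fun v => if v == j then (fun m => l j1 (E j j1 *: m)) else l v).
  rewrite eqxx; split=> // [||b Bb].
  - apply: family_extend (j1E) (j1i) (fam) _ _ _ _ _ => //; first exact: Ce.
    + move=> c a b; rewrite scalerDr -scS; apply: fam_lin fam _ _ _ _ _.
      by rewrite leqnn.
    + by move=> m; rewrite peSr.
  - by rewrite yE.
  - by apply: lB; exists b.
have nja : ~ arr j j1 by rewrite (arr_asym ja).
pose W z := exists b m, B b /\ z = b + E j1 j *: m.
have sW : subspace W.
  split=> [|c _ _ [b [m [Bb ->]]] [b' [m' [Bb' ->]]]].
    by exists 0, 0; rewrite scaler0 addr0; case: sB.
  exists (sc c *: b + b'), (sc c *: m + m'); split; first by case: sB => _; apply.
  by rewrite !scalerDr scS addrACA.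
(* Arrow from [j + 1] to [j], with [W] the sum of [B] and its image. A vector of [C] outside [W]
   ends the interval at [j]; otherwise every vector of [C] comes, modulo [B], from [j + 1]. *)
have [[y [Cy nWy]]|h] := pselect (exists y, C y /\ ~ W y).
  apply: (single y W) => //.
  - by move=> z Bz; exists z, 0; rewrite scaler0 addr0.
  - by move=> _ [b [m [Bb ->]]]; rewrite scalerDr peSl Ce //; apply: BC.
  - by move=> _ m; exists 0, m; rewrite add0r; case: sB.
have CW y : C y -> W y by move=> Cy; apply: contrapT => nW; apply: h; exists y.
pose pre (V : M -> Prop) m := E j1 j1 *: m = m /\ V (E j1 j *: m).
have s_pre V : subspace V -> subspace (pre V).
  move=> sV; split=> [|c a b [e1 V1] [e2 V2]].
    by rewrite /pre !scaler0; case: sV.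
  by rewrite /pre !scalerDr -!scS e1 e2; split=> //; case: sV => _; apply.
have [|||m []||i [x [l [j1i fam [xe Cx] lx lB]]]] := IH j1 (pre B) (pre C) k1 => //.
- exact: s_pre.
- exact: s_pre.
- by move=> m [e Bm]; split=> //; apply: BC.
- case: CB => y [Cy nBy]; have [b [m [Bb yE]]] := CW y Cy.
  have mE : E j1 j *: (E j1 j1 *: m) = y - b by rewrite peSr yE addrC addKr.
  exists (E j1 j1 *: m); split; first split; rewrite ?peSl //.
    by rewrite mE; apply: subspaceB sC Cy (BC _ Bb).
  case=> _; rewrite mE => Byb; apply: nBy.
  by have := subspaceD sB Byb Bb; rewrite subrK.
(* The form at [j] has to vanish on [B] and to give [l j1] when composed with the arrow. So it must
   kill [V] and be 1 on the image of [x j1], which is outside [V]. *)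
pose V z := exists b m, [/\ B b, l j1 m = 0 & z = b + E j1 j *: m].
have j1S : (j1 <= j1 <= i)%N by rewrite leqnn.
have lk := fam_lin fam j1S.
have sV : subspace V.
  split=> [|c _ _ [b [m [Bb lm ->]]] [b' [m' [Bb' lm' ->]]]].
    by exists 0, 0; rewrite scaler0 addr0 (klin0 lk); split=> //; case: sB.
  exists (sc c *: b + b'), (sc c *: m + m'); split.
  - by case: sB => _; apply.
  - by rewrite lk lm lm' mulr0 addr0.
  - by rewrite !scalerDr scS addrACA.
have nVx : ~ V (E j1 j *: x j1).
  case=> b [m [Bb lm e]].
  have : l j1 (E j1 j1 *: (x j1 - m)) = 0.
    apply: lB; split; first by rewrite peSl.
    by rewrite peSr scalerBr e addrK.
  rewrite (fam_l fam) // (klinB _ _ lk) lx lm subr0 => /eqP.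
  by rewrite oner_eq0.
have [lj [kl lV lxj]] := separating_form fgM sV nVx.
have ji : (j <= i)%N by move: j1i; rewrite j1E; apply: ltnW.
exists i, (fun v => if v == j then E j1 j *: x j1 else x v),
  (fun v => if v == j then (fun m => lj (E j j *: m)) else l v).
rewrite eqxx; split=> // [||b Bb].
- apply: family_extend (j1E) (j1i) (fam) _ _ _ _ _ => //.
  + by rewrite peSl.
  + by move=> c a b; rewrite scalerDr -scS kl.
  + by move=> m; rewrite peSl.
  + move=> _; split=> // m; rewrite peSl.
    have -> : m = (m - sc (l j1 m) *: x j1) + sc (l j1 m) *: x j1 by rewrite subrK.
    set d := l j1 m; rewrite scalerDr (klinD _ _ kl) -scS (klinZ _ _ kl) lxj mulr1.
    rewrite lV ?add0r; last first.
      exists 0, (m - sc d *: x j1); rewrite add0r; split=> //; first by case: sB.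
      by rewrite (klinB _ _ lk) (klinZ _ _ lk) lx mulr1 subrr.
    by rewrite (klinD _ _ lk) (klinB _ _ lk) (klinZ _ _ lk) lx mulr1 subrK.
- by rewrite peSl.
- rewrite Ce; last exact: BC.
  by apply: lV; exists b, 0; rewrite scaler0 addr0 (klin0 lk).
Qed.

End IntervalSummand.

(** * Interval modules as indecomposables, and irreducible morphisms between them *)

Section IntervalModules.
Variables (n : nat) (sh : qshape n) (K : fieldType) (R : nzRingType).
Variable X : algsys sh K R.
Local Notation arr := (arr (up sh)).
Local Notation conn := (conn (up sh)).
Local Notation nz := (nz sh).
Local Notation sc := (sc X).
Local Notation E := (pe X).
Implicit Types (u v w i j : 'I_n.+1) (S T : {set 'I_n.+1}).

(** Endomorphisms of [thin S] are scalars, so a single coordinate decides whether a composite is the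
    identity. All later splittings are checked in this way. *)
Lemma thin_scalar S (okS : ok sh S) (M : lmodType R) (f : {linear thin okS X -> M})
    (g : {linear M -> thin okS X}) : convex S ->
  (exists2 v, v \in S & co (g (f (bas X okS v))) v = 1) -> cancel f g.
Proof.
move=> cS [v vS e]; have [h hE] := comp_linear g f.
have [c [cE _]] := thin_hom h cS cS.
have c1 : c = 1 by have := cE (bas X okS v) v; rewrite hE e vS co_bas eqxx vS mulr1.
by move=> x; apply: thin_ext => w wS; rewrite -hE cE wS c1 mul1r.
Qed.

(** [family_exists] is applied at the leftmost vertex [a] of the support, with [B] zero and [C] the
    whole space at [a]; the missing conditions on the left hold because the module vanishes there.
    The vectors and forms give maps from [thin S] to [M] and back whose composite is the
    identity. *)
Lemma indecomposable_thin_iso (M : lmodType R) :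
  finitely_generated M -> indecomposable M ->
  exists S (okS : ok sh S), [/\ convex S, S != set0 & isomorphic M (thin okS X)].
Proof.
move=> fgM indM; have [nzM _] := indM.
pose P v := `[< exists m : M, E v v *: m <> 0 >].
have [v0 Pv0] : exists v, P v.
  apply: contrapT => h; apply: nzM => m; rewrite -(sum_peS X m) big1 // => v _.
  by apply: contrapT => hv; apply: h; exists v; apply/asboolP; exists m.
case: (arg_minnP (P := P) (fun v => v : nat) Pv0) => a /asboolP[m0 m0E] amin.
have below v (m : M) : (v < a)%N -> E v v *: m = 0.
  move=> va; apply: contrapT => h.
  by have := amin v; rewrite leqNgt va => /(_ _)/negP; apply=> //; apply/asboolP; exists m.
pose B (y : M) := y = 0; pose C (y : M) := E a a *: y = y.
have [||y ->|//||i [x [l [ai fam _ lx _]]]] := @family_exists _ _ _ _ X M fgM _ a B C erefl.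
- by split=> // c _ _ -> ->; rewrite scaler0 addr0.
- split=> [|c y z Cy Cz]; first exact: scaler0.
  by rewrite /C scalerDr -scS Cy Cz.
- exact: scaler0.
- by exists (E a a *: m0); split; rewrite /C ?peSl.
pose S := [set v : 'I_n.+1 | (a <= v <= i)%N].
have inS v : (v \in S) = (a <= v <= i)%N by rewrite inE.
have cS : convex S by move=> u v w; rewrite !inE; clear; lia.
have aS : a \in S by rewrite inS leqnn.
have xarr u v : arr u v -> u \in S -> E u v *: x u = if v \in S then x v else 0.
  move=> uv; rewrite !inS => uS; case: (leqP a v) => [av|va] /=; first exact: fam_xa fam _ _ uv uS av.
  by rewrite -peSl below.
have larr u v m : arr u v -> v \in S -> l v (E u v *: m) = if u \in S then l u m else 0.
  move=> uv; rewrite !inS => vS; case: (leqP a u) => [au|ua] /=; first exact: fam_la fam _ _ _ uv vS au.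
  by rewrite -peSr below // scaler0 (klin0 (fam_lin fam vS)).
have lx1 v : v \in S -> l v (x v) = 1.
  move=> vS; rewrite -lx; apply: (convex_const (f := fun v => l v (x v)) cS) => // {vS}u {}v uS vS e.
  have /orP[uv|vu] := arr_total (up sh) (or_introl e : adj u v).
    by have := larr u v (x u) uv vS; rewrite xarr // vS uS.
  by have := larr v u (x v) vu uS; rewrite xarr // vS uS.
have xconn u v : u \in S -> v \in S -> conn u v -> E u v *: x u = x v.
  have [k] := ubnP `|u - v|%N; elim: k u => // k IH u lk uS vS uv.
  have [->|nuv] := eqVneq u v; first by apply: fam_x fam _ _; rewrite -inS.
  have [w [uw wv lw]] := conn_first uv nuv.
  have wS : w \in S by apply: (convex_between cS uS vS); apply: conn_mid (arr_conn uw) wv.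
  rewrite -(@peS _ _ _ _ X M u w v (x u) (arr_conn uw) wv) xarr // wS IH //.
  by move: lw lk; clear; lia.
have okS : ok sh S.
  apply: ok_weak => u v uS vS uv; apply: contrapT => /negP nuv.
  have := lx1 v vS; rewrite -(xconn u v) // (pe_out X nuv) scale0r.
  have lk : klin X (l v) by apply: fam_lin fam _ _; rewrite -inS.
  by rewrite (klin0 lk) => /eqP; rewrite eq_sym oner_eq0.
have [|f [_ fE]] := @hom_from _ _ _ _ X S okS M x _ xarr.
  by move=> v vS; apply: fam_x fam _ _; rewrite -inS.
have [||g gE] := @hom_to _ _ _ _ X S okS M l _ _ larr.
- by move=> v vS; apply: fam_lin fam _ _; rewrite -inS.
- by move=> v m vS; apply: fam_l fam _ _ _; rewrite -inS.
exists S, okS; split=> //; first by apply/set0Pn; exists a.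
have fK : cancel f g.
  by apply: thin_scalar => //; exists a; rewrite ?fE ?gE ?aS.
by apply: retraction_indecomposable fK indM _ => /thin_zero S0; move: aS; rewrite S0 inE.
Qed.

(** The projector on a direct factor is a scalar equal to its square, hence 0 or 1. *)
Lemma thin_indecomposable S (okS : ok sh S) : convex S -> S != set0 ->
  indecomposable (thin okS X).
Proof.
move=> cS S0; split=> [/thin_zero S0'|Y Z [f /bijective_linear_inv[g fK gK]]].
  by rewrite S0' eqxx in S0.
have [p pE] : exists p : {linear thin okS X -> thin okS X}, forall x, p x = g ((f x).1, 0).
  apply: linear_mapP => a x y; rewrite [f _]linearP -(linearP g); congr (g _).
  by apply: injective_projections; rewrite /= ?scaler0 ?addr0.
have pp x : p (p x) = p x by rewrite !pE gK.
have [c [cE _]] := thin_hom p cS cS.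
have [v vS] := set0Pn _ S0.
have : c * c = c.
  have := congr1 (fun z => co z v) (pp (bas X okS v)).
  by rewrite !cE vS co_bas eqxx vS /= !mulr1.
move/eqP; rewrite -subr_eq0 -{3}[c]mulr1 -mulrBr mulf_eq0 subr_eq0.
case/orP=> /eqP cv; [left|right] => y.
  have : p (g (y, 0)) = 0 by apply: thin_ext => w _; rewrite cE cv mul0r if_same co0.
  rewrite pE gK /= => /(congr1 f); rewrite gK linear0 => e.
  by have /= := congr1 (fun z => z.1) e.
have : p (g (0, y)) = g (0, y) by apply: thin_ext => w wS; rewrite cE cv mul1r wS.
rewrite pE gK /= => /(congr1 f); rewrite !gK => e.
by have /= := congr1 (fun z => z.2) e.
Qed.

Lemma thin_eq_iso S T (okS : ok sh S) : S = T -> forall okT : ok sh T,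
  isomorphic (thin okS X) (thin okT X).
Proof.
case: T / => okT; rewrite (Prop_irrelevance okT okS); exact: isomorphic_refl.
Qed.

Lemma thin_iso_sub S T (okS : ok sh S) (okT : ok sh T) : convex S -> convex T ->
  S != set0 -> (exists (f : {linear thin okS X -> thin okT X})
    (g : {linear thin okT X -> thin okS X}), cancel f g) ->
  [/\ S \subset T, comap sh S T & comap sh T S].
Proof.
move=> cS cT S0 [f [g fK]].
have [c [cE cC]] := thin_hom f cS cT.
have [d [dE dC]] := thin_hom g cT cS.
have key v : v \in S -> d * c != 0 /\ v \in T.
  move=> vS; have := congr1 (fun z => co z v) (fK (bas X okS v)).
  rewrite dE vS cE co_bas eqxx vS.
  case: ifP => [vT|_]; last by rewrite mulr0 => /esym/eqP; rewrite oner_eq0.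
  by rewrite !mulr1 => ->; rewrite oner_neq0.
have [v vS] := set0Pn _ S0.
have [] := key v vS; rewrite mulf_eq0 negb_or => /andP[d0 c0] _.
by split; [apply/subsetP => w /key[] | apply: cC | apply: dC].
Qed.

Lemma thin_iso_eq S T (okS : ok sh S) (okT : ok sh T) : convex S -> convex T ->
  S != set0 -> isomorphic (thin okS X) (thin okT X) -> S = T.
Proof.
move=> cS cT S0 [f /bijective_linear_inv[g fK gK]].
have [|ST _ _] := thin_iso_sub (okS := okS) (okT := okT) cS cT S0; first by exists f, g.
have T0 : T != set0 by apply: contraNneq S0 => T0; rewrite -subset0 -T0.
have [|TS _ _] := thin_iso_sub (okS := okT) (okT := okS) cT cS T0; first by exists g, f.
by apply/eqP; rewrite eqEsubset ST.
Qed.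

(** An edge of [T] leaving [S] violates one of the two conditions, according to its orientation. *)
Lemma comap_eq S T : convex T -> S != set0 -> S \subset T ->
  comap sh S T -> comap sh T S -> S = T.
Proof.
move=> cT S0 ST SC TC; apply/eqP/negPn/negP => nST.
have [u [v [uS vT vS uv]]] := convex_boundary cT ST S0 nST.
have uT := subsetP ST _ uS.
have /orP[a|a] := arr_total (up sh) uv.
  by have := SC u v uS vT a; rewrite uT (negPf vS).
by have := TC v u vT uS a; rewrite uT (negPf vS).
Qed.

(** The transported map is a multiple of the natural one. Factorizing it through [thin U] turns
    irreducibility into a condition on intervals, a one-sided splitting giving equality by
    [comap_eq]. *)
Lemma irreducible_thin (M N : lmodType R) (f : {linear M -> N}) S T
    (okS : ok sh S) (okT : ok sh T) :
  irreducible_morphism f -> convex S -> convex T -> S != set0 -> T != set0 ->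
  isomorphic M (thin okS X) -> isomorphic N (thin okT X) ->
  exists (p : {linear M -> thin okS X}) (q : {linear N -> thin okT X}) (c : K),
   [/\ bijective p, bijective q, c != 0,
     forall x v, co (q (f x)) v = if v \in T then c * co (p x) v else 0 &
   [/\ comap sh S T, S :&: T != set0, S != T &
     forall U, convex U -> ok sh U -> comap sh S U -> comap sh U T ->
       S :&: T \subset U -> U = S \/ U = T]].
Proof.
move=> [nsm nse irr] cS cT S0 T0 [p pb] [q qb].
have [p' pK p'K] := bijective_linear_inv pb.
have [q' qK q'K] := bijective_linear_inv qb.
have [fp fpE] := comp_linear f p'.
have [g0 g0E] := comp_linear q fp.
have [c [cE cC]] := thin_hom g0 cS cT.
have main x v : co (q (f x)) v = if v \in T then c * co (p x) v else 0.
  by rewrite -cE g0E fpE pK.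
have facU U (okU : ok sh U) (h : {linear thin okS X -> thin okU X})
    (k : {linear thin okU X -> thin okT X}) :
    (forall x, k (h x) = g0 x) ->
    (exists r : {linear thin okU X -> thin okS X}, cancel h r) \/
    (exists r : {linear thin okT X -> thin okU X}, cancel r k).
  move=> khE.
  have [hp hpE] := comp_linear h p; have [qk qkE] := comp_linear q' k.
  have [|[r rK]|[r rK]] := irr _ hp qk (thin_finitely_generated X okU).
  - by move=> x; rewrite qkE hpE khE g0E fpE pK qK.
  - left; have [r' r'E] := comp_linear p r; exists r' => x.
    by rewrite r'E -{2}(p'K x) -(rK (p' x)) hpE p'K.
  - right; have [r' r'E] := comp_linear r q'; exists r' => x.
    by rewrite r'E -[k _]q'K -qkE rK q'K.
(* A zero map would factor through the zero module [thin set0], and either splitting would make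
   [thin S] or [thin T] zero. *)
have g0_neq0 : c != 0 /\ S :&: T != set0.
  apply/andP/negPn/negP; rewrite negb_and !negbK => h.
  have z x : g0 x = 0.
    apply: thin_ext => v vT; rewrite cE vT co0; case/orP: h => [/eqP->|/eqP ST].
      by rewrite mul0r.
    rewrite co_out ?mulr0 //; apply/negP => vS.
    have : v \in S :&: T by rewrite inE vS.
    by rewrite ST inE.
  have ok0 : ok sh set0 by apply: ok_set0.
  have z0 (y : thin ok0 X) : y = 0 by apply: thin_ext => v; rewrite inE.
  have [h0 h0E] : exists h0 : {linear thin okS X -> thin ok0 X}, forall x, h0 x = 0.
    by apply: (@linear_mapP R _ _ (fun=> 0)) => a x y; rewrite scaler0 addr0.
  have [k0 k0E] : exists k0 : {linear thin ok0 X -> thin okT X}, forall x, k0 x = 0.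
    by apply: (@linear_mapP R _ _ (fun=> 0)) => a x y; rewrite scaler0 addr0.
  have [|[r rK]|[r rK]] := facU _ ok0 h0 k0.
  - by move=> x; rewrite k0E z.
  - case/set0Pn: S0 => v vS; case: (bas_eq0 (X := X) (okS := okS) vS).
    by rewrite -(rK (bas X okS v)) h0E linear0.
  - case/set0Pn: T0 => v vT; case: (bas_eq0 (X := X) (okS := okT) vT).
    by rewrite -(rK (bas X okT v)) (z0 (r _)) linear0.
have [c0 ST0] := g0_neq0; have ST := cC c0.
exists p, q, c; split=> //; split=> // [|U cU okU SU UT sub].
  apply/eqP => e; apply: nsm.
  have [r rE] : exists r : {linear thin okT X -> thin okS X},
      forall x v, co (r x) v = if v \in S then co x v else 0.
    by apply: nat_map => u v; rewrite -e => uT vS _; rewrite uT vS.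
  have [r1 r1E] := comp_linear r q; have [r2 r2E] := comp_linear p' r1.
  have [r3 r3E] : exists r3 : {linear N -> M}, forall x, r3 x = sc c^-1 *: r2 x.
    by apply: linear_mapP => a x y; rewrite linearP scalerDr scS.
  exists r3 => x; rewrite r3E r2E r1E -[RHS]pK -linearZ; congr (p' _).
  apply: thin_ext => v vS; rewrite co_sc rE vS main -e vS.
  by rewrite mulrA mulVf // mul1r.
have [h hE] := nat_map X okS okU SU; have [k kE] := nat_map X okU okT UT.
have [k' k'E] : exists k' : {linear thin okU X -> thin okT X}, forall x, k' x = sc c *: k x.
  by apply: linear_mapP => a x y; rewrite linearP scalerDr scS.
have [|[r rK]|[r rK]] := facU U okU h k'.
- move=> x; apply: thin_ext => v vT; rewrite k'E co_sc kE vT hE cE vT; congr (_ * _).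
  case: ifP => // /negbT vU; rewrite co_out //; apply: contraNN vU => vS.
  by apply: (subsetP sub); rewrite inE vS.
- left; have [|SsU _ US] := thin_iso_sub (okS := okS) (okT := okU) cS cU S0; first by exists h, r.
  by apply/esym/comap_eq.
- right; have [|TsU TU _] := thin_iso_sub (okS := okT) (okT := okU) cT cU T0; first by exists r, k'.
  by apply/esym/comap_eq.
Qed.

End IntervalModules.

(** * The irreducible morphisms attached to an arrow *)

Section ArrowSets.
Variables (n : nat) (sh : qshape n).
Local Notation arr := (arr (up sh)).
Local Notation conn := (conn (up sh)).
Local Notation nz := (nz sh).
Variables (s t : 'I_n.+1).
Hypothesis st : arr s t.
Implicit Types (u v w : 'I_n.+1).
Local Notation U := (Uset sh s t).
Local Notation V := (Vset sh s t).

Let st_adj : adj s t := arr_adjacent st.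
Let ts_adj : adj t s := adjC st_adj.

(** The arrow joins the start of [V] to the end of [U], so [thin Nset] has [thin U] as a submodule
    with quotient [thin V]. *)
Definition Nset := U :|: V.

Lemma in_Vset v : (v \in V) = nz s v && side s t v.
Proof. by rewrite inE. Qed.

Lemma arr_cross u v : arr u v -> side t s u -> ~~ side s t v.
Proof.
move=> uv su; apply/negP => sv.
have [e1 e2] : u = t :> nat /\ v = s :> nat.
  by apply: side_cross ts_adj (arr_adjacent uv) su _; rewrite -sideN.
by move: uv; rewrite e1 e2 (arr_asym st).
Qed.

Lemma arr_cross_back u v : arr u v -> side s t u -> ~~ side s t v -> u = s /\ v = t.
Proof.
move=> uv su sv; have [e1 e2] := side_cross st_adj (arr_adjacent uv) su sv.
by split; apply: val_inj.
Qed.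

Lemma t_in_Uset : t \in U.
Proof. by rewrite in_Uset nz_refl side_refl. Qed.

Lemma Uset_Vset v : v \in U -> v \in V -> False.
Proof.
rewrite in_Uset in_Vset (sideN v st_adj) => /andP[_ h] /andP[_ h'].
by rewrite h' in h.
Qed.

Lemma Vset_notU v : v \in V -> (v \in U) = false.
Proof. by move=> vV; apply/negP => vU; apply: Uset_Vset vU vV. Qed.

Lemma Uset_notV v : v \in U -> (v \in V) = false.
Proof. by move=> vU; apply/negP => vV; apply: Uset_Vset vU vV. Qed.

(** In this form [V] is the support of the cokernel of the map from the projective at [t] to the one
    at [s]. *)
Lemma Vset_alt v : (v \in V) = nz s v && ~~ nz t v.
Proof.
rewrite in_Vset; have [sv|sv] //= := boolP (nz s v).
have [sd|sd] := boolP (side s t v); apply/esym.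
  apply/negP => tv; have : ~~ side t s v by rewrite (sideN v st_adj) sd.
  move/(side_between ts_adj) => m; have /andP[ts _] := conn_between m (nz_conn tv).
  by case: (adj_neq st_adj); apply: conn_anti (arr_conn st) ts.
apply/negPn; have m := side_between st_adj sd.
have /andP[c1 c2] := conn_between m (nz_conn sv).
by have /andP[] := nz_sub c1 c2 sv.
Qed.

Lemma in_Nset v : (v \in Nset) = (v \in U) || (v \in V).
Proof. exact: in_setU. Qed.

Lemma Nset_convex : convex Nset.
Proof.
have key u v w : u \in U -> w \in V -> (u <= v <= w)%N || (w <= v <= u)%N -> v \in Nset.
  move=> uU wV h; have := uU; have := wV.
  rewrite in_Uset in_Vset => /andP[_ sw] /andP[_ su]; rewrite inE.
  have [sv|sv] := boolP (side s t v).
    apply/orP; right; apply: (convex_between (@Vset_convex _ sh s t) (Vset_start sh s t) wV).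
    exact: side_mid st_adj su sw sv h.
  apply/orP; left; apply: (convex_between (@Uset_convex _ sh s t) t_in_Uset uU).
  by apply: (side_mid ts_adj sw su); rewrite ?(sideN v st_adj) // orbC.
move=> u v w /setUP[uU|uV] /setUP[wU|wV] h.
- by rewrite in_Nset (Uset_convex uU wU h).
- by apply: key uU wV _; rewrite h.
- by apply: key wU uV _; rewrite h orbT.
- by rewrite in_Nset (Vset_convex uV wV h) orbT.
Qed.

(** No path leads from [U] to [V]. A path from [V] to [U] starts at a vertex reached from [s] and
    ends at one leading to [t], so it can only be the arrow itself. *)
Lemma Nset_ok : ok sh Nset.
Proof.
apply: ok_weak => u v /setUP[uU|uV] /setUP[vU|vV] uv.
- exact: (ok_convex (@Uset_convex _ sh s t) (@Uset_ok _ sh s t)).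
- move: uU vV; rewrite in_Uset in_Vset => /andP[_ su] /andP[_ sv].
  have [m m'] := side_apart st_adj su sv.
  have /andP[_ tv] := conn_between m uv; have /andP[ts _] := conn_between m' tv.
  by case: (adj_neq st_adj); apply: conn_anti (arr_conn st) ts.
- move: uV vU; rewrite in_Uset in_Vset => /andP[nu su] /andP[nv sv].
  have [m m'] := side_apart ts_adj su sv.
  have /andP[us sv'] := conn_between m uv; have /andP[_ tv] := conn_between m' sv'.
  have -> : u = s by apply: val_inj; apply: conn_anti us (nz_conn nu).
  have -> : v = t by apply: val_inj; apply: conn_anti (nz_conn nv) tv.
  exact: nz_arr.
- exact: (ok_convex (@Vset_convex _ sh s t) (@Vset_ok _ sh s t)).
Qed.

Lemma comap_Uset_Nset : comap sh U Nset.
Proof.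
move=> u v uU vN uv; rewrite in_Nset uU /=; case/setUP: vN => // vV.
move: uU vV; rewrite in_Uset in_Vset => /andP[_ su] /andP[_ sv].
by have := arr_cross uv su; rewrite sv.
Qed.

Lemma comap_Nset_Vset : comap sh Nset V.
Proof.
move=> u v uN vV uv; rewrite in_Nset vV orbT; case/setUP: uN => // uU.
move: uU vV; rewrite in_Uset in_Vset => /andP[_ su] /andP[_ sv].
by have := arr_cross uv su; rewrite sv.
Qed.

Lemma not_comap_Nset_Uset : ~ comap sh Nset U.
Proof.
move=> /(_ s t); rewrite !in_Nset Vset_start orbT t_in_Uset => /(_ isT isT st).
by rewrite Vset_notU ?Vset_start.
Qed.

Lemma not_comap_Vset_Nset : ~ comap sh V Nset.
Proof.
move=> /(_ s t); rewrite !in_Nset t_in_Uset Vset_start orbT => /(_ isT isT st).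
by rewrite Uset_notV ?t_in_Uset.
Qed.

Variables (K : fieldType) (R : nzRingType) (X : algsys sh K R).
Local Notation sc := (sc X).
Local Notation E := (pe X).
Let cU : convex U := @Uset_convex _ sh s t.
Let cV : convex V := @Vset_convex _ sh s t.
Let cN : convex Nset := Nset_convex.
Let okU : ok sh U := @Uset_ok _ sh s t.
Let okV : ok sh V := @Vset_ok _ sh s t.
Let okN : ok sh Nset := Nset_ok.
Let sV : s \in V := Vset_start sh s t.
Let sN : s \in Nset. Proof. by rewrite in_Nset sV orbT. Qed.
Let tN : t \in Nset. Proof. by rewrite in_Nset t_in_Uset. Qed.
Let U0 : U != set0. Proof. by apply/set0Pn; exists t; apply: t_in_Uset. Qed.
Let V0 : V != set0. Proof. by apply/set0Pn; exists s. Qed.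
Let N0 : Nset != set0. Proof. by apply/set0Pn; exists s. Qed.

Lemma arr_bas S (okS : ok sh S) u v : arr u v -> u \in S ->
  E u v *: bas X okS u = if v \in S then bas X okS v else 0.
Proof.
move=> uv uS; rewrite pe_bas (nz_arr uv) (seg_adj _ (arr_adjacent uv)) uS /=.
by [].
Qed.

Lemma idem_bas S (okS : ok sh S) u : E u u *: bas X okS u = bas X okS u.
Proof.
have [uS|uS] := boolP (u \in S); last by rewrite bas_out // scaler0.
by rewrite pe_bas nz_refl seg_refl uS.
Qed.

(* A factorization through Z splits according to whether the image of bas t  *)
(* in Z lies in the image of the arrow s -> t.                                *)
Lemma irreducible_Uset_Nset (f : {linear thin okU X -> thin okN X}) :
  (forall x v, co (f x) v = if v \in Nset then co x v else 0) ->
  irreducible_morphism f.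
Proof.
move=> fE; split=> [[g fK]|[g gK]|Z h g fgZ fhg].
- have [|_ _ c] := thin_iso_sub (okS := okU) (okT := okN) (X := X) cU cN U0; first by exists f, g.
  exact: not_comap_Nset_Uset c.
- have [|sub _ _] := thin_iso_sub (okS := okN) (okT := okU) (X := X) cN cU N0; first by exists g, f.
  by have := subsetP sub _ sN; rewrite Vset_notU.
have tt : co (g (h (bas X okU t))) t = 1.
  by rewrite -fhg fE tN co_bas eqxx t_in_Uset.
pose z u := h (bas X okU u).
have zi u : E u u *: z u = z u by rewrite -linearZ idem_bas.
have za u v : arr u v -> u \in U -> E u v *: z u = if v \in U then z v else 0.
  move=> uv uU; rewrite -linearZ arr_bas //; case: ifP => // _; exact: linear0.
have [[m mE]|nm] := pselect (exists m, z t = E s t *: m).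
  (* The translates of [m] along [V] extend the family [z], since [m] is sent to [z t] by the arrow;
     this gives a section of [g]. *)
  right; pose z' v := if v \in U then z v else E s v *: m.
  have [||r [_ rE]] := @hom_from _ _ _ _ X _ okN Z z'.
  - by move=> v _; rewrite /z'; case: ifP => _; rewrite ?zi ?peSl.
  - move=> u v uv; rewrite /z' !in_Nset; have [uU _|nuU /= uV] := boolP (u \in U).
      rewrite za //; case: ifP => //= _; case: ifP => // vV.
      move: uU vV; rewrite in_Uset in_Vset => /andP[_ su] /andP[_ sv].
      by have := arr_cross uv su; rewrite sv.
    have := uV; rewrite in_Vset => /andP[nu su].
    rewrite peS ?(arr_conn uv) ?nz_conn //.
    have [sv|sv] := boolP (side s t v).
      have -> : v \in U = false by rewrite in_Uset (sideN v st_adj) sv andbF.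
      rewrite in_Vset sv andbT /=; case: ifP => // /negbT nv.
      by rewrite pe_out // scale0r.
    have [_ ->] := arr_cross_back uv su sv.
    by rewrite t_in_Uset -mE.
  exists r; apply: thin_scalar => //; exists t => //.
  by rewrite rE // /z' t_in_Uset.
left.
(* A form that is 1 at [z t] and kills the image of the arrow, composed with the paths to [t], gives
   a retraction of [h]. Its vanishing is the compatibility needed at the arrow that enters [U] from
   [s]. *)
have sW : subspace X (fun y : Z => exists m, y = E s t *: m).
  split=> [|c _ _ [x ->] [y ->]]; first by exists 0; rewrite scaler0.
  by exists (sc c *: x + y); rewrite scalerDr scS.
have [l [kl lW lz]] := separating_form fgZ sW nm.
have [|v m vU|u v m uv vU|r rE] := @hom_to _ _ _ _ X _ okU Z (fun u m => l (E u t *: m)).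
- by move=> v _ c x y; rewrite scalerDr -scS kl.
- by rewrite peSr.
- have := vU; rewrite in_Uset => /andP[nv sv].
  rewrite peS ?(arr_conn uv) ?nz_conn //; case: ifP => // /negbT.
  rewrite in_Uset negb_and => /orP[nu|su]; first by rewrite pe_out // scale0r (klin0 kl).
  rewrite (sideN u st_adj) negbK in su.
  have [|-> _] := arr_cross_back uv su; first by rewrite -(sideN v st_adj).
  by apply: lW; exists m.
exists r; apply: thin_scalar => //; exists t; first exact: t_in_Uset.
by rewrite rE t_in_Uset -/(z t) zi.
Qed.

(** The dichotomy is whether some vector of [Z] at [s] is killed by the arrow to [t] but has image
    of coordinate 1 at [s]. Its translates then give a section of [g]. If there is none, the
    coordinate form of [g] at [s] vanishes on the kernel of the arrow, so it factors through the
    arrow and extends to a form at [t], whence a retraction of [h]. *)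
Lemma irreducible_Nset_Vset (f : {linear thin okN X -> thin okV X}) :
  (forall x v, co (f x) v = if v \in V then co x v else 0) ->
  irreducible_morphism f.
Proof.
move=> fE; split=> [[g fK]|[g gK]|Z h g fgZ fhg].
- have [|sub _ _] := thin_iso_sub (okS := okN) (okT := okV) (X := X) cN cV N0; first by exists f, g.
  by have := subsetP sub _ tN; rewrite Uset_notV // t_in_Uset.
- have [|_ c _] := thin_iso_sub (okS := okV) (okT := okN) (X := X) cV cN V0; first by exists g, f.
  exact: not_comap_Vset_Nset c.
pose w0 := h (bas X okN s).
have gw0 : co (g w0) s = 1 by rewrite /w0 -fhg fE sV co_bas eqxx sN.
have w0i : E s s *: w0 = w0 by rewrite /w0 -linearZ idem_bas.
have [[w [wi w0' wg]]|nw] := pselect (exists w : Z, [/\ E s s *: w = w, E s t *: w = 0 & co (g w) s = 1]).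
  right; have [||r [_ rE]] := @hom_from _ _ _ _ X _ okV Z (fun v => E s v *: w).
  - by move=> v _; rewrite peSl.
  - move=> u v uv uV; have := uV; rewrite in_Vset => /andP[nu su].
    rewrite peS ?(arr_conn uv) ?nz_conn //; case: ifP => // /negbT.
    rewrite in_Vset negb_and => /orP[nv|sv]; first by rewrite pe_out // scale0r.
    by have [_ ->] := arr_cross_back uv su sv.
  exists r; apply: thin_scalar => //; exists s => //.
  by rewrite rE // wi.
have ker (w : Z) : E s s *: w = w -> E s t *: w = 0 -> co (g w) s = 0.
  move=> wi w0'; apply/eqP/negPn/negP => d0; apply: nw.
  exists (sc (co (g w) s)^-1 *: w).
  by rewrite -!scS wi w0' scaler0 linearZ co_sc mulVf.
left.
(* A form that kills [W] takes equal values on a vector at [s] and on its image at [t]; normalized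
   at [w0], it agrees at [s] with the coordinate form of [g]. *)
pose W (y : Z) := exists m x, [/\ E s s *: x = x, co (g x) s = 0 &
  y = E s t *: m - E s s *: m + x].
have sW : subspace X W.
  split=> [|c _ _ [m [x [xi gx ->]]] [m' [x' [xi' gx' ->]]]].
    by exists 0, 0; rewrite !scaler0 linear0 co0 subr0 addr0.
  exists (sc c *: m + m'), (sc c *: x + x'); split.
  - by rewrite scalerDr -scS xi xi'.
  - by rewrite linearP co_lin gx gx' mulr0 addr0.
  - by rewrite !scalerDr -!scS scalerN opprD addrACA [X in X + _ = _]addrACA.
have nst : s != t by apply/eqP => e; case: (adj_neq st_adj); rewrite e.
have nW : ~ W w0.
  case=> m [x [xi gx e]].
  have m0 : E s t *: m = 0.
    have := congr1 (fun y => E t t *: y) e.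
    rewrite -w0i peS0 // scalerDr scalerBr peSl peS0 // -xi peS0 // addr0 subr0.
    by move->.
  have gm := ker (E s s *: m); rewrite peSl peSr in gm.
  move: gw0; rewrite e m0 sub0r linearD linearN coD gx addr0.
  rewrite -[- g _]scaleN1r -(sc1 X) -scN co_sc gm // mulr0 => /eqP.
  by rewrite eq_sym oner_eq0.
have [l [kl lW lw0]] := separating_form fgZ sW nW.
have ls (y : Z) : E s s *: y = y -> l y = co (g y) s.
  move=> yi; have : l (y - sc (co (g y) s) *: w0) = 0.
    apply: lW; exists 0, (y - sc (co (g y) s) *: w0); split.
    - by rewrite scalerBr -scS yi w0i.
    - by rewrite linearB linearZ -scaleN1r -(sc1 X) -scN coD !co_sc gw0 mulr1 mulN1r subrr.
    - by rewrite !scaler0 subr0 add0r.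
  by rewrite (klinB _ _ kl) (klinZ _ _ kl) lw0 mulr1 => /subr0_eq.
have lst (m : Z) : l (E s t *: m) = co (g m) s.
  have : l (E s t *: m - E s s *: m) = 0.
    by apply: lW; exists m, 0; rewrite scaler0 linear0 co0 addr0.
  rewrite (klinB _ _ kl) => /subr0_eq->; rewrite ls ?peSl // linearZ co_idem eqxx.
  by [].
pose l' v m := if v \in U then l (E v t *: m) else co (g m) v.
have [|v m vN|u v m uv vN|r rE] := @hom_to _ _ _ _ X _ okN Z l'.
- move=> v _ c x y; rewrite /l'; case: ifP => _; last by rewrite linearP co_lin.
  by rewrite scalerDr -scS kl.
- rewrite /l'; case: ifP => _; first by rewrite peSr.
  by rewrite linearZ co_idem eqxx.
- rewrite /l' in_Nset; case/setUP: vN => [vU|vV].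
    rewrite vU; have /andP[nv sv] : nz v t && side t s v by rewrite -in_Uset.
    rewrite peS ?(arr_conn uv) ?nz_conn //; have [//|/=] := boolP (u \in U).
    rewrite in_Uset negb_and => /orP[nu|su].
      rewrite pe_out // scale0r (klin0 kl); case: ifP => // uV.
      have := uV; rewrite in_Vset => /andP[_ su].
      have [|e _] := arr_cross_back uv su; first by rewrite -(sideN v st_adj).
      by rewrite e (nz_arr st) in nu.
    rewrite (sideN u st_adj) negbK in su.
    have [|-> _] := arr_cross_back uv su; first by rewrite -(sideN v st_adj).
    by rewrite sV lst.
  rewrite Vset_notU // linearZ co_arr // eqxx vV /=.
  have [uU|uU] := boolP (u \in U).
    move: uU vV; rewrite in_Uset in_Vset => /andP[_ su] /andP[_ sv].
    by have := arr_cross uv su; rewrite sv.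
  by rewrite /=; case: ifP => // /negbT uV; rewrite co_out.
exists r; apply: thin_scalar => //; exists s => //.
by rewrite rE sN /l' Vset_notU // gw0.
Qed.

End ArrowSets.

(** * Projective modules and the translate *)

Section Projectives.
Variables (n : nat) (sh : qshape n) (K : fieldType) (R : nzRingType).
Variable X : algsys sh K R.
Local Notation arr := (arr (up sh)).
Local Notation conn := (conn (up sh)).
Local Notation nz := (nz sh).
Local Notation sc := (sc X).
Local Notation E := (pe X).
Implicit Types (u v w j : 'I_n.+1).

Definition Pset j := [set v : 'I_n.+1 | nz j v].

Lemma in_Pset j v : (v \in Pset j) = nz j v.
Proof. by rewrite inE. Qed.

Lemma Pset_start j : j \in Pset j.
Proof. by rewrite in_Pset nz_refl. Qed.

Lemma Pset_convex j : convex (Pset j).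
Proof.
move=> u v w; rewrite !in_Pset => nu nw h.
have [m|m] : ((j <= v <= w) || (w <= v <= j))%N \/ ((j <= v <= u) || (u <= v <= j))%N.
  by move: h; clear; lia.
- by have /andP[a b] := conn_between m (nz_conn nw); have /andP[] := nz_sub a b nw.
- by have /andP[a b] := conn_between m (nz_conn nu); have /andP[] := nz_sub a b nu.
Qed.

Lemma Pset_ok j : ok sh (Pset j).
Proof.
apply: ok_weak => u v; rewrite !in_Pset => nu nv uv.
by have /andP[] := nz_sub (nz_conn nu) uv nv.
Qed.

Local Notation okP j := (@Pset_ok j).
Local Notation P j := (thin (okP j) X).
Local Notation pbas j := (bas X (okP j) j).

Lemma pe_pbas j v : v \in Pset j -> E j v *: pbas j = bas X (okP j) v.
Proof.
by move=> vP; rewrite pe_bas (convex_seg _ _ (@Pset_convex j)) Pset_start vP -in_Pset vP.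
Qed.

(* The embedding of the projective module P j in the algebra as the left      *)
(* ideal generated by the trivial path at j.                                  *)
Lemma proj_embedding j : exists e : {linear P j -> R^o},
  [/\ forall x, (e x : R) *: pbas j = x, forall x, e x * E j j = e x
    & forall a, e (a *: pbas j) = a * E j j].
Proof.
have [||e [eE eb]] := @hom_from _ _ _ _ X _ (okP j) R^o (fun v => E j v).
- by move=> v; rewrite in_Pset => jv; rewrite -[LHS]/(E v v * E j v) peM ?conn_refl ?nz_conn.
- move=> u v uv; rewrite !in_Pset => ju; rewrite -[LHS]/(E u v * E j u) (peM X (nz_conn ju) (arr_conn uv)).
  by case: ifP => // /negbT h; apply: (pe_out X h).
have bj : e (pbas j) = E j j by apply: eb; apply: Pset_start.
have eK x : (e x : R) *: pbas j = x.
  rewrite eE scaler_suml [RHS](bas_expand x) [RHS](bigID (mem (Pset j))) /=.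
  rewrite [X in _ = _ + X]big1 ?addr0 => [|v /(bas_out X (okP j))->]; last by rewrite scaler0.
  by apply: eq_bigr => v vP; rewrite -scalerA pe_pbas.
have eM a : e (a *: pbas j) = a * E j j by rewrite linearZ bj.
by exists e; split=> // x; rewrite -eM eK.
Qed.

Lemma proj_hom j (M : lmodType R) (y : M) (e : {linear P j -> R^o}) :
  exists f : {linear P j -> M}, forall x, f x = (e x : R) *: y.
Proof.
by apply: (@linear_mapP R _ _ (fun x => (e x : R) *: y)) => a x z; rewrite linearP scalerDl scalerA.
Qed.

Lemma proj_projective j : projective (P j).
Proof.
move=> M N g h gs; have [e [eK eE eM]] := proj_embedding j.
have [m mE] := gs (h (pbas j)).
have [f fE] := proj_hom m e.
by exists f => x; rewrite fE linearZ mE -linearZ eK.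
Qed.

Lemma pe_proj j (x : P j) : E j j *: x = sc (co x j) *: pbas j.
Proof.
apply: thin_ext => v _; rewrite co_idem co_sc co_bas Pset_start andbT.
by case: eqP => [_|_]; rewrite ?mulr1 ?mulr0.
Qed.

(** The trivial path at [j] extracts from [x] a non-zero multiple of the generator. Thus [P j] is
    local, which yields its radical and the superfluity of kernels. *)
Lemma proj_submodule j (S : P j -> Prop) x :
  submodule S -> S x -> co x j != 0 -> forall y, S y.
Proof.
move=> [S0 SD] Sx xj y; have SZ a z : S z -> S (a *: z).
  by move=> Sz; have := SD a z 0 Sz S0; rewrite addr0.
have [e [eK _ _]] := proj_embedding j.
rewrite -(eK y); apply: (SZ).
have -> : pbas j = sc (co x j)^-1 *: (E j j *: x); last exact: SZ (SZ _ _ Sx).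
by rewrite pe_proj scalerA -scM mulVf // sc1 scale1r.
Qed.

Lemma proj_superfluous j (M : lmodType R) (f : {linear P j -> M}) :
  f (pbas j) <> 0 -> superfluous_kernel f.
Proof.
move=> fb S subS Sk; have [s [k [Ss fk e]]] := Sk (pbas j).
apply: (proj_submodule subS Ss).
have kj : co k j = 0.
  apply/eqP/negPn/negP => kj; apply: fb.
  have sub : submodule (fun x => f x = 0).
    split=> [|a x y fx fy]; first exact: linear0.
    by rewrite linearP fx fy scaler0 addr0.
  exact: (proj_submodule sub fk kj).
have := congr1 (fun z => co z j) e; rewrite coD kj addr0 co_bas eqxx Pset_start => <-.
by rewrite oner_neq0.
Qed.

Lemma proj_radical j (x : P j) : radical x <-> co x j = 0.
Proof.
pose r (x : P j) := co x j = 0.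
have sub_r : submodule r.
  split=> [|a y z yr zr]; first exact: co0.
  apply/eqP; rewrite coD zr addr0 co_scale big1 // => u _.
  case: ifP => // suj; have [uj|uj] := boolP (nz u j); last by rewrite (cf_out X) ?mul0r.
  have ju : nz j u by rewrite -in_Pset (seg_start suj).
  have -> : u = j by apply: val_inj; apply: conn_anti (nz_conn uj) (nz_conn ju).
  by rewrite yr mulr0.
have prop_r : ~ (forall y, r y).
  by move=> /(_ (pbas j)); rewrite /r co_bas eqxx Pset_start => /eqP; rewrite oner_eq0.
split=> [rx|xr S [subS nS maxS]].
  apply: (rx r); split=> // T subT rT.
  have [h|h] := pselect (exists2 y, T y & co y j != 0).
    by right; case: h => y Ty yj; apply: (proj_submodule subT Ty).
  by left=> y Ty; apply/eqP/negPn/negP => yj; apply: h; exists y.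
have Sr y : S y -> r y.
  by move=> Sy; apply/eqP/negPn/negP => yj; apply: nS; apply: (proj_submodule subS Sy).
by have [rS|//] := maxS r sub_r Sr; apply: rS.
Qed.

Lemma proj_thin_hom j S (okS : ok sh S) (e : {linear P j -> R^o}) :
  (forall x, (e x : R) *: pbas j = x) -> convex S -> j \in S ->
  forall (f : {linear P j -> thin okS X}), f (pbas j) = bas X okS j ->
  forall x v, co (f x) v = if v \in S then co x v else 0.
Proof.
move=> eK cS jS f fb x v; rewrite [in LHS](bas_expand x) linear_sum co_sum.
have fv u : u \in Pset j -> f (bas X (okP j) u) = if u \in S then bas X okS u else 0.
  move=> uP; rewrite -pe_pbas // linearZ_LR fb pe_bas -in_Pset uP (convex_seg _ _ cS) jS.
  by [].
rewrite (bigD1 v) //= big1 => [|u nu]; rewrite linearZ_LR co_sc.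
  rewrite addr0; have [vP|vP] := boolP (v \in Pset j).
    by rewrite fv //; case: ifP => vS; rewrite ?co0 ?mulr0 // co_bas eqxx vS mulr1.
  by rewrite (co_out x vP) mul0r if_same.
have [uP|uP] := boolP (u \in Pset j); last by rewrite (co_out x uP) mul0r.
rewrite fv //; case: ifP => _; rewrite ?co0 ?mulr0 //.
by rewrite co_bas eq_sym (negPf nu) mulr0.
Qed.

(* The sequence P t -> P s -> thin (V s t) -> 0 attached to an arrow s -> t.  *)
Lemma arrow_presentation (s t : 'I_n.+1) (es : {linear P s -> R^o})
    (et : {linear P t -> R^o}) :
  (forall x, (es x : R) *: pbas s = x) -> (forall a, es (a *: pbas s) = a * E s s) ->
  (forall x, (et x : R) *: pbas t = x) -> (forall a, et (a *: pbas t) = a * E t t) ->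
  arr s t ->
  exists (d : {linear P t -> P s}) (c : {linear P s -> thin (@Vset_ok n sh s t) X}),
    [/\ forall x, d x = (et x : R) *: (E s t *: pbas s),
        surjective_map c,
        forall x, c x = 0 <-> exists y, d y = x,
        superfluous_kernel d & superfluous_kernel c].
Proof.
move=> esK esM etK etM st.
have tP : t \in Pset s by rewrite in_Pset nz_arr.
have [d dE] := proj_hom (E s t *: pbas s) et.
have [c cE] := proj_hom (bas X (@Vset_ok n sh s t) s) es.
have dt : d (pbas t) = bas X (okP s) t.
  by rewrite dE -[pbas t]scale1r etM mul1r peSl pe_pbas.
have cs : c (pbas s) = bas X (@Vset_ok n sh s t) s.
  by rewrite cE -[pbas s]scale1r esM mul1r idem_bas.
have dco := proj_thin_hom etK (@Pset_convex s) tP dt.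
have cco := proj_thin_hom esK (@Vset_convex n sh s t) (Vset_start sh s t) cs.
exists d, c; split=> //.
- move=> y; exists (thin_mk X (okP s) (fun v => co y v)); apply: thin_ext => v vV.
  have vP : v \in Pset s by move: vV; rewrite in_Vset in_Pset => /andP[].
  by rewrite cco vV co_mk vP.
- move=> x; split=> [cx|[y <-]].
    exists (thin_mk X (okP t) (fun v => co x v)); apply: thin_ext => v vP.
    rewrite dco vP co_mk; case: ifP => // /negbT ntv.
    have vV : v \in Vset sh s t by rewrite Vset_alt // -!in_Pset vP.
    by have := congr1 (fun z => co z v) cx; rewrite cco vV co0.
  apply: thin_ext => v vV; rewrite cco vV co0 dco.
  case: ifP => // _; rewrite co_out // in_Pset.
  by move: vV; rewrite Vset_alt // => /andP[].
- by apply: proj_superfluous; rewrite dt; apply: bas_eq0.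
- by apply: proj_superfluous; rewrite cs; apply: bas_eq0; apply: Vset_start.
Qed.

End Projectives.

(** * Right modules, duality and the inverse translate *)

Section OppositeSystem.
Variables (n : nat) (sh : qshape n) (K : fieldType) (R : nzRingType).
Variable X : algsys sh K R.

Let cfo (u v : 'I_n.+1) (a : R^c) : K := cf X v u a.
Let peo (u v : 'I_n.+1) : R^c := pe X v u.
Let sco (c : K) : R^c := sc X c.

Lemma op_cf_inj a b : (forall u v, cfo u v a = cfo u v b) -> a = b.
Proof. by move=> h; apply: (@cf_inj _ _ _ _ X) => u v; apply: (h v u). Qed.

Lemma op_cf_out u v a : ~~ nz (op_shape sh) u v -> cfo u v a = 0.
Proof. exact: (@cf_out _ _ _ _ X). Qed.

Lemma op_cfD u v a b : cfo u v (a + b) = cfo u v a + cfo u v b.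
Proof. exact: (@cfD _ _ _ _ X). Qed.

Lemma op_cf1 u v : cfo u v 1 = (u == v)%:R.
Proof. by rewrite /cfo eq_sym; apply: (@cf1 _ _ _ _ X). Qed.

Lemma op_cfM u w (a b : R^c) : nz (op_shape sh) u w ->
  cfo u w (a * b) = \sum_v cfo v w a * cfo u v b.
Proof.
move=> h; rewrite /cfo; apply: etrans (cfM X b a h) _.
by apply: eq_bigr => v _; rewrite mulrC.
Qed.

Lemma op_cf_pe u v u' v' :
  cfo u v (peo u' v') = [&& u == u', v == v' & nz (op_shape sh) u v]%:R.
Proof. by rewrite /cfo /peo cf_pe andbCA. Qed.

Lemma op_cf_sc u v c : cfo u v (sco c) = if u == v then c else 0.
Proof. by rewrite /cfo /sco cf_sc eq_sym. Qed.

Definition op_sys : algsys (op_shape sh) K R^c :=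
  AlgSys op_cf_inj op_cf_out op_cfD op_cf1 op_cfM op_cf_pe op_cf_sc.

End OppositeSystem.

Section Translate.
Variables (n : nat) (sh : qshape n) (K : fieldType) (A : algType K).
Variable X : algsys sh K A.
Hypothesis scE : forall c, sc X c = c%:A.
Local Notation E := (pe X).
Local Notation P j := (thin (@Pset_ok n sh j) X).
Local Notation pbas j := (bas X (@Pset_ok n sh j) j).
Local Notation Po j := (thin (@Pset_ok n (op_shape sh) j) (op_sys X)).
Local Notation pbaso j := (bas (op_sys X) (@Pset_ok n (op_shape sh) j) j).
Implicit Types (j : 'I_n.+1).

(** The identification of $\mathrm{Hom}(e_jA,A)$ with $Ae_j$: a form is determined by its value at
    the generator and acts by multiplication in $A$. *)
Lemma proj_hom_to_algebra j (e : {linear P j -> A^o}) (eo : {linear Po j -> (A^c)^o}) :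
  (forall x, (e x : A) *: pbas j = x) -> (forall x, e x * E j j = e x) ->
  (forall a, e (a *: pbas j) = a * E j j) ->
  (forall x, (eo x : A^c) *: pbaso j = x) ->
  (forall a : A, eo ((a : A^c) *: pbaso j) = E j j * a) ->
  is_hom_to_algebra (fun (l : P j) (x : Po j) => (e l : A) * (eo x : A)).
Proof.
move=> eK eE eM eoK eoM.
have eob : eo (pbaso j) = E j j.
  by rewrite -[pbaso j]scale1r; apply: etrans (eoM 1) _; apply: (@mulr1 A).
split.
- move=> l; split=> [x y|a x]; first by rewrite linearD mulrDr.
  by rewrite linearZ -mulrA.
- by move=> a l l' x; rewrite linearP mulrDl -mulrA.
- move=> l l' /(_ (pbaso j)); rewrite eob !eE => ll'.
  by rewrite -(eK l) ll' eK.
- move=> phi [phiD phiM]; exists (phi (pbaso j) *: pbas j) => x.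
  rewrite eM -phiM.
  have -> : ((E j j : A^c) *: pbaso j) = pbaso j.
    exact: (idem_bas (op_sys X)).
  by rewrite -phiM eoK.
Qed.

(** The bases at the vertices of [S] are dual to each other, so duality keeps the interval and only
    reverses the arrows. *)
Lemma thin_dual S (okS : ok sh S) (okSo : ok (op_shape sh) S) :
  is_dual (thin okS X) (thin okSo (op_sys X)).
Proof.
exists (fun z x => \sum_v co z v * co x v); split.
- move=> z c x y; rewrite mulr_sumr -big_split; apply: eq_bigr => v _.
  by rewrite -scE co_lin mulrDr mulrCA.
- by move=> z z' x; rewrite -big_split; apply: eq_bigr => v _; rewrite coD mulrDl.
- move=> a z x.
  transitivity (\sum_v \sum_u (if seg S u v then cf X v u a * co z u * co x v else 0)).
    apply: eq_bigr => v _; rewrite co_scale mulr_suml; apply: eq_bigr => u _.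
    by case: ifP; rewrite ?mul0r.
  rewrite exchange_big; apply: eq_bigr => u _; rewrite co_scale mulr_sumr.
  apply: eq_bigr => v _; rewrite segC; case: ifP; rewrite ?mulr0 //.
  by rewrite mulrCA mulrA.
- move=> z z' h; apply: thin_ext => v vS.
  have key y : \sum_u co y u * co (bas X okS v) u = co y v.
    rewrite (bigD1 v) //= co_bas eqxx vS mulr1 big1 ?addr0 // => u nu.
    by rewrite co_bas (negPf nu) mulr0.
  by have := h (bas X okS v); rewrite !key.
- move=> phi phil; exists (thin_mk (op_sys X) okSo (fun v => phi (bas X okS v))) => x.
  have phiD y y' : phi (y + y') = phi y + phi y'.
    by have := phil 1 y y'; rewrite !scale1r mul1r.
  have phi0 : phi 0 = 0 by apply: (addrI (phi 0)); rewrite -phiD !addr0.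
  have phiZ c y : phi (sc X c *: y) = c * phi y.
    by have := phil c y 0; rewrite !addr0 phi0 addr0 scE.
  rewrite [in RHS](bas_expand x) (big_morph phi phiD phi0); apply: eq_bigr => v _.
  rewrite phiZ co_mk mulrC; case: ifP => // /negbT vS.
  by rewrite co_out // !mul0r.
Qed.

(** The interval [U] is the [Vset] of the reversed arrow, so [arrow_presentation] over the converse
    algebra presents the dual of [thin U]. Its transpose is right multiplication by the arrow, from
    [P t] to [P s], whose cokernel is given by [arrow_presentation] again. *)
Lemma inverse_AR_translate_Uset (s t : 'I_n.+1) : arr (up sh) s t ->
  is_inverse_AR_translate (thin (@Uset_ok n sh s t) X) (thin (@Vset_ok n sh s t) X).
Proof.
move=> st; have sto : arr (up (op_shape sh)) t s by rewrite /= arr_negb.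
exists (thin (@Vset_ok n (op_shape sh) t s) (op_sys X)); split; first exact: thin_dual.
have [es [esK esE esM]] := proj_embedding X s.
have [et [etK etE etM]] := proj_embedding X t.
have [eos [eosK eosE eosM]] := proj_embedding (op_sys X) s.
have [eot [eotK eotE eotM]] := proj_embedding (op_sys X) t.
have [ds [c [dsE cs cE _ _]]] := arrow_presentation esK esM etK etM st.
have [d [e [dE e_s eE dk ek]]] := arrow_presentation eotK eotM eosK eosM sto.
exists (Po s), (Po t), d, e, (P t), (P s), (fun l x => (et l : A) * (eot x : A)),
  (fun l x => (es l : A) * (eos x : A)), ds, c; split=> //.
- by split=> //; split; apply: proj_projective.
- by split; apply: proj_hom_to_algebra.
move=> l x; rewrite dsE scalerA esM dE scalerA eotM.
have est : E s t * E s s = E s t by rewrite peM ?conn_refl // arr_conn.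
have ett : E t t * E s t = E s t by rewrite peM ?conn_refl // arr_conn.
transitivity ((et l : A) * E s t * (eos x : A)).
  by congr (_ * _); apply: etrans (esym (mulrA _ _ _)) _; rewrite est.
rewrite -[LHS]mulrA; congr (_ * _); rewrite -{1}ett -mulrA; reflexivity.
Qed.

End Translate.

(** * Minimal right determiners *)

Section VsetEnd.
Variables (n : nat) (sh : qshape n) (s t : 'I_n.+1).
Hypothesis st : arr (up sh) s t.
Implicit Types (j k v : 'I_n.+1).
Local Notation V := (Vset sh s t).

Definition Vend k : Prop := k \in V /\ forall v, arr (up sh) k v -> v \notin V.

Lemma Vend_conn k v : Vend k -> v \in V -> conn (up sh) k v -> v = k.
Proof.
case=> kV kend vV kv; apply/eqP/negPn/negP => nvk.
have [|w [kw wv _]] := conn_first kv; first by rewrite eq_sym.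
case/negP: (kend w kw); apply: (convex_between (@Vset_convex n sh s t) kV vV).
exact: conn_mid (arr_conn kw) wv.
Qed.

Lemma Vend_unique j k : Vend j -> Vend k -> j = k.
Proof.
move=> je ke; have := je.1; have := ke.1; rewrite !in_Vset => /andP[nk sk] /andP[nj sj].
case/orP: (side_total (arr_adjacent st) sj sk) => m.
  by have /andP[_ h] := conn_between m (nz_conn nk); rewrite (Vend_conn je ke.1 h).
by have /andP[_ h] := conn_between m (nz_conn nj); rewrite (Vend_conn ke je.1 h).
Qed.

Lemma Vend_exists : exists k, Vend k.
Proof.
case: (arg_maxnP (P := fun v => v \in V) (fun v => `|v - s|%N) (Vset_start sh s t)) => k kV kmax.
exists k; split=> // v kv; apply/negP => vV; have := kmax v vV.
move: kV vV; rewrite !in_Vset => /andP[nk sk] /andP[nv sv].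
have m := conn_mid (nz_conn nk) (arr_conn kv).
by have := arr_adjacent kv; rewrite /adj; move: m; clear; lia.
Qed.

End VsetEnd.

Section Determiners.
Variables (n : nat) (sh : qshape n) (K : fieldType) (A : algType K).
Variable X : algsys sh K A.
Hypothesis scE : forall c, sc X c = c%:A.
Local Notation VM s t := (thin (@Vset_ok n sh s t) X).
Local Notation UM s t := (thin (@Uset_ok n sh s t) X).
Local Notation arr := (arr (up sh)).
Local Notation conn := (conn (up sh)).
Local Notation nz := (nz sh).
Local Notation sc := (sc X).
Local Notation E := (pe X).
Local Notation P j := (thin (@Pset_ok n sh j) X).
Local Notation pbas j := (bas X (@Pset_ok n sh j) j).
Implicit Types (j k s t u v : 'I_n.+1) (M N Y C D : lmodType A).

Lemma determiner_single M N (f : {linear M -> N}) D :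
  (forall Y, determiner_summand f Y <-> isomorphic Y D) ->
  forall C, is_minimal_right_determiner f C <-> isomorphic C D.
Proof.
move=> fD C; split=> [[m [Y [Ydet Yinj Yall sumC]]]|CD].
  have YD i : isomorphic (Y i) D by apply/fD.
  have [i0 _] := Yall D ((fD D).2 (isomorphic_refl D)).
  have m1 : m = 1%N.
    have all0 i : i = i0.
      by apply: Yinj; apply: isomorphic_trans (YD i) (isomorphic_sym (YD i0)).
    have := card_ord m; rewrite (eq_card (_ : _ =i pred1 i0)) ?card1 // => i.
    by rewrite !inE (all0 i) eqxx.
  clear i0; subst m; move/direct_sum1: sumC => CY.
  exact: isomorphic_trans CY (YD _).
exists 1%N, (fun=> D); split=> [i|i j _|Y /fD YD|].
- by apply/fD; apply: isomorphic_refl.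
- by rewrite (ord1 i) (ord1 j).
- by exists ord0.
- exact/direct_sum1.
Qed.

Lemma radical_isomorphic M N (f : {linear M -> N}) x :
  bijective f -> radical x -> radical (f x).
Proof.
case/bijective_linear_inv => g fK gK rx S [[S0 SD] nS maxS].
apply: (rx (fun y => S (f y))); split.
- by split=> [|a y z Sy Sz]; rewrite ?linear0 // linearP; apply: SD.
- by move=> h; apply: nS => y; rewrite -(gK y).
move=> T [T0 TD] ST; have [||h|h] := maxS (fun y => T (g y)).
- by split=> [|a y z Ty Tz]; rewrite ?linear0 // linearP; apply: TD.
- by move=> y Sy; apply: ST; rewrite gK.
- by left=> y Ty; apply: h; rewrite fK.
- by right=> y; rewrite -(fK y).
Qed.

(** A projective [M] is a direct summand of a free module, which is a sum of modules [P j]. Some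
    composite from [thin S] through [P j] back is a non-zero scalar, so [thin S] is a retract of
    [P j], and the intervals agree by [comap_eq]. *)
Lemma projective_indecomposable M : finitely_generated M -> projective M ->
  indecomposable M -> exists j, isomorphic M (P j).
Proof.
move=> fgM pM indM.
have [S [okS [cS S0 [p pb]]]] := indecomposable_thin_iso X fgM indM.
have [p' pK p'K] := bijective_linear_inv pb.
have [m [g gP]] := fgM.
pose F : lmodType A := {ffun 'I_m -> A^o}.
have [q qE] : exists q : {linear F -> M}, forall y, q y = \sum_i (y i : A) *: g i.
  apply: (@linear_mapP A F M (fun y => \sum_i (y i : A) *: g i)) => a x y.
  rewrite scaler_sumr -big_split; apply: eq_bigr => i _.
  by rewrite !ffunE scalerDl scalerA.
have [idl idlE] := @linear_mapP A M M idfun (fun _ _ _ => erefl).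
have [|r rE] := pM _ _ q idl.
  move=> y; have [c ->] := gP y; exists [ffun i => c i : A^o].
  by rewrite qE; apply: eq_bigr => i _; rewrite ffunE.
have [v vS] := set0Pn _ S0.
(* The basis vector at [v] is a sum over generators [i] and trivial paths [j]; some term has a
   non-zero coordinate at [v]. *)
have [i [j ij]] : exists i j, co (p (((r (p' (bas X okS v)) i : A) * E j j) *: g i)) v != 0.
  apply: contrapT => h; have := oner_neq0 K.
  have <- : co (p (p' (bas X okS v))) v = 1 by rewrite p'K co_bas eqxx vS.
  set x := p' _ in h *; rewrite -[x]/(idfun x) -idlE rE qE linear_sum co_sum big1 ?eqxx // => i _.
  rewrite -[X in X *: g i](@mulr1 A) -(sum_pe X) mulr_sumr scaler_suml linear_sum co_sum big1 // => j _.
  by apply/eqP/negPn/negP => ij; apply: h; exists i, j.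
have [e [eK eE eM]] := proj_embedding X j.
have [al alE] : exists al : {linear thin okS X -> P j},
    forall y, al y = (r (p' y) i : A) *: pbas j.
  apply: (@linear_mapP A _ _ (fun y => (r (p' y) i : A) *: pbas j)) => a x y.
  by rewrite 2!linearP !ffunE scalerDl scalerA.
have [b bE] := proj_hom (E j j *: g i) e.
have [be beE] := comp_linear p b.
have [h hE] := comp_linear be al.
have [c [cE _]] := thin_hom h cS cS.
have c0 : c != 0.
  apply: contraNneq ij => c0; have := cE (bas X okS v) v.
  rewrite c0 mul0r if_same hE beE bE alE eM scalerA -mulrA.
  have -> : E j j * E j j = E j j by rewrite peM ?conn_refl.
  by move->.
have [be' be'E] : exists be' : {linear P j -> thin okS X}, forall y, be' y = sc c^-1 *: be y.
  by apply: (@linear_mapP A _ _ (fun y => sc c^-1 *: be y)) => a x y; rewrite linearP scalerDr scS.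
have [|SP SPc PSc] := thin_iso_sub (okS := okS) (okT := @Pset_ok n sh j) (X := X) cS (@Pset_convex n sh j) S0.
  exists al, be' => x; apply: thin_ext => w wS.
  by rewrite be'E co_sc -hE cE wS mulrA mulVf // mul1r.
exists j; apply: isomorphic_trans (ex_intro _ p pb) _.
by apply: thin_eq_iso; apply: comap_eq SPc PSc => //; apply: Pset_convex.
Qed.

Lemma proj_indecomposable j : indecomposable (P j).
Proof.
by apply: thin_indecomposable; [apply: Pset_convex | apply/set0Pn; exists j; apply: Pset_start].
Qed.

Lemma Vthin_indecomposable s t : indecomposable (VM s t).
Proof.
by apply: thin_indecomposable; [apply: Vset_convex | apply/set0Pn; exists s; apply: Vset_start].
Qed.

Lemma Uthin_indecomposable s t : indecomposable (UM s t).
Proof.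
apply: thin_indecomposable; first exact: Uset_convex.
by apply/set0Pn; exists t; apply: (Vset_start (op_shape sh)).
Qed.

Section Morphism.
Variables (M N : lmodType A) (f : {linear M -> N}) (S T : {set 'I_n.+1}).
Variables (okS : ok sh S) (okT : ok sh T).
Variables (p : {linear M -> thin okS X}) (q : {linear N -> thin okT X}) (c : K).
Hypotheses (pb : bijective p) (qb : bijective q) (c0 : c != 0).
Hypothesis fE : forall x v, co (q (f x)) v = if v \in T then c * co (p x) v else 0.
Hypotheses (cS : convex S) (cT : convex T) (S0 : S != set0) (T0 : T != set0).
Hypothesis ST : comap sh S T.

Let indM : indecomposable M.
Proof.
apply: indecomposable_isomorphic (thin_indecomposable X okS cS S0).
by apply: isomorphic_sym; exists p.
Qed.

(** As [M] is indecomposable, one of [B1] and [B2] is zero, and it is not [B2] because [f] is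
    non-zero. *)
Lemma intrinsic_kernel_iso Ker Y (k : {linear Y -> M}) : (exists x, f x != 0) ->
  is_kernel k f -> intrinsic_kernel f Ker -> isomorphic Ker Y.
Proof.
move=> [x fx] kk [B1 [B2 [phi [f2 [k2 [phib f1E f2E _ [k2i k2P]]]]]]].
have [psi phiK psiK] := bijective_linear_inv phib.
have fphi b : f (phi b) = f2 b.2.
  have -> : b = (b.1, 0) + (0, b.2) by case: b => b1 b2; congr pair; rewrite ?addr0 ?add0r.
  by rewrite linearD linearD f1E add0r f2E /= add0r.
have [_ /(_ B1 B2)] := indM; case=> [|z1|z2].
- by exists psi; exists phi.
- have [k' k'E] : exists k' : {linear Ker -> M}, forall y, k' y = phi (0, k2 y).
    apply: (@linear_mapP A _ _ (fun y => phi (0, k2 y))) => a y z.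
    rewrite -(linearP phi) linearP; congr (phi _).
    by apply: injective_projections; rewrite /= ?scaler0 ?addr0.
  apply: (kernel_isomorphic (k := k') _ kk); split.
    move=> y z; rewrite !k'E => /(can_inj phiK) /(congr1 snd) /=.
    exact: k2i.
  move=> y; split=> [fy|[z <-]].
    have /k2P[z zE] : f2 (psi y).2 = 0 by rewrite -fphi psiK.
    exists z; rewrite k'E zE -[RHS]psiK; congr (phi _).
    by rewrite [RHS]surjective_pairing (z1 (psi y).1).
  by rewrite k'E fphi /=; apply/k2P; exists z.
- case/eqP: fx; rewrite -(psiK x) fphi (z2 (psi x).2); exact: linear0.
Qed.

Lemma nonzero_morphism v : v \in S -> v \in T -> exists x, f x != 0.
Proof.
move=> vS vT; have [p' pK p'K] := bijective_linear_inv pb.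
exists (p' (bas X okS v)); apply: contraNneq c0 => e.
have := fE (p' (bas X okS v)) v; rewrite e linear0 co0 vT p'K co_bas eqxx vS mulr1.
by move=> <-.
Qed.

Section Epimorphism.
Variables (s t : 'I_n.+1).
Hypothesis st : arr s t.
Hypothesis TS : T \subset S.
Hypothesis diff : S :\: T = Uset sh s t.

Lemma epi_surjective : surjective_map f.
Proof.
move=> y; have [p' pK p'K] := bijective_linear_inv pb.
exists (p' (thin_mk X okS (fun v => c^-1 * co (q y) v))); apply: (bij_inj qb).
apply: thin_ext => v vT; rewrite fE vT p'K co_mk (subsetP TS) //.
by rewrite mulrA mulfV // mul1r.
Qed.

Lemma epi_kernel : exists k : {linear UM s t -> M}, is_kernel k f.
Proof.
have [p' pK p'K] := bijective_linear_inv pb.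
have inU v : (v \in Uset sh s t) = (v \notin T) && (v \in S) by rewrite -diff inE.
have US : comap sh (Uset sh s t) S.
  move=> u v; rewrite !inU => /andP[nuT uS] vS uv; rewrite vS uS andbT.
  by apply/negP => vT; have := ST uS vT uv; rewrite vS (negPf nuT).
have [i iE] := nat_map X (@Uset_ok n sh s t) okS US.
have [k kE] := comp_linear p' i; exists k; split.
  move=> x y; rewrite !kE => /(can_inj p'K) e; apply: thin_ext => v vU.
  have vS : v \in S by move: vU; rewrite inU => /andP[].
  by have := congr1 (fun z => co z v) e; rewrite !iE vS.
move=> x; split=> [fx|[y <-]].
  exists (thin_mk X (@Uset_ok n sh s t) (fun v => co (p x) v)).
  rewrite kE -[RHS]pK; congr (p' _); apply: thin_ext => v vS.
  rewrite iE vS co_mk inU vS andbT; case: ifP => // /negbFE vT.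
  have := fE x v; rewrite fx linear0 co0 vT => /esym/eqP.
  by rewrite mulf_eq0 (negPf c0) => /eqP.
apply: (bij_inj qb); apply: thin_ext => v vT.
rewrite fE vT kE p'K iE linear0 co0 (subsetP TS) //.
by rewrite co_out ?mulr0 // inU vT.
Qed.

(** The first summand can be taken zero: an endomorphism of [M] is a scalar, and one that preserves
    the non-zero [f] is the identity. *)
Lemma epi_intrinsic_kernel : intrinsic_kernel f (UM s t).
Proof.
have [k kk] := epi_kernel.
have ok0 : ok sh set0 by apply: ok_set0.
have z0 (y : thin ok0 X) : y = 0 by apply: thin_ext => v; rewrite inE.
have [phi phiE] : exists phi : {linear (thin ok0 X * M)%type -> M}, forall b, phi b = b.2.
  by apply: (@linear_mapP A _ _ (fun b => b.2)).
exists (thin ok0 X), M, phi, f, k; split=> //.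
- exists (fun m => (0, m)) => [b|m]; last by rewrite phiE.
  by rewrite phiE [RHS]surjective_pairing (z0 b.1).
- by move=> b; rewrite phiE linear0.
- by move=> b; rewrite phiE.
move=> g fg; have [p' pK p'K] := bijective_linear_inv pb.
have [pg pgE] := comp_linear p g; have [h hE] := comp_linear pg p'.
have [d [dE _]] := thin_hom h cS cS.
have [v vT] := set0Pn _ T0; have vS := subsetP TS _ vT.
have d1 : d = 1.
  have := fE (g (p' (bas X okS v))) v; rewrite fg fE vT p'K -pgE -hE dE vS.
  by rewrite co_bas eqxx vS => /(mulfI c0); rewrite mulr1 => <-.
have gid x : g x = x.
  apply: (bij_inj pb); apply: thin_ext => w wS.
  by have := dE (p x) w; rewrite hE pK pgE wS d1 mul1r.
by exists idfun => x; rewrite ?gid.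
Qed.

Lemma epi_determiner C :
  is_minimal_right_determiner f C <-> isomorphic C (VM s t).
Proof.
have fne : exists x, f x != 0.
  by have [v vT] := set0Pn _ T0; apply: nonzero_morphism (subsetP TS _ vT) vT.
have tr := inverse_AR_translate_Uset scE st.
apply: determiner_single => Y; split.
  case=> indY [[Z [Ker [ik indZ ZKer ZY]]]|[_ _ [? [? [? [h [_ _ _ nh]]]]]]].
  - have [k kk] := epi_kernel.
    have KU := intrinsic_kernel_iso fne kk ik.
    apply: inverse_AR_translate_unique ZY tr _.
    apply: (isomorphic_trans _ KU); apply: summand_indecomposable => //.
    exact: indecomposable_isomorphic (isomorphic_sym KU) (Uthin_indecomposable s t).
  - by case: nh => x; have [m mE] := epi_surjective (h x); exists m.
move=> YV; split; first exact: indecomposable_isomorphic (isomorphic_sym YV) (Vthin_indecomposable s t).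
left; exists (UM s t), (UM s t); split.
- exact: epi_intrinsic_kernel.
- exact: Uthin_indecomposable.
- exists (thin (@ok_set0 n sh) X); apply/isomorphic_sym/isomorphic_prod0/thin_zero.
  by [].
- exact: inverse_AR_translate_isomorphic tr (isomorphic_sym YV).
Qed.

End Epimorphism.
Section Monomorphism.
Variables (s t k : 'I_n.+1).
Hypothesis st : arr s t.
Hypothesis SsT : S \subset T.
Hypothesis diff : T :\: S = Vset sh s t.
Hypothesis kV : Vend sh s t k.

Lemma mono_injective : injective f.
Proof.
move=> x y fxy; apply: (bij_inj pb); apply: thin_ext => v vS.
have := congr1 (fun z => co (q z) v) fxy; rewrite !fE (subsetP SsT) //.
exact: mulfI.
Qed.

Lemma mono_image y : (exists x, f x = y) <-> (forall v, v \in Vset sh s t -> co (q y) v = 0).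
Proof.
split=> [[x <-] v|h].
  rewrite -diff inE fE => /andP[vS vT]; rewrite vT co_out ?mulr0 //.
have [p' pK p'K] := bijective_linear_inv pb.
exists (p' (thin_mk X okS (fun v => c^-1 * co (q y) v))); apply: (bij_inj qb).
apply: thin_ext => v vT; rewrite fE vT p'K co_mk.
have [vS|vS] := boolP (v \in S); first by rewrite mulrA mulfV // mul1r.
by rewrite mulr0 h // -diff inE vS.
Qed.

Lemma Vset_sub v : v \in Vset sh s t -> v \in T.
Proof. by rewrite -diff inE => /andP[]. Qed.

(** The generator goes to the basis vector at [k], outside the image of [f]. All other vertices of
    [P k] lie outside [V], as [k] is its last vertex, so the radical lands in the image and
    lifts. *)
Lemma mono_almost_factors : almost_factors (P k) f.
Proof.
have [q' qK q'K] := bijective_linear_inv qb.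
have [e [eK _ eM]] := proj_embedding X k.
have kT := Vset_sub kV.1.
have [g gE] := proj_hom (bas X okT k) e.
have gk : g (pbas k) = bas X okT k.
  by rewrite gE -[pbas k]scale1r eM mul1r idem_bas.
have gco := proj_thin_hom eK cT kT gk.
have [h hE] := comp_linear q' g.
pose D := Pset sh k :\ k.
have DP : D \subset Pset sh k by apply: subD1set.
have okD : ok sh D by apply: ok_sub DP _; apply: Pset_ok.
have DPc : comap sh D (Pset sh k).
  move=> u v uD vP uv; rewrite inE vP (subsetP DP u uD) andbT !inE; apply/eqP => vk.
  move: uD uv; rewrite vk !inE => /andP[uk ku] uk'; case/eqP: uk.
  by apply: val_inj; apply: conn_anti (arr_conn uk') (nz_conn ku).
have [i iE] := nat_map X okD (@Pset_ok n sh k) DPc.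
have ii : injective i.
  move=> x y e1; apply: thin_ext => v vD; have := congr1 (fun z => co z v) e1.
  by rewrite !iE (subsetP DP).
have [hi hiE] := comp_linear h i.
have [|u uE] := @lift_injective A _ _ _ f hi mono_injective.
  move=> y; apply/mono_image => v vV; rewrite hiE hE q'K gco Vset_sub // iE.
  case: ifP => // vP; rewrite co_out // !inE; case: (v =P k) => //= nvk.
  apply/negP => kv; case: nvk; apply: (Vend_conn kV vV).
  exact: nz_conn.
exists (thin okD X), i, u, h; split=> //.
- move=> x; split=> [/proj_radical xk|[y <-]].
    exists (thin_mk X okD (fun v => co x v)); apply: thin_ext => v vP.
    rewrite iE vP co_mk !inE; case: (v =P k) => [->|] //=.
    by rewrite -in_Pset vP.
  by apply/proj_radical; rewrite iE co_out ?if_same // !inE eqxx.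
- by move=> y; rewrite uE hiE.
- move=> /(_ (pbas k))[m mE].
  have /mono_image/(_ _ kV.1) : exists x, f x = h (pbas k) by exists m.
  rewrite hE q'K gk co_bas eqxx kT => /eqP; by rewrite oner_eq0.
Qed.

(** The kernel is zero, so only projectives count, and [projective_indecomposable] reduces these to
    the modules [P j]. *)
Lemma mono_determiner C :
  is_minimal_right_determiner f C <-> isomorphic C (P k).
Proof.
apply: determiner_single => Y; split=> [[indY [[Z [Ker [ik indZ ZKer ZY]]]|[fgY pY afY]]]|YP].
- case: ik => [B1 [B2 [phi [f2 [k2 [phib f1E f2E _ [k2i k2P]]]]]]].
  case: indZ => nzZ _; case: nzZ => z; case: ZKer => W [i [i' iK i'K]].
  have k0 (y : Ker) : y = 0.
    apply: k2i; rewrite linear0.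
    have : f2 (k2 y) = 0 by apply/k2P; exists y.
    rewrite f2E -[RHS](linear0 f) => /mono_injective.
    by rewrite -[RHS](linear0 phi) => /(bij_inj phib) [].
  have : (z, 0) = 0 :> (Z * W)%type by rewrite -(i'K (z, 0)) (k0 (i' _)) linear0.
  by move/(congr1 fst).
- have [j YP] := projective_indecomposable fgY pY indY.
  suff <- : j = k by [].
  have [phi phib] := isomorphic_sym YP.
  case: afY => [radP [i [u [h [ii iP hu nh]]]]].
  have [e [eK _ eM]] := proj_embedding X j.
  have [h1 h1E] := comp_linear h phi; have [g gE] := comp_linear q h1.
  have img x : co x j = 0 -> exists m, f m = h1 x.
    move=> /proj_radical /(radical_isomorphic phib) /iP [y yE].
    by exists (u y); rewrite -hu yE h1E.
  have nimg : ~ exists m, f m = h1 (pbas j).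
    case=> m mE; apply: nh => y; have [psi phiK psiK] := bijective_linear_inv phib.
    exists (e (psi y) *: m); rewrite linearZ mE -linearZ eK h1E psiK.
    by [].
  pose d := co (g (pbas j)) j.
  have gj : g (pbas j) = sc d *: bas X okT j.
    apply: thin_ext => v vT; rewrite -[pbas j](idem_bas X) linearZ_LR co_idem co_sc co_bas.
    case: (v =P j) => [vj|_]; last by rewrite mulr0.
    by move: vT; rewrite vj => ->; rewrite mulr1.
  (* The image of the generator is a multiple of the basis vector at [j], so [j] is in [V]. If an
     arrow from [j] stayed in [V], its image would be the image of a radical element and yet lie
     outside the image of [f]. *)
  have [v vV dv] : exists2 v, v \in Vset sh s t & co (g (pbas j)) v != 0.
    apply: contrapT => nv; apply: nimg; apply/mono_image => v vV; rewrite -gE.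
    by apply/eqP/negPn/negP => dv; apply: nv; exists v.
  have vj : v = j.
    by apply/eqP; apply: contraNT dv => nvj; rewrite gj co_sc co_bas (negPf nvj) mulr0.
  rewrite vj in vV dv; have jT := Vset_sub vV.
  apply: (Vend_unique st) kV; split=> // w jw; apply/negP => wV.
  have wP : w \in Pset sh j by rewrite in_Pset nz_arr.
  have njw : j != w by apply/eqP => ejw; case: (adj_neq (arr_adjacent jw)); rewrite ejw.
  have /img/mono_image/(_ _ wV) : co (bas X (@Pset_ok n sh j) w) j = 0.
    by rewrite co_bas (negPf njw).
  rewrite -gE -pe_pbas // linearZ_LR gj -scS arr_bas // Vset_sub // co_sc co_bas eqxx Vset_sub //.
  by rewrite mulr1 => /eqP; rewrite (negPf dv).
split; first exact: indecomposable_isomorphic (isomorphic_sym YP) (proj_indecomposable k).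
right; split.
- exact: finitely_generated_isomorphic (isomorphic_sym YP) (thin_finitely_generated X _).
- exact: (projective_isomorphic (isomorphic_sym YP) (@proj_projective _ _ _ _ X k)).
have [phi phib] := YP; have [psi phiK psiK] := bijective_linear_inv phib.
have [radP [i [u [h [ii iP hu nh]]]]] := mono_almost_factors.
have [i' i'E] := comp_linear psi i; have [h' h'E] := comp_linear h phi.
exists radP, i', u, h'; split.
- by move=> x y; rewrite !i'E => /(can_inj psiK)/ii.
- move=> x; split=> [/(radical_isomorphic phib)/iP[y yE]|[y <-]].
    by exists y; rewrite i'E yE phiK.
  rewrite i'E; apply: radical_isomorphic; first by exists phi.
  by apply/iP; exists y.
- by move=> y; rewrite h'E i'E psiK.
- by move=> img; apply: nh => x; have [m mE] := img (psi x); exists m; rewrite -mE h'E psiK.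
Qed.

End Monomorphism.
End Morphism.
End Determiners.

(** * The list of all determiners *)

Section Determined.
Variables (n : nat) (sh : qshape n) (K : fieldType) (A : algType K).
Variable X : algsys sh K A.
Hypothesis scE : forall c, sc X c = c%:A.
Local Notation VM s t := (thin (@Vset_ok n sh s t) X).
Local Notation UM s t := (thin (@Uset_ok n sh s t) X).
Local Notation arr := (arr (up sh)).
Implicit Types (k s t : 'I_n.+1).

Definition path_end k : Prop := exists s t, arr s t /\ Vend sh s t k.

(** Conversely, each arrow is realized by its epimorphism from [thin Nset] to [thin Vset], and each
    last vertex by the monomorphism from [thin Uset] to [thin Nset]. *)
Lemma in_Det_thin (C : lmodType A) : in_Det C <->
  (exists s t, arr s t /\ isomorphic C (VM s t)) \/
  (exists k, path_end k /\ isomorphic C (thin (@Pset_ok n sh k) X)).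
Proof.
split.
  case=> M [N [f [[fgM fgN] [indM indN] irrf]]] detC.
  have [S [okS [cS S0 MS]]] := indecomposable_thin_iso X fgM indM.
  have [T [okT [cT T0 NT]]] := indecomposable_thin_iso X fgN indN.
  have [p [q [c [pb qb c0 fE [ST ST0 nST max]]]]] := irreducible_thin irrf cS cT S0 T0 MS NT.
  have [[sub [s [t [st _ _ diff]]]]|[sub [s [t [st _ _ diff]]]]] :=
    irreducible_pair cS cT okS okT ST0 nST ST max.
    have [k ke] := Vend_exists sh s t.
    right; exists k; split; first by exists s, t.
    exact/(mono_determiner pb qb c0 fE cT st sub diff ke).
  left; exists s, t; split=> //.
  exact/(epi_determiner scE pb qb c0 fE cS S0 T0 ST st sub diff).
have Vc s t : convex (Vset sh s t) by apply: Vset_convex.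
have Uc s t : convex (Uset sh s t) by apply: Uset_convex.
have V0 s t : Vset sh s t != set0 by apply/set0Pn; exists s; apply: Vset_start.
have U0 s t : Uset sh s t != set0.
  by apply/set0Pn; exists t; apply: (Vset_start (op_shape sh)).
case=> [[s [t [st CV]]]|[k [[s [t [st ke]]] CP]]].
  have Nc := Nset_convex st.
  have N0 : Nset sh s t != set0 by apply/set0Pn; exists s; rewrite in_Nset Vset_start orbT.
  have [f fE] := nat_map X (Nset_ok st) (@Vset_ok n sh s t) (comap_Nset_Vset st).
  have irrf := irreducible_Nset_Vset fE.
  have [p [q [c [pb qb c0 fE' [ST _ _ _]]]]] := irreducible_thin irrf Nc (Vc s t) N0 (V0 s t)
    (isomorphic_refl _) (isomorphic_refl _).
  exists (thin (Nset_ok st) X), (VM s t), f; split=> //.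
  - by split; apply: thin_finitely_generated.
  - by split; apply: thin_indecomposable.
  have sub : Vset sh s t \subset Nset sh s t by apply: subsetUr.
  have diff : Nset sh s t :\: Vset sh s t = Uset sh s t.
    apply/setP => v; rewrite in_setD in_Nset.
    by have [vV|vV] := boolP (v \in Vset sh s t); rewrite ?orbF ?(Vset_notU st vV).
  exact/(epi_determiner scE pb qb c0 fE' Nc N0 (V0 s t) ST st sub diff).
have Nc := Nset_convex st.
have N0 : Nset sh s t != set0 by apply/set0Pn; exists s; rewrite in_Nset Vset_start orbT.
have [f fE] := nat_map X (@Uset_ok n sh s t) (Nset_ok st) (comap_Uset_Nset st).
have irrf := irreducible_Uset_Nset fE.
have [p [q [c [pb qb c0 fE' _]]]] := irreducible_thin irrf (Uc s t) Nc (U0 s t) N0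
  (isomorphic_refl _) (isomorphic_refl _).
exists (UM s t), (thin (Nset_ok st) X), f; split=> //.
- by split; apply: thin_finitely_generated.
- by split; apply: thin_indecomposable.
have sub : Uset sh s t \subset Nset sh s t by apply: subsetUl.
have diff : Nset sh s t :\: Uset sh s t = Vset sh s t.
  apply/setP => v; rewrite in_setD in_Nset.
  by have [vU|vU] := boolP (v \in Uset sh s t); rewrite ?(Uset_notV st vU).
exact/(mono_determiner pb qb c0 fE' Nc st sub diff ke).
Qed.

End Determined.

(** * The list has no repetitions, and its length *)

Section SetInjectivity.
Variables (n : nat) (sh : qshape n).
Local Notation arr := (arr (up sh)).
Implicit Types (j k s t : 'I_n.+1).

Lemma nz_anti j k : nz sh j k -> nz sh k j -> j = k.
Proof. by move=> jk kj; apply: val_inj; apply: conn_anti (nz_conn jk) (nz_conn kj). Qed.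

Lemma Pset_inj j k : Pset sh j = Pset sh k -> j = k.
Proof.
move=> e; apply: nz_anti; rewrite -in_Pset; first by rewrite e Pset_start.
by rewrite -e Pset_start.
Qed.

Lemma Vset_nz s t v : v \in Vset sh s t -> nz sh s v.
Proof. by rewrite in_Vset => /andP[]. Qed.

(** Both sets would start at [s], but only the second contains the neighbour [t]. *)
Lemma Vset_notP s t k : arr s t -> Vset sh s t <> Pset sh k.
Proof.
move=> st e; have sk : s = k.
  apply: nz_anti; first by apply: (@Vset_nz _ t); rewrite e Pset_start.
  by rewrite -in_Pset -e Vset_start.
have : t \in Vset sh s t by rewrite e -sk in_Pset nz_arr.
by rewrite in_Vset side_other ?andbF //; apply: adjC; apply: arr_adjacent st.
Qed.

Lemma Vset_inj s t s' t' : arr s t -> arr s' t' ->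
  Vset sh s t = Vset sh s' t' -> s = s' /\ t = t'.
Proof.
move=> st st' e; have ss : s = s'.
  apply: nz_anti; first by apply: (@Vset_nz _ t); rewrite e Vset_start.
  by apply: (@Vset_nz _ t'); rewrite -e Vset_start.
split=> //; move: st' e; rewrite -ss => st' e.
apply/eqP/negPn/negP => ntt.
have : t' \in Vset sh s t.
  rewrite in_Vset nz_arr //=; apply: side_opposite (arr_adjacent st) (arr_adjacent st') _.
  by apply/eqP; rewrite eq_sym.
by rewrite e in_Vset side_other ?andbF //; apply: adjC; apply: arr_adjacent st'.
Qed.

Lemma num_arrows : #|[pred p : 'I_n.+1 * 'I_n.+1 | arr p.1 p.2]| = n.
Proof.
have lt (k : 'I_n) : (k < n.+1)%N by apply: ltnW; rewrite ltnS.
have ltS (k : 'I_n) : (k.+1 < n.+1)%N by rewrite ltnS.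
pose a (k : 'I_n) := if up sh k then (Ordinal (lt k), Ordinal (ltS k))
  else (Ordinal (ltS k), Ordinal (lt k)).
have a_inj : injective a.
  move=> k l; rewrite /a; case: ifP => _; case: ifP => _ [] e1 e2; apply: val_inj;
    by move: e1 e2; rewrite /=; clear; lia.
rewrite -[RHS]card_ord -(card_codom a_inj); apply: eq_card => -[u v].
apply/idP/imageP => /= [uv|[k _ [e]]]; last first.
  by move: e; rewrite /a inE /=; case: ifP => uk [-> ->]; rewrite /arr /= uk eqxx ?orbT.
move: uv; rewrite inE /= => /orP[/andP[/eqP e f]|/andP[/eqP e f]].
  have h : (u < n)%N by have := ltn_ord v; rewrite e.
  by exists (Ordinal h) => //; rewrite /a /= f; congr pair; apply: val_inj.
have h : (v < n)%N by have := ltn_ord u; rewrite e.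
by exists (Ordinal h) => //; rewrite /a /= (negPf f); congr pair; apply: val_inj.
Qed.

End SetInjectivity.

Lemma num_iso_classes_fin (R : nzRingType) (Pm : lmodType R -> Prop) (J : finType)
    (D : J -> lmodType R) :
  (forall j, Pm (D j)) -> (forall i j, isomorphic (D i) (D j) -> i = j) ->
  (forall M, Pm M -> exists j, isomorphic M (D j)) -> num_iso_classes Pm #|J|.
Proof.
move=> h1 h2 h3; exists (fun i => D (enum_val i)); split=> //.
- by move=> i j /h2/enum_val_inj.
- by move=> M /h3[j Mj]; exists (enum_rank j); rewrite enum_rankK.
Qed.

Section DeterminedCount.
Variables (n : nat) (sh : qshape n) (K : fieldType) (A : algType K).
Variable X : algsys sh K A.
Hypothesis scE : forall c, sc X c = c%:A.
Local Notation VM s t := (thin (@Vset_ok n sh s t) X).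
Local Notation UM s t := (thin (@Uset_ok n sh s t) X).

Lemma num_determined :
  num_iso_classes (@in_Det K A) (n + #|[pred k | `[< path_end sh k >]]|).
Proof.
pose J1 := {p : 'I_n.+1 * 'I_n.+1 | arr (up sh) p.1 p.2}.
pose J2 := {k : 'I_n.+1 | `[< path_end sh k >]}.
pose D (j : J1 + J2) : lmodType A := match j with
  | inl p => VM (val p).1 (val p).2
  | inr k => thin (@Pset_ok n sh (val k)) X end.
have -> : (n + #|[pred k | `[< path_end sh k >]]| = #|{: J1 + J2}|)%N.
  by rewrite card_sum !card_sig num_arrows.
have V0 s t : Vset sh s t != set0 by apply/set0Pn; exists s; apply: Vset_start.
have P0 k : Pset sh k != set0 by apply/set0Pn; exists k; apply: Pset_start.
have Vc s t : convex (Vset sh s t) by apply: Vset_convex.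
have Pc k : convex (Pset sh k) by apply: Pset_convex.
apply: (num_iso_classes_fin (D := D)).
- case=> [[[s t] /= st]|[k /= /asboolP ke]]; apply/(in_Det_thin scE).
    by left; exists s, t; split=> //; apply: isomorphic_refl.
  by right; exists k; split=> //; apply: isomorphic_refl.
- case=> [[[s t] /= st]|[k /= ke]] [[[s' t'] /= st']|[k' /= ke']] /thin_iso_eq.
  + move=> /(_ (Vc _ _) (Vc _ _) (V0 _ _)) /(Vset_inj st st')[e1 e2].
    by congr inl; apply: val_inj; rewrite /= e1 e2.
  + by move=> /(_ (Vc _ _) (Pc _) (V0 _ _)) /(Vset_notP st).
  + by move=> /(_ (Pc _) (Vc _ _) (P0 _)) /esym /(Vset_notP st').
  + move=> /(_ (Pc _) (Pc _) (P0 _)) /Pset_inj e.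
    by congr inr; apply: val_inj.
- move=> M /(in_Det_thin scE)[[s [t [st Mst]]]|[k [ke Mk]]].
    by exists (inl (exist _ (s, t) st)).
  by exists (inr (exist _ k (introT (asboolP _) ke))).
Qed.

End DeterminedCount.

(** * Bound quiver algebras *)

Section QuiverPaths.
Variables (n : nat) (Q : quiverA n).
Implicit Types (u v w x y : 'I_n.+1) (p q r : qpath Q).

Definition orient (k : nat) : bool := Q (inord k) (inord k.+1).

Lemma arr_orient u v : arr orient u v = Q u v.
Proof.
have key (i j : 'I_n.+1) : j = i.+1 :> nat -> orient i = Q i j.
  move=> e; have lt : (i.+1 < n.+1)%N by rewrite -e.
  rewrite /orient inord_val (_ : inord i.+1 = j) //.
  by apply: val_inj; rewrite /= inordK.
have sym (i j : 'I_n.+1) : j = i.+1 :> nat -> Q j i = ~~ Q i j.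
  move=> e; have := arrow_graph Q i j; rewrite e eqxx /=.
  have [h|h] := boolP (Q i j); first by rewrite (negPf (arrow_simple h)).
  by [].
rewrite /arr; case: (v =P u.+1 :> nat) => [e|ne] /=.
  rewrite (key u v e) e; case: eqP => [e'|_]; last by rewrite orbF.
  by move: e'; clear; lia.
case: (u =P v.+1 :> nat) => [e|ne'] /=; first by rewrite (key v u e) (sym v u e).
case uv: (Q u v) => //; have := arrow_graph Q u v.
rewrite uv /=. move=> /esym/orP[/eqP/ne[]|/eqP/ne'[]].
Qed.

Lemma path_conn x s y : path Q x s -> y \in x :: s ->
  conn orient x y /\ conn orient y (last x s).
Proof.
elim: s x y => [|z s IH] x y /=; first by rewrite inE => _ /eqP->; split; apply: conn_refl.
case/andP=> xz zs; rewrite inE => ys.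
have xz' : conn orient x z by apply: arr_conn; rewrite arr_orient.
case/predU1P: ys => [->|/(IH z y zs)[zy yl]].
  split; first exact: conn_refl.
  exact: conn_trans xz' (IH z z zs (mem_head _ _)).2.
by split=> //; apply: conn_trans xz' zy.
Qed.

Lemma qpath_conn p : conn orient (psrc p) (ptgt p).
Proof. exact: (path_conn (qpathP p) (mem_head _ _)).2. Qed.

Lemma conn_path x y : conn orient x y -> exists2 s, path Q x s & last x s = y.
Proof.
have [k] := ubnP `|x - y|%N; elim: k x => // k IH x lk xy.
have [->|nxy] := eqVneq x y; first by exists [::].
have [w [xw wy lw]] := conn_first xy nxy.
have [|s ws sy] := IH w _ wy; first by move: lw lk; clear; lia.
by exists (w :: s); rewrite //= -arr_orient xw.
Qed.

Lemma path_unique x s s' : path Q x s -> path Q x s' -> last x s = last x s' -> s = s'.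
Proof.
have loop z y t : path Q z (y :: t) -> last y t <> z.
  move=> /= /andP[zy yt] e.
  have zy' : arr orient z y by rewrite arr_orient.
  have [_ yz] := path_conn yt (mem_head _ _); rewrite e in yz.
  by case: (adj_neq (arr_adjacent zy')); apply: conn_anti (arr_conn zy') yz.
elim: s x s' => [|y s IH] x [|y' s'] //.
- by move=> _ h /= /esym/(loop _ _ _ h).
- by move=> h _ /= /(loop _ _ _ h).
move=> /= /andP[xy ys] /andP[xy' ys'] e.
have a : arr orient x y by rewrite arr_orient.
have a' : arr orient x y' by rewrite arr_orient.
have [_ c] := path_conn ys (mem_head _ _); have [_ c'] := path_conn ys' (mem_head _ _).
have m := conn_mid (arr_conn a) c; have m' := conn_mid (arr_conn a') c'.
have yy : y = y'.
  apply: val_inj; move: (arr_adjacent a) (arr_adjacent a') m m'; rewrite e /adj /=.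
  by clear; lia.
by rewrite yy in ys e *; rewrite (IH y' s').
Qed.

(** Because the graph is a line, paths may be replaced by pairs of vertices from here on. *)
Lemma qpath_unique p q : psrc p = psrc q -> ptgt p = ptgt q -> p = q.
Proof.
move=> e e'; apply: qpath_inj => //; apply: (@path_unique (psrc p)).
- exact: qpathP.
- by rewrite e; apply: qpathP.
- by rewrite -/(ptgt p) e' e.
Qed.

Lemma conn_qpath u v : conn orient u v -> exists p, psrc p = u /\ ptgt p = v.
Proof.
by case/conn_path => s us e; have [p p1 p2] := qpath_ex us; exists p; rewrite /ptgt p1 p2.
Qed.

Lemma is_compE q r p : is_comp q r p =
  [&& psrc p == psrc r, ptgt p == ptgt q & ptgt r == psrc q].
Proof.
apply/and3P/and3P => -[/eqP e1 /eqP e2 /eqP e3]; split; apply/eqP => //.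
  by rewrite /ptgt e3 last_cat e1 -/(ptgt r) e2.
have rs : path Q (psrc r) (ptail r ++ ptail q).
  by rewrite cat_path qpathP -/(ptgt r) e3 qpathP.
have [s s1 s2] := qpath_ex rs; have -> : p = s.
  apply: qpath_unique; first by rewrite s1.
  by rewrite e2 /ptgt s1 s2 last_cat -/(ptgt r) e3.
by rewrite s2.
Qed.

Variable K : fieldType.
Local Notation KQ := (pathalg K Q).
Implicit Types (f g : KQ).

(* The path from u to v, or 0 when there is none.                             *)
Definition pathE u v : KQ := [ffun p => ((psrc p == u) && (ptgt p == v))%:R].

(** The sum has at most one term; it gives the coefficient of the path from [u] to [v], and 0 if
    there is none. *)
Definition pcoef u v f : K := \sum_(p | (psrc p == u) && (ptgt p == v)) f p.

Lemma pcoef_path_eq f p : pcoef (psrc p) (ptgt p) f = f p.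
Proof.
rewrite /pcoef (bigD1 p) ?eqxx //= big1 ?addr0 // => q /andP[/andP[/eqP e1 /eqP e2]].
by rewrite (qpath_unique e1 e2) eqxx.
Qed.

Lemma pcoef_out u v f : ~~ conn orient u v -> pcoef u v f = 0.
Proof.
move=> h; rewrite /pcoef big1 // => p /andP[/eqP e1 /eqP e2]; case/negP: h.
by rewrite -e1 -e2 qpath_conn.
Qed.

Lemma pcoef_inj f g : (forall u v, pcoef u v f = pcoef u v g) -> f = g.
Proof. by move=> h; apply/ffunP => p; rewrite -!pcoef_path_eq h. Qed.

Lemma pcoefZ u v f c : pcoef u v (c *: f) = c * pcoef u v f.
Proof. by rewrite /pcoef mulr_sumr; apply: eq_bigr => p _; rewrite ffunE. Qed.

Lemma pcoefD u v f g : pcoef u v (f + g) = pcoef u v f + pcoef u v g.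
Proof. by rewrite /pcoef -big_split; apply: eq_bigr => p _; rewrite ffunE. Qed.

Lemma pcoef0 u v : pcoef u v 0 = 0.
Proof. by rewrite /pcoef big1 // => p _; rewrite ffunE. Qed.

Lemma pcoefB u v f g : pcoef u v (f - g) = pcoef u v f - pcoef u v g.
Proof. by rewrite pcoefD -[- g]scaleN1r pcoefZ mulN1r. Qed.

Lemma pcoefE u v x y : pcoef x y (pathE u v) = [&& x == u, y == v & conn orient x y]%:R.
Proof.
have [h|h] := boolP (conn orient x y); last by rewrite pcoef_out // !andbF.
have [p [e1 e2]] := conn_qpath h.
by rewrite andbT -{1}e1 -{1}e2 pcoef_path_eq ffunE e1 e2.
Qed.

Lemma pcoef1 u v : pcoef u v 1 = (u == v)%:R.
Proof.
have [h|h] := boolP (conn orient u v); last first.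
  by rewrite pcoef_out //; case: eqP => // e; rewrite e conn_refl in h.
have [p [e1 e2]] := conn_qpath h.
rewrite -{1}e1 -{1}e2 pcoef_path_eq [LHS]ffunE; congr (nat_of_bool _)%:R.
apply/eqP/eqP => [p0|uv]; first by rewrite -e1 -e2 /ptgt p0.
apply: (@path_unique u); first by rewrite -{1}e1 qpathP.
  by [].
by rewrite -{1}e1 -/(ptgt p) e2 uv.
Qed.

Lemma pcoefM u w f g : conn orient u w ->
  pcoef u w (f * g) = \sum_v pcoef v w f * pcoef u v g.
Proof.
move=> uw; have [p [e1 e2]] := conn_qpath uw.
rewrite -{1}e1 -{1}e2 pcoef_path_eq [LHS]ffunE.
transitivity (\sum_q \sum_r
    (if (ptgt q == w) && (psrc r == u) && (ptgt r == psrc q) then f q * g r else 0)).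
  apply: eq_bigr => q _; rewrite big_mkcond; apply: eq_bigr => r _.
  by rewrite is_compE e1 e2 [u == _]eq_sym [w == _]eq_sym andbA [in RHS](andbC (ptgt q == w)).
transitivity (\sum_v \sum_q \sum_r
    (if (psrc q == v) && (ptgt q == w) && ((psrc r == u) && (ptgt r == v))
     then f q * g r else 0)); last first.
  apply: eq_bigr => v _; rewrite /pcoef mulr_suml [RHS]big_mkcond; apply: eq_bigr => q _.
  case: ifP => h; last by rewrite big1.
  by rewrite mulr_sumr [RHS]big_mkcond.
rewrite [RHS]exchange_big; apply: eq_bigr => q _ /=.
rewrite [RHS]exchange_big; apply: eq_bigr => r _ /=.
rewrite [RHS](bigD1 (psrc q)) //= eqxx big1 ?addr0 ?andbA // => v nv.
by rewrite eq_sym (negPf nv).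
Qed.

End QuiverPaths.

(** * The bound quiver algebra as an algebra spanned by paths *)

Section BoundQuiverSystem.
Variables (K : fieldType) (n : nat) (Q : quiverA n) (I : admissible_ideal K Q).
Local Notation KQ := (pathalg K Q).
Local Notation IV := (ideal_vspace I).
Local Notation E := (pathE K).
Local Notation conn := (conn (orient Q)).
Implicit Types (u v w : 'I_n.+1) (f g : KQ) (a b : bqalg I).

Definition nzpath u v : bool := @pathE n Q K u v \notin IV.

Lemma pathE_mul u v w : conn u v -> conn v w -> pathE Q K v w * pathE Q K u v = pathE Q K u w.
Proof.
move=> uv vw; apply: pcoef_inj => x y; have [xy|xy] := boolP (conn x y); last by rewrite !pcoef_out.
rewrite pcoefM // (bigD1 v) //= !pcoefE eqxx big1 ?addr0; last first.
  by move=> t nt; rewrite !pcoefE (negPf nt) mul0r.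
rewrite -natrM mulnb; congr (nat_of_bool _)%:R.
case: (x =P u) => [->|]; rewrite ?andbF //=; case: (y =P w) => [->|] //=.
by rewrite uv vw (conn_trans uv vw) ?eqxx.
Qed.

Lemma pcoef_sandwich u v f :
  pathE Q K v v * f * pathE Q K u u = pcoef u v f *: pathE Q K u v.
Proof.
apply: pcoef_inj => x y; have [xy|xy] := boolP (conn x y); last by rewrite !pcoef_out.
rewrite pcoefZ pcoefE xy andbT pcoefM // (bigD1 u) //= !pcoefE big1 ?addr0; last first.
  by move=> t nt; rewrite !pcoefE (negPf nt) /= andbF mulr0.
rewrite eqxx /=; case: (x =P u) => [->|]; last by rewrite !mulr0.
rewrite conn_refl mulr1 /=; have [uy|uy] := boolP (conn u y); last first.
  rewrite pcoef_out //; case: eqP => [e|]; rewrite ?mulr0 //.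
  by rewrite -e pcoef_out // mul0r.
rewrite pcoefM // (bigD1 v) //= pcoefE eqxx big1 ?addr0; last first.
  by move=> t nt; rewrite pcoefE (negPf nt) mul0r.
case: (y =P v) => [->|]; last by rewrite mul0r mulr0.
by rewrite conn_refl mul1r mulr1.
Qed.

(** Multiplying an element of the ideal by trivial paths on both sides isolates one term, so the
    ideal contains every path occurring in its elements. *)
Lemma pcoef_ideal u v f : nzpath u v -> f \in IV -> pcoef u v f = 0.
Proof.
move=> nz fI; apply/eqP; apply: contraNT nz => c0.
have : pcoef u v f *: pathE Q K u v \in IV.
  by rewrite -pcoef_sandwich; apply/bqideal_mulr/bqideal_mull.
by move/(rpredZ (pcoef u v f)^-1); rewrite scalerA mulVf // scale1r.
Qed.

Lemma pcoef_expand f : f = \sum_u \sum_v pcoef u v f *: pathE Q K u v.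
Proof.
apply: pcoef_inj => x y; rewrite (big_morph (pcoef x y) (pcoefD x y) (@pcoef0 n Q K x y)).
rewrite (bigD1 x) //= [X in _ + X]big1 ?addr0 => [|u nu]; last first.
  rewrite (big_morph (pcoef x y) (pcoefD x y) (@pcoef0 n Q K x y)) big1 // => v _.
  by rewrite pcoefZ pcoefE eq_sym (negPf nu) mulr0.
rewrite (big_morph (pcoef x y) (pcoefD x y) (@pcoef0 n Q K x y)) (bigD1 y) //= big1 ?addr0 => [|v nv].
  rewrite pcoefZ pcoefE !eqxx /=; have [xy|xy] := boolP (conn x y); first by rewrite mulr1.
  by rewrite pcoef_out ?mul0r.
by rewrite pcoefZ pcoefE [y == v]eq_sym (negPf nv) andbF mulr0.
Qed.

Lemma ideal_coef f : (forall u v, nzpath u v -> pcoef u v f = 0) -> f \in IV.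
Proof.
move=> h; rewrite (pcoef_expand f); apply: rpred_sum => u _; apply: rpred_sum => v _.
have [nz|] := boolP (nzpath u v); first by rewrite h // scale0r rpred0.
by rewrite negbK => /rpredZ; apply.
Qed.

Lemma pathE_pathv p : pathE Q K (psrc p) (ptgt p) = pathv K p.
Proof.
apply/ffunP => q; rewrite !ffunE; congr (nat_of_bool _)%:R.
by apply/andP/eqP => [[/eqP e1 /eqP e2]|->]; [apply: qpath_unique | rewrite !eqxx].
Qed.

Lemma nzpath_conn u v : nzpath u v -> conn u v.
Proof.
apply: contraNT => h; rewrite (_ : pathE Q K u v = 0) ?rpred0 //.
by apply: pcoef_inj => x y; rewrite pcoefE pcoef0; case: eqP => // ->; case: eqP => // ->;
  rewrite (negPf h).
Qed.

Lemma admissible_sub f : f \in IV -> f \in (arrow_ideal K Q ^+ 2)%VS.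
Proof.
by have [_ [m _ /andP[_ h]]] := ideal_admissible I; apply: (subvP h).
Qed.

Lemma nzpath_refl u : nzpath u u.
Proof.
apply/negP => /admissible_sub h.
have [p p1 p2] := trivial_path Q u.
have := subvP (expv_trivial_path K 1 p2) _ h.
have e1 : pathE Q K u u p = 1 by rewrite ffunE /ptgt p2 /= p1 eqxx.
by rewrite memv_ker lfunE /= /coef_path e1 oner_eq0.
Qed.

(** By admissibility the ideal lies in the square of the arrow ideal, whose elements have
    coefficient 0 at paths of length one. *)
Lemma nzpath_arr u v : arr (orient Q) u v -> nzpath u v.
Proof.
rewrite arr_orient => uv; apply/negP => /admissible_sub.
have [|p p1 p2] := @qpath_ex n Q u [:: v]; first by rewrite /= uv.
suff h : (arrow_ideal K Q ^+ 2 <= lker (linfun (coef_path (K := K) p)))%VS.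
  have e1 : pathE Q K u v p = 1 by rewrite ffunE /ptgt p2 /= p1 !eqxx.
  by move/(subvP h); rewrite memv_ker lfunE /= /coef_path e1 oner_eq0.
have triv f q : f \in arrow_ideal K Q -> ptail q = [::] -> f q = 0.
  move=> fA q0; have := subvP (arrow_ideal_trivial_path K q0) _ fA.
  by rewrite memv_ker lfunE => /eqP.
rewrite expv2; apply/prodvP => f g fA gA; rewrite memv_ker lfunE /= /coef_path.
rewrite ffunE; apply/eqP; apply: big1 => q _; apply: big1 => r /and3P[_ _ /eqP].
rewrite p2; case er: (ptail r) => [|x l]; first by rewrite (triv g r) ?mulr0.
case: l {er} => [|//] [_ eq]; rewrite (triv f q) ?mul0r //.
Qed.

Lemma nzpath_sub u v w : conn u v -> conn v w -> nzpath u w -> nzpath u v && nzpath v w.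
Proof.
move=> uv vw; rewrite /nzpath -(pathE_mul uv vw) => h.
by apply/andP; split; apply: contraNN h => h; [apply: bqideal_mull | apply: bqideal_mulr].
Qed.

Definition bq_shape : qshape n :=
  QShape nzpath_conn nzpath_refl nzpath_arr nzpath_sub.

(** Independent of the representative: by [pcoef_ideal] the ideal has coefficient 0 at surviving
    paths. *)
Definition bq_cf u v a : K := if nzpath u v then pcoef u v (repr a) else 0.

Lemma bq_cfE u v f : bq_cf u v (bqproj I f) = if nzpath u v then pcoef u v f else 0.
Proof.
rewrite /bq_cf; case: ifP => // nz; apply/eqP; rewrite -subr_eq0 -pcoefB.
by rewrite pcoef_ideal ?eqxx // bqproj_reprB.
Qed.

Lemma bq_cf_inj a b : (forall u v, bq_cf u v a = bq_cf u v b) -> a = b.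
Proof.
have [[f ->] [g ->]] := (bqprojP a, bqprojP b) => h; apply/bqproj_eq/ideal_coef => u v nz.
by have := h u v; rewrite !bq_cfE nz pcoefB => ->; rewrite subrr.
Qed.

Lemma bq_cf_out u v a : ~~ nz bq_shape u v -> bq_cf u v a = 0.
Proof. by rewrite /bq_cf /= => /negPf->. Qed.

Lemma bq_cfD u v a b : bq_cf u v (a + b) = bq_cf u v a + bq_cf u v b.
Proof.
have [[f ->] [g ->]] := (bqprojP a, bqprojP b); rewrite -bqprojD !bq_cfE.
by case: ifP; rewrite ?addr0 // pcoefD.
Qed.

Lemma bq_cf1 u v : bq_cf u v 1 = (u == v)%:R.
Proof.
rewrite (bq_cfE u v 1) pcoef1; case: ifP => // /negbT h; case: eqP h => // ->.
by rewrite nzpath_refl.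
Qed.

Lemma bq_cfM u w a b : nz bq_shape u w ->
  bq_cf u w (a * b) = \sum_v bq_cf v w a * bq_cf u v b.
Proof.
move=> nz; have [[f ->] [g ->]] := (bqprojP a, bqprojP b); rewrite -bqprojM bq_cfE.
have h : nzpath u w by [].
rewrite h pcoefM ?nzpath_conn //; apply: eq_bigr => v _; rewrite !bq_cfE.
have [uv|uv] := boolP (conn u v); last by rewrite !(pcoef_out _ uv) mulr0 if_same mulr0.
have [vw|vw] := boolP (conn v w); last by rewrite !(pcoef_out _ vw) mul0r if_same mul0r.
by have /andP[-> ->] := nzpath_sub uv vw h.
Qed.

Definition bq_pe u v : bqalg I := bqproj I (pathE Q K u v).

Lemma bq_cf_pe u v u' v' :
  bq_cf u v (bq_pe u' v') = [&& u == u', v == v' & nz bq_shape u v]%:R.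
Proof.
rewrite bq_cfE pcoefE /=; case: ifP => [h|]; last by rewrite !andbF.
by rewrite nzpath_conn.
Qed.

Lemma bq_cf_sc u v (c : K) : bq_cf u v (c%:A) = if u == v then c else 0.
Proof.
have -> : c%:A = bqproj I (c *: 1) by rewrite bqprojZ.
rewrite bq_cfE pcoefZ pcoef1; case: eqP => [->|]; first by rewrite nzpath_refl mulr1.
by rewrite mulr0 if_same.
Qed.

Definition bq_sys : algsys bq_shape K (bqalg I) :=
  AlgSys bq_cf_inj bq_cf_out bq_cfD bq_cf1 bq_cfM bq_cf_pe bq_cf_sc.

(** On a linear stretch every path is part of the full path from [s] to [k]. If the latter survives,
    so do all of them and the restriction is zero; if not, it is itself a non-zero element of the
    restriction. *)
Lemma restrict_ideal_neq0 (s k i j : 'I_n.+1) : conn s k ->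
  (i == s) && (j == k) || (i == k) && (j == s) -> (i <= j)%N ->
  (restrict_ideal IV i j != 0%VS) = ~~ nzpath s k.
Proof.
move=> sk ij le.
have inE v : ((s <= v <= k) || (k <= v <= s))%N = (i <= v <= j)%N.
  by case/orP: ij le => /andP[/eqP-> /eqP->]; clear; lia.
apply/idP/idP => [|].
  apply: contraNN => nzsk; rewrite -subv0; apply/subvP => f /memv_capP[fI fB].
  rewrite memv0; apply/eqP/ffunP => p; rewrite ffunE.
  have [hp|hp] := boolP (all (fun v : 'I_n.+1 => (i <= v <= j)%N) (psrc p :: ptail p)); last first.
    have h : (pathalg_between K Q i j <= lker (linfun (coef_path (K := K) p)))%VS.
      apply/span_subvP => _ /mapP[q + ->]; rewrite mem_filter memv_ker lfunE => /andP[hq _].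
      by rewrite /= /coef_path ffunE; case: (p =P q) hp => [->|_ _]; rewrite ?hq ?eqxx.
    by have := subvP h _ fB; rewrite memv_ker lfunE => /eqP.
  rewrite -pcoef_path_eq; apply: pcoef_ideal => //.
  have /allP hall := hp.
  have h1 := hall _ (mem_head _ _); have h2 := hall _ (mem_last _ _).
  rewrite -inE in h1; rewrite -inE in h2.
  have /andP[s1 k1] := conn_between h1 sk; have /andP[s2 k2] := conn_between h2 sk.
  have /andP[_ nz1] := nzpath_sub s1 k1 nzsk.
  by have /andP[] := nzpath_sub (qpath_conn p) k2 nz1.
rewrite negbK => skI; have [p [p1 p2]] := conn_qpath sk.
have pE : pathE Q K s k = pathv K p by rewrite -p1 -p2 pathE_pathv.
have : pathv K p \in restrict_ideal IV i j.
  rewrite memv_cap -pE skI /= pE; apply: memv_span; apply: map_f.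
  rewrite mem_filter mem_enum andbT; apply/allP => v vp.
  have [c1 c2] := path_conn (qpathP p) vp; rewrite -inE.
  by rewrite p1 in c1; rewrite -/(ptgt p) p2 in c2; apply: conn_mid c1 c2.
apply: contraTneq => ->; rewrite memv0; apply/eqP => /ffunP/(_ p).
by rewrite !ffunE eqxx => /eqP; rewrite oner_eq0.
Qed.

End BoundQuiverSystem.

(** * Counting *)

Section PathEnds.
Local Open Scope nat_scope.
Variables (n : nat) (sh : qshape n).
Local Notation f := (up sh).
Local Notation arr := (arr f).
Local Notation conn := (conn f).
Local Notation nz := (nz sh).
Implicit Types (e k s t u v w x y : 'I_n.+1).

Definition source u : bool := [forall v : 'I_n.+1, ~~ arr v u].
Definition sink u : bool := [forall v : 'I_n.+1, ~~ arr u v].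
Definition isource u : bool := source u && (0 < u < n).
Definition reached k : bool := [exists s, isource s && nz s k].

Lemma sourceP u : reflect (forall v, ~~ arr v u) (source u).
Proof. exact: forallP. Qed.

Lemma sinkP u : reflect (forall v, ~~ arr u v) (sink u).
Proof. exact: forallP. Qed.

Definition between u v w : bool := (u <= v <= w) || (w <= v <= u).

Lemma adj_toward u v : u != v -> exists2 w : 'I_n.+1, adj u w & between u w v.
Proof.
move=> nuv; have nuv' := ord_neq nuv.
have [i [lt a b]] : exists i : nat, [/\ i < n.+1, adj u i & (u <= i <= v) || (v <= i <= u)].
  have := ltn_ord u; have := ltn_ord v; move: nuv'; rewrite /adj.
  move: (u : nat) (v : nat) => i j; case: (ltnP i j) => ij nij lj li;
    [exists i.+1|exists i.-1]; split; lia.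
by exists (Ordinal lt).
Qed.

Lemma other_neighbor u v : 0 < u < n -> adj u v -> exists2 w : 'I_n.+1, adj u w & w != v.
Proof.
move=> hu uv.
have [i [lt a b]] : exists i : nat, [/\ i < n.+1, adj u i & i <> v].
  move: uv hu; rewrite /adj; move: (u : nat) (v : nat) => i j h1 h2.
  by case: (j =P i.+1) => h; [exists i.-1|exists i.+1]; split; lia.
by exists (Ordinal lt) => //; apply/eqP => e; apply: b; rewrite -e.
Qed.

Lemma adj_two u v w x : adj u v -> adj u w -> v != w -> adj u x -> x = v \/ x = w.
Proof.
move=> uv uw nvw ux; have nvw' := ord_neq nvw.
have [h|h] : x = v :> nat \/ x = w :> nat.
  by move: uv uw ux nvw'; rewrite /adj; clear; lia.
- by left; apply: val_inj.
- by right; apply: val_inj.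
Qed.

Lemma arr_conn_unique u v w x : arr u v -> arr u w -> conn v x -> conn w x -> v = w.
Proof.
move=> uv uw vx wx; apply: val_inj.
have := conn_mid (arr_conn uv) vx; have := conn_mid (arr_conn uw) wx.
by move: (arr_adjacent uv) (arr_adjacent uw); rewrite /adj /=; clear; lia.
Qed.

Lemma conn_last u v : conn u v -> u != v -> exists2 w : 'I_n.+1, conn u w & arr w v.
Proof.
move=> uv nuv; have := uv; rewrite -conn_negb => vu.
have [|w [vw wu _]] := conn_first vu; first by rewrite eq_sym.
by exists w; [rewrite -conn_negb | rewrite -arr_negb].
Qed.

Lemma source_conn u v : source v -> conn u v -> u = v.
Proof.
move=> /sourceP sv uv; apply/eqP/negPn/negP => /(conn_last uv)[w _].
by apply/negP.
Qed.

Lemma sink_conn u v : sink u -> conn u v -> u = v.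
Proof.
move=> /sinkP su uv; apply/eqP/negPn/negP => /(conn_first uv)[w [uw _ _]].
by move: uw; apply/negP.
Qed.

Lemma sink_below u : exists2 k, sink k & conn u k.
Proof.
case: (arg_maxnP (P := fun k => conn u k) (fun k => `|k - u|%N) (conn_refl f u)) => k uk kmax.
exists k => //; apply/sinkP => v; apply/negP => kv.
have := kmax v (conn_trans uk (arr_conn kv)); have := conn_mid uk (arr_conn kv).
by move: (arr_adjacent kv); rewrite /adj; clear; lia.
Qed.

Lemma source_arr u v : source u -> adj u v -> arr u v.
Proof.
by move=> /sourceP su /(arr_total f)/orP[//|vu]; have := su v; rewrite vu.
Qed.

Lemma sink_arr u v : sink u -> adj u v -> arr v u.
Proof.
by move=> /sinkP su /(arr_total f)/orP[uv|//]; have := su v; rewrite uv.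
Qed.

Lemma isource_neighbors s : isource s ->
  exists v w : 'I_n.+1, [/\ arr s v, arr s w, v != w & 0 < s < n].
Proof.
case/andP=> ss hs.
have [v sv _] : exists2 v : 'I_n.+1, adj s v & between s v ord0.
  by apply: adj_toward; apply/eqP => e; move: hs; rewrite e.
have [w sw nw] := other_neighbor hs sv.
by exists v, w; split=> //; [apply: source_arr|apply: source_arr|rewrite eq_sym].
Qed.

Lemma isource_not_sink s : isource s -> sink s = false.
Proof.
move=> /isource_neighbors[v [_ [sv _ _ _]]]; apply/negP => /sinkP/(_ v).
by rewrite sv.
Qed.

(** The two arrows leaving [s] lead in opposite directions to different sinks. *)
Lemma isource_two_sinks s : isource s -> exists k k', [/\ sink k, sink k' & k != k'].
Proof.
move=> /isource_neighbors[v [w [sv sw nvw _]]].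
have [k kk vk] := sink_below v; have [k' kk' wk'] := sink_below w.
exists k, k'; split=> //; apply: contraNneq nvw => e.
by apply/eqP/(arr_conn_unique sv sw vk); rewrite e.
Qed.

(** A path ending at an inner source starts there, but then it continues along the second arrow. A
    path ending at a sink starts at a vertex with two outgoing arrows, one along the path and one to
    [t]. Conversely, a reached sink ends the path from an inner source that avoids the other
    neighbour. *)
Lemma path_endP k : path_end sh k <-> ~~ isource k /\ (sink k -> reached k).
Proof.
split=> [[s [t [st ke]]]|[nsk sk]].
  have [kV kend] := ke; have st_adj := arr_adjacent st.
  have nzsk : nz s k := Vset_nz kV; have csk := nz_conn nzsk.
  split.
    apply/negP => /andP[kk hk]; have sk := source_conn kk csk.
    rewrite sk in st st_adj kV kend.
    have [w kw nwt] := other_neighbor hk st_adj.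
    have akw := source_arr kk kw.
    case/negP: (kend w akw); rewrite in_Vset nz_arr //=.
    by apply: side_opposite st_adj kw _ => e; case/eqP: nwt; apply: val_inj.
  move=> kk; apply/existsP; exists s; rewrite nzsk andbT.
  have nsk : s != k by apply/eqP => e; have /sinkP/(_ t) := kk; rewrite -e st.
  have [w [sw wk _]] := conn_first csk nsk.
  have nwt : w != t.
    apply/eqP => e; rewrite e in wk.
    have := kV; rewrite Vset_alt // => /andP[_ /negP]; apply.
    by have /andP[] := nz_sub (arr_conn st) wk nzsk.
  have hs : 0 < s < n.
    have := kV; rewrite in_Vset => /andP[_]; have := ltn_ord t; have := ltn_ord k.
    have nsk' := ord_neq nsk.
    by case: (sideP k st_adj) => -[e ->]; move: e nsk'; clear; lia.
  rewrite /isource hs andbT; apply/sourceP => v; apply/negP => vs.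
  have := adj_two st_adj (arr_adjacent sw) _ (adjC (arr_adjacent vs)).
  case; first by rewrite eq_sym.
    by move=> e; rewrite e (arr_asym st) in vs.
  by move=> e; rewrite e (arr_asym sw) in vs.
have [kk|] := boolP (sink k).
  have /existsP[s /andP[ss nzsk]] := sk kk.
  have csk := nz_conn nzsk.
  have nsk' : s != k by apply: contraNneq nsk => <-.
  have [w [sw wk _]] := conn_first csk nsk'.
  have /andP[srcs hs] := ss.
  have [t st nt] := other_neighbor hs (arr_adjacent sw).
  have ast := source_arr srcs st.
  exists s, t; split=> //; split; last by move=> v; rewrite (negPf (sinkP _ kk v)).
  rewrite Vset_alt // nzsk; apply/negP => /nz_conn tk; case/eqP: nt.
  exact: arr_conn_unique ast sw tk wk.
rewrite negb_forall => /existsP[v]; rewrite negbK => kv.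
(* For a vertex with an arrow [k -> v], the path may be trivial: a second outgoing arrow would make
   [k] an inner source. *)
exists k, v; split=> //; split; first exact: Vset_start.
move=> x kx; apply/negP; rewrite in_Vset => /andP[_ sx]; case/negP: nsk.
have xv : v != x.
  by apply/eqP => e; move: sx; rewrite -e side_other //; apply: adjC; apply: arr_adjacent kv.
have xv' := ord_neq xv.
apply/andP; split; last first.
  move: (arr_adjacent kv) (arr_adjacent kx) xv' (ltn_ord v) (ltn_ord x); rewrite /adj.
  by clear; lia.
apply/sourceP => y; apply/negP => yk.
have [e|e] := adj_two (arr_adjacent kv) (arr_adjacent kx) xv (adjC (arr_adjacent yk)).
  by rewrite e (arr_asym kv) in yk.
by rewrite e (arr_asym kx) in yk.
Qed.

Lemma num_path_ends :
  #|[pred k | `[< path_end sh k >]]| + #|[pred k | isource k]|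
    + #|[pred k | sink k && ~~ reached k]| = n.+1.
Proof.
rewrite -[RHS]card_ord -addnA -cardUI [X in _ + (_ + X)]eq_card0 ?addn0; last first.
  move=> k; rewrite !inE; apply/negP => /andP[ks].
  by rewrite (isource_not_sink ks).
rewrite -(cardC [pred k | `[< path_end sh k >]]); congr (_ + _).
apply: eq_card => k; rewrite !inE; apply/orP/asboolPn => [h /path_endP[nk rk]|h].
  by case: h => [|/andP[/rk->]] //; rewrite (negPf nk).
have [ks|ks] := boolP (isource k); first by left.
right; apply/andP; have [kk|kk] := boolP (sink k); last first.
  by case: h; apply/path_endP; split=> //; rewrite (negPf kk).
by split=> //; apply/negP => rk; case: h; apply/path_endP.
Qed.

(** The vertex farthest from [k] in the direction of [k'] among those with a path to [k] is a
    source. *)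
Lemma between_source k k' : sink k -> sink k' -> k != k' ->
  exists s, [/\ isource s, conn s k & between k s k'].
Proof.
move=> kk kk' nkk'.
pose P s := conn s k && between k s k'.
have Pk : P k by rewrite /P conn_refl /between leqnn /= andbT leq_total.
case: (arg_maxnP (P := P) (fun s => `|s - k|%N) Pk) => s /andP[sk bs] smax.
have nsk : s != k.
  apply/eqP => e; have [w kw bw] := adj_toward nkk'.
  have := smax w; rewrite /P bw (arr_conn (sink_arr kk kw)) => /(_ isT).
  by rewrite e; move: kw; rewrite /adj; clear; lia.
have nsk' : s != k'.
  by apply/eqP => e; case/eqP: nkk'; rewrite e in sk; apply/esym/sink_conn.
have nn1 := ord_neq nsk.
have nn2 := ord_neq nsk'.
exists s; split=> //; apply/andP; split; last first.
  move: bs nn1 nn2 (ltn_ord k) (ltn_ord k'); rewrite /between; clear; lia.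
apply/sourceP => v; apply/negP => vs.
have vk := conn_trans (arr_conn vs) sk.
have bv : between k v k'.
  by move: bs nn1 nn2 (arr_adjacent vs); rewrite /between /adj; clear; lia.
have := smax v; rewrite /P vk bv => /(_ isT) le.
have m : (s <= v <= k) || (k <= v <= s).
  by move: le (arr_adjacent vs) nn1; rewrite /adj; clear; lia.
have /andP[sv _] := conn_between m sk.
by case: (adj_neq (arr_adjacent vs)); apply: conn_anti (arr_conn vs) sv.
Qed.

Lemma end_source e k : sink k -> k != e ->
  (exists s, [/\ isource s, conn s k & between k s e]) \/
  (conn e k /\ forall t, sink t -> between k t e -> t = k).
Proof.
move=> kk nke.
pose P s := conn s k && between k s e.
have Pk : P k by rewrite /P conn_refl /between leqnn /= andbT leq_total.
case: (arg_maxnP (P := P) (fun s => `|s - k|%N) Pk) => s /andP[sk bs] smax.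
have [se|nse] := eqVneq s e.
  right; rewrite -se; split=> // t tt bt; apply: sink_conn => //.
  by have /andP[] := conn_between (etrans (orbC _ _) bt) sk.
left; exists s; split=> //.
have [v sv bv] := adj_toward nse.
have bv' : between k v e by move: bs bv; rewrite /between; clear; lia.
have nse' := ord_neq nse.
have asv : arr s v.
  have /orP[//|vs] := arr_total f sv.
  have := smax v; rewrite /P bv' (conn_trans (arr_conn vs) sk) => /(_ isT).
  by move: sv bv bs nse'; rewrite /adj /between; clear; lia.
have nsk : s != k by apply: contraTneq asv => ->; apply/sinkP.
have nsk' := ord_neq nsk.
have [w [sw wk _]] := conn_first sk nsk.
have bw := conn_mid (arr_conn sw) wk.
have nvw : v != w.
  apply/eqP => h; rewrite h in bv; move: bs bv bw nsk' nse' (arr_adjacent sw).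
  by rewrite /between /adj; clear; lia.
apply/andP; split; last first.
  by move: bs nsk' nse' (ltn_ord k) (ltn_ord e); rewrite /between; clear; lia.
apply/sourceP => y; apply/negP => ys.
have [h|h] := adj_two sv (arr_adjacent sw) nvw (adjC (arr_adjacent ys)).
  by rewrite h (arr_asym asv) in ys.
by rewrite h (arr_asym sw) in ys.
Qed.

(** Of two such sources on the same side of [k], one would lie on the path from the other. *)
Lemma source_unique k s s' : source s -> source s' -> conn s k -> conn s' k ->
  (s < k) = (s' < k) -> s = s'.
Proof.
move=> ss ss' sk sk' same.
have [m|m] : (s <= s' <= k) || (k <= s' <= s) \/ (s' <= s <= k) || (k <= s <= s').
  by move: same; clear; lia.
  by have /andP[c _] := conn_between m sk; apply: source_conn.
by have /andP[c _] := conn_between m sk'; apply/esym/source_conn.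
Qed.

Lemma isource_not_conn e k s : isource s -> conn e k -> between k s e -> e = s.
Proof.
move=> /andP[ss _] ek b; apply: source_conn => //.
by have /andP[] := conn_between (etrans (orbC _ _) b) ek.
Qed.

End PathEnds.

(** * Sink ideals and inner sources *)

Section SinkIdeals.
Local Open Scope nat_scope.
Variables (K : fieldType) (n : nat) (Q : quiverA n) (I : admissible_ideal K Q).
Local Notation sh := (bq_shape I).
Local Notation conn := (conn (orient Q)).
Local Notation restr := (restrict_ideal (ideal_vspace I)).
Implicit Types (i j k s t u v : 'I_n.+1).

Lemma is_sourceE s : is_source Q s = source sh s.
Proof. by apply: eq_forallb => v; rewrite arr_orient. Qed.

Lemma is_sinkE s : is_sink Q s = sink sh s.
Proof. by apply: eq_forallb => v; rewrite arr_orient. Qed.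

Lemma inner_sourceE s : inner_source Q s = isource sh s.
Proof. by rewrite /inner_source is_sourceE. Qed.

Lemma linear_betweenE i j : i <= j -> linear_between Q i j = conn i j || conn j i.
Proof.
move=> ij; rewrite /linear_between; congr (_ || _).
  apply/'forall_forallP/connP => [h|[h _] k l]; last first.
    apply/implyP => /and3P[ik /eqP lk lj]; rewrite -arr_orient /arr lk eqxx h //.
    by rewrite ik /=; move: lk lj; clear; lia.
  split=> k hk; last by move: hk ij; clear; lia.
  have lt1 : k < n.+1 by have := ltn_ord j; move: hk; clear; lia.
  have lt2 : k.+1 < n.+1 by have := ltn_ord j; move: hk; clear; lia.
  have /implyP := h (Ordinal lt1) (Ordinal lt2); rewrite -arr_orient /arr /= eqxx /=.
  rewrite (_ : (k == k.+2) = false) ?orbF; last by clear; lia.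
  by apply; move: hk; clear; lia.
apply/'forall_forallP/connP => [h|[_ h] k l]; last first.
  apply/implyP => /and3P[ik /eqP lk lj]; rewrite -arr_orient /arr lk eqxx /= (h k) ?orbT //.
  by rewrite ik /=; move: lk lj; clear; lia.
split=> k hk; first by move: hk ij; clear; lia.
have lt1 : k < n.+1 by have := ltn_ord j; move: hk; clear; lia.
have lt2 : k.+1 < n.+1 by have := ltn_ord j; move: hk; clear; lia.
have /implyP := h (Ordinal lt1) (Ordinal lt2); rewrite -arr_orient /arr /= eqxx /=.
rewrite (_ : (k == k.+2) = false) /=; last by clear; lia.
by apply; move: hk; clear; lia.
Qed.

Lemma linear_sink_left s k : sink sh k -> s < k -> linear_between Q s k = conn s k.
Proof.
move=> kk sk; rewrite linear_betweenE ?(ltnW sk) //.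
have [ks|] := boolP (conn k s); last by rewrite orbF.
by have := sink_conn kk ks => e; rewrite e ltnn in sk.
Qed.

Lemma linear_sink_right s k : sink sh k -> k < s -> linear_between Q k s = conn s k.
Proof.
move=> kk sk; rewrite linear_betweenE ?(ltnW sk) //.
have [ks|] := boolP (conn k s); last by [].
by have := sink_conn kk ks => e; rewrite e ltnn in sk.
Qed.

Lemma restr_left s k : s < k -> conn s k -> (restr s k != 0%VS) = ~~ nz sh s k.
Proof. by move=> lt sk; apply: restrict_ideal_neq0; rewrite ?eqxx // ltnW. Qed.

Lemma restr_right s k : k < s -> conn s k -> (restr k s != 0%VS) = ~~ nz sh s k.
Proof. by move=> lt sk; apply: restrict_ideal_neq0; rewrite ?eqxx ?orbT // ltnW. Qed.

Lemma ord_lt_neq i j : i < j -> i != j.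
Proof. by move=> ij; apply/eqP => e; rewrite e ltnn in ij. Qed.

Lemma reached_one s k : isource sh s -> conn s k ->
  (forall t, isource sh t -> conn t k -> t = s) -> reached sh k = nz sh s k.
Proof.
move=> ss sk uniq; apply/existsP/idP => [[t /andP[tt tk]]|nsk].
  by rewrite -(uniq t tt (nz_conn tk)).
by exists s; rewrite ss.
Qed.

(** Serves for a sink at the left end and for a first sink reached linearly from the left end. The
    only inner source leading to [k] is the first one, as an earlier one would lie on its path to
    [k]. *)
Lemma one_sided_right k k' : sink sh k -> sink sh k' -> k < k' ->
  (forall t, isource sh t -> k < t) ->
  [exists s, first_inner_source Q s && (restr k s != 0%VS)] = ~~ reached sh k.
Proof.
move=> kk kk' lt right; have [s [ss sk _]] := between_source kk kk' (ord_lt_neq lt).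
have ks := right s ss; have /andP[srcs _] := ss.
have uniq t : isource sh t -> conn t k -> t = s.
  move=> tt tk; have /andP[srct _] := tt; apply: (source_unique srct srcs tk sk).
  by have := right t tt; move: ks; clear; lia.
have first : first_inner_source Q s.
  rewrite /first_inner_source inner_sourceE ss; apply/forallP => t; apply/implyP.
  rewrite inner_sourceE => tt; rewrite leqNgt; apply/negP => ts.
  have bt : between k t s by rewrite /between; have := right t tt; move: ts; clear; lia.
  by rewrite (isource_not_conn tt sk bt) ltnn in ts.
rewrite (reached_one ss sk uniq) -(restr_right ks sk).
apply/existsP/idP => [[t /andP[/andP[tt /forallP ft]]]|h]; last by exists s; rewrite first.
have -> // : t = s.
have /andP[_ /forallP fs] := first.
have ts : t <= s by have := ft s; rewrite inner_sourceE ss.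
have st : s <= t by have := fs t; rewrite tt.
by apply: val_inj; apply/eqP; rewrite eqn_leq ts.
Qed.

Lemma one_sided_left k k' : sink sh k -> sink sh k' -> k' < k ->
  (forall t, isource sh t -> t < k) ->
  [exists s, last_inner_source Q s && (restr s k != 0%VS)] = ~~ reached sh k.
Proof.
move=> kk kk' lt left; have nk : k != k' by rewrite eq_sym ord_lt_neq.
have [s [ss sk _]] := between_source kk kk' nk.
have ks := left s ss; have /andP[srcs _] := ss.
have uniq t : isource sh t -> conn t k -> t = s.
  move=> tt tk; have /andP[srct _] := tt; apply: (source_unique srct srcs tk sk).
  by have := left t tt; move: ks; clear; lia.
have last : last_inner_source Q s.
  rewrite /last_inner_source inner_sourceE ss; apply/forallP => t; apply/implyP.
  rewrite inner_sourceE => tt; rewrite leqNgt; apply/negP => ts.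
  have bt : between k t s by rewrite /between; have := left t tt; move: ts; clear; lia.
  by rewrite (isource_not_conn tt sk bt) ltnn in ts.
rewrite (reached_one ss sk uniq) -(restr_left ks sk).
apply/existsP/idP => [[t /andP[/andP[tt /forallP ft]]]|h]; last by exists s; rewrite last.
have -> // : t = s.
have /andP[_ /forallP fs] := last.
have ts : s <= t by have := ft s; rewrite inner_sourceE ss.
have st : t <= s by have := fs t; rewrite tt.
by apply: val_inj; apply/eqP; rewrite eqn_leq st.
Qed.

(** In the first four cases of the sink ideal one inner source leads to [k], in the last case one on
    each side. The sink is unreached when all these paths vanish, hence the requirement that both
    halves be non-zero. *)
Lemma sink_ideal_reached k : is_sink Q k -> 1 < num_sinks Q ->
  sink_ideal_neq0 I k = ~~ reached sh k.
Proof.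
rewrite is_sinkE => kk /card_gt1P[k1 [k2 []]]; rewrite !inE !is_sinkE => kk1 kk2 n12.
have [k' [kk' nk']] : exists k', sink sh k' /\ k != k'.
  by have [e|ne] := eqVneq k k1; [exists k2; rewrite e | exists k1].
have ltn v : v <= n by have := ltn_ord v; rewrite ltnS.
rewrite /sink_ideal_neq0; case: (k =P ord0) => [k0|/eqP k0].
  have pos t : t != ord0 -> k < t by rewrite k0 lt0n.
  apply: (one_sided_right kk kk') => [|t /andP[_ /andP[t0 _]]]; last by rewrite k0.
  by apply: pos; rewrite -k0 eq_sym.
case: (k =P ord_max) => [km|/eqP km].
  apply: (one_sided_left kk kk') => [|t /andP[_ /andP[_ tn]]]; last by rewrite km.
  rewrite km ltn_neqAle ltn andbT; apply: contraNneq nk' => e; rewrite km.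
  by apply/eqP/val_inj; rewrite /= e.
have kgt0 : 0 < k by rewrite lt0n.
have kltn : k < n.
  rewrite ltn_neqAle ltn andbT; apply: contraNneq km => e; by apply/eqP/val_inj.
have lin0 := linear_sink_left (s := ord0) kk kgt0.
have linn := linear_sink_right (s := ord_max) kk kltn.
have firstE : first_sink Q k = [forall t, sink sh t ==> (k <= t)].
  by rewrite /first_sink is_sinkE kk; apply: eq_forallb => t; rewrite is_sinkE.
have lastE : last_sink Q k = [forall t, sink sh t ==> (t <= k)].
  by rewrite /last_sink is_sinkE kk; apply: eq_forallb => t; rewrite is_sinkE.
case: ifP => [/andP[fk lk]|nfirst].
  rewrite firstE in fk; rewrite lin0 in lk.
  apply: (one_sided_right kk kk').
    rewrite ltn_neqAle; apply/andP; split; last by have /forallP/(_ k') := fk; rewrite kk'.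
    by apply: contraNneq nk' => e; apply/eqP/val_inj.
  move=> t tt; rewrite ltnNge; apply/negP => tk.
  have bt : between k t ord0 by rewrite /between tk orbT.
  by have /andP[_ /andP[t0 _]] := tt; rewrite -(isource_not_conn tt lk bt) in t0.
case: ifP => [/andP[fk lk]|nlast].
  rewrite lastE in fk; rewrite linn in lk.
  apply: (one_sided_left kk kk').
    rewrite ltn_neqAle; apply/andP; split; last by have /forallP/(_ k') := fk; rewrite kk'.
    by apply: contraNneq nk' => e; apply/eqP/val_inj.
  move=> t tt; rewrite ltnNge; apply/negP => tk.
  have bt : between k t ord_max by rewrite /between tk /= ltn.
  by have /andP[_ /andP[_ tn]] := tt; rewrite -(isource_not_conn tt lk bt) ltnn in tn.
(* If no inner source leads to [k] from the left, [end_source] makes the stretch from the left end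
   linear and [k] the first sink, a case already treated. *)
have [s [ss sk ls]] : exists s, [/\ isource sh s, conn s k & s < k].
  case: (end_source kk k0) => [[s [ss sk b]]|[c0 all]].
    exists s; split=> //; rewrite ltn_neqAle; apply/andP; split.
      apply/eqP => e; move: (isource_not_sink ss).
      by rewrite (val_inj e : s = k) kk.
    by move: b; rewrite /between /=; clear; lia.
  case/negP: (negbT nfirst); rewrite firstE lin0 c0 andbT; apply/forallP => t.
  apply/implyP => tt; rewrite leqNgt; apply/negP => tk.
  have bt : between k t ord0 by rewrite /between /=; move: tk; clear; lia.
  by rewrite (all t tt bt) ltnn in tk.
have [s' [ss' sk' ls']] : exists s, [/\ isource sh s, conn s k & k < s].
  case: (end_source kk km) => [[s' [ss' sk' b]]|[c0 all]].
    exists s'; split=> //; rewrite ltn_neqAle; apply/andP; split.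
      apply/eqP => e; move: (isource_not_sink ss').
      by rewrite -(val_inj e : k = s') kk.
    by move: b kltn (ltn s'); rewrite /between /=; clear; lia.
  case/negP: (negbT nlast); rewrite lastE linn c0 andbT; apply/forallP => t.
  apply/implyP => tt; rewrite leqNgt; apply/negP => tk.
  have bt : between k t ord_max by rewrite /between /=; move: tk (ltn t); clear; lia.
  by rewrite (all t tt bt) ltnn in tk.
have /andP[srcs _] := ss; have /andP[srcs' _] := ss'.
have uniq t : source sh t -> conn t k -> t < k -> t = s.
  by move=> tt tk lt; apply: (source_unique tt srcs tk sk); rewrite lt ls.
have uniq' t : source sh t -> conn t k -> k < t -> t = s'.
  move=> tt tk lt; apply: (source_unique tt srcs' tk sk').
  by move: lt ls'; clear; lia.
have -> : ~~ reached sh k = ~~ nz sh s k && ~~ nz sh s' k.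
  rewrite -negb_or; congr (~~ _); apply/existsP/orP => [[t /andP[tt tk]]|].
    have /andP[srct _] := tt; have ctk := nz_conn tk.
    case: (ltngtP t k) => [lt|lt|e].
    - by left; rewrite -(uniq t).
    - by right; rewrite -(uniq' t).
    - by move: (isource_not_sink tt); rewrite (val_inj e : t = k) kk.
  by case=> [h|h]; [exists s; rewrite ss | exists s'; rewrite ss'].
rewrite -(restr_left ls sk) -(restr_right ls' sk').
apply/existsP/andP => [[t /existsP[t' /and5P[tt tt' /andP[lt lt'] lin1 /and3P[lin2 r1 r2]]]]|[r1 r2]].
  rewrite !is_sourceE in tt tt'.
  rewrite (linear_sink_left kk lt) in lin1; rewrite (linear_sink_right kk lt') in lin2.
  by rewrite -(uniq t) // -(uniq' t').
exists s; apply/existsP; exists s'; rewrite !is_sourceE srcs srcs' ls ls' /=.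
by rewrite (linear_sink_left kk ls) (linear_sink_right kk ls') sk sk' r1 r2.
Qed.

End SinkIdeals.

Theorem theorem1p2 (K : fieldType) (n : nat) (Q : quiverA n)
    (I : admissible_ideal K Q) :
  (num_sinks Q = 1%N ->
     num_iso_classes (@in_Det K (bqalg I)) (2 * n.+1 - 2)%N) /\
  ((2 <= num_sinks Q)%N ->
     num_iso_classes (@in_Det K (bqalg I))
       (2 * n.+1 - num_inner_sources Q - num_nonzero_sink_ideals I - 1)%N).
Proof.
have main := num_determined (X := bq_sys I) (fun _ => erefl).
have count := num_path_ends (bq_shape I).
have pE : num_inner_sources Q = #|[pred k | isource (bq_shape I) k]|.
  by apply: eq_card => k; rewrite !inE (inner_sourceE I).
set a := #|[pred k | `[< _ >]]| in main count; rewrite -pE in count.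
set b := #|_| in count.
split=> [r1|r2].
  have p0 : num_inner_sources Q = 0%N.
    rewrite pE; apply: eq_card0 => s; rewrite inE; apply/negP => /isource_two_sinks.
    case=> k [k' [kk kk' nkk]]; have : (1 < num_sinks Q)%N; last by rewrite r1.
    by apply/card_gt1P; exists k, k'; rewrite !inE !(is_sinkE I).
  (* Without inner sources the only sink is unreached. *)
  have b1 : b = 1%N.
    rewrite -r1; apply: eq_card => k; rewrite !inE (is_sinkE I).
    case: (sink _ k) => //=; apply/existsP => -[s /andP[ss _]].
    by have := card0_eq (etrans (esym pE) p0) s; rewrite inE ss.
  rewrite p0 b1 in count; congr num_iso_classes: main; move: count; clear; lia.
have bq : b = num_nonzero_sink_ideals I.
  apply: eq_card => k; rewrite !inE (is_sinkE I).
  by have [kk|] //= := boolP (sink _ k); rewrite sink_ideal_reached // (is_sinkE I).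
rewrite bq in count.
(* There are [n] arrows, while [a] is [n.+1] minus the inner sources and the unreached sinks. *)
suff <- : (n + a = 2 * n.+1 - num_inner_sources Q - num_nonzero_sink_ideals I - 1)%N by [].
by move: count; clear; lia.
Qed.
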